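(* Let $m\ge2$ be an integer and let $X_0^*$ be a random variable with values in $\{1,2,\dots\}$ such that $\mathbf P(X_0^*=k)\sim c_0\, m^{-k}k^{-\alpha}$ as $k\to\infty$, for some constant $0<c_0<\infty$ and some $2<\alpha\le 4$. Then, with $\nu=\nu(\alpha):=\frac{1}{\alpha-2}$, $$F_\infty(p)=\exp\Big(-\frac{1}{(p-p_c)^{\nu+o(1)}}\Big),\qquad p\downarrow p_c .$$
   Context: Recursive system: fix an integer $m\ge2$. For a $\mathbb Z_+$-valued random variable $X_0$, define recursively the laws of $X_n$, $n\ge0$, by requiring that $X_{n+1}$ has the law of $(X_{n,1}+\cdots+X_{n,m}-1)^+$, where $X_{n,1},\dots,X_{n,m}$ are independent copies of $X_n$. The free energy is $F_\infty:=\lim_{n\to\infty}\mathbf E(X_n)/m^n$. Parametrized family: given $X_0^*$ and $p\in[0,1]$, let $X_0$ have law $(1-p)\delta_0+p\,P_{X_0^*}$, and let $F_\infty(p)$ denote the free energy of the resulting system. $p_c=p_c(X_0^* ):=\frac{1}{1+\mathbf E\{[(m-1)X_0^*-1]m^{X_0^*}\}}$ (which is in $(0,1)$ under the present hypothesis); it is known that $F_\infty(p)>0$ for $p>p_c$ and $F_\infty(p)=0$ for $p\le p_c$. Notation $a_k\sim b_k$ means $a_k/b_k\to1$. *)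

(* Defs.v *)
(* laws of Z_+-valued random variables are functions nat -> R. *)
From Stdlib Require Import Reals Lra.
Open Scope R_scope.

Definition conv (f g : nat -> R) (k : nat) : R :=
  sum_f_R0 (fun j => f j * g (k - j)%nat) k.

Fixpoint conv_pow (f : nat -> R) (n : nat) : nat -> R :=
  match n with
  | O => fun k => if Nat.eqb k 0 then 1 else 0
  | S n' => conv f (conv_pow f n')
  end.

(* One step of the recursive system: law of (X_1 + ... + X_m - 1)^+ . *)
Definition step (m : nat) (f : nat -> R) (k : nat) : R :=
  let s := conv_pow f m in
  match k with
  | O => s 0%nat + s 1%nat
  | S k' => s (S (S k'))
  end.

Fixpoint law (m : nat) (f0 : nat -> R) (n : nat) : nat -> R :=
  match n with
  | O => f0
  | S n' => step m (law m f0 n')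
  end.

(* Law of X_0 = (1-p) delta_0 + p P_{X_0^*}. *)
Definition mix (p : R) (q : nat -> R) (k : nat) : R :=
  (if Nat.eqb k 0 then 1 - p else 0) + p * q k.

Definition is_free_energy (m : nat) (f0 : nat -> R) (F : R) : Prop :=
  exists E : nat -> R,
    (forall n, infinite_sum (fun k => INR k * law m f0 n k) (E n)) /\
    Un_cv (fun n => E n / INR m ^ n) F.

(* Main.v *)
(** Let G_n(s) = E s^(X_n) and A_n(s) = E[((s-1) X_n - 1) s^(X_n)]. The recursion
    gives A_(n+1)(m) = A_n(m) G_n(m)^(m-1), and A_0(m) = (1+S)(p - p_c), so the system
    stays near criticality until the product D_n of the G_k(m)^(m-1), k < n, is of
    order 1/(p - p_c); from that time on the mean of X_n takes off like m^n.

    Upper bound on F.  A single large value of X_0 survives n steps, so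
    E[m^(X_n); X_n > k] is at least of order D_n E[m^(X_0); X_0 > k+n] = D_n k^(1-alpha)
    for k of order n.  As long as A_n(m) <= 1 the left side is O(1/k), whence
    D_n = O(n^(alpha-2)): nothing happens before time (p - p_c)^(-nu).

    Lower bound on F.  Truncate X_0 at l, slightly more than (p - p_c)^(-nu): the
    system is still supercritical, and T_n = A_n''(m) starts below A_0(m) l^2.
    Since T_n / D_n hardly grows and A_n'(m)^2 <= C T_n, the ratio r_n = A_n'(m)/A_n(m)
    obeys a Riccati inequality r_(n+1) <= r_n - r_n^2/(C l^2), hence r_n <= C l
    for some n <= l.  Then A_n(s) > 0 for s = m - c/l.  If the mean stayed bounded up to
    time N, then P(X_n > x) = O(m^(-x)) for n + x <= N, so that sending all values larger
    than l^(1+o(1)) to 0 costs superpolynomially little at s; but A_n(s) of this bounded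
    system grows exponentially, which contradicts the same tail estimate. *)

Require Import Defs.
From Stdlib Require Import Reals Lra Lia Psatz.
From Coquelicot Require Import Coquelicot.
From mathcomp Require all_boot all_order all_algebra ring lra Rstruct.
Open Scope R_scope.

(** For every n, F lies between (E X_n - 1)/m^n and E X_n/m^n, so each bound needs one good time n
    only. The positive part leaves a stray atom, the probability that the m summands are all 0, in
    the recursions for G_n and G_n'. In A_n it cancels for every s, leaving A_(n+1)(s) = (A_n(s) +
    (m-s)(s-1) G_n'(s)) G_n(s)^(m-1). At s = m this is purely multiplicative. At s < m the extra
    term is a drift of at least (m-s)/m once A_n(s) >= 0, and it pays for the values sent to 0.
    These have to be sent to 0 at every step: growth of A_n(s) needs G_n(s) - 1 bounded below, which
    comes from a bound on the support. The step preserves the stochastic order, so the truncated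
    system stays below the true one. Being finitely supported, it consists of polynomials, with
    formal derivatives. The contradiction is run in the direct sense: some coefficient of this
    system must exceed a multiple of m^(-i), hence so does a tail of X_n, and E X_(n+i) >= m^i P(X_n
    > i) then makes a mean large. Support bound and running time exceed l by factors (p-p_c)^(-d), d
    > 0, so that exponentials beat all powers. *)

Notation ser := (@is_series R_AbsRing R_NormedModule) (only parsing).

(** * Convergent series: algebra, comparison, tails *)

Lemma ser_plus (f g : nat -> R) (a b : R) : ser f a -> ser g b -> ser (fun k => f k + g k) (a + b).
Proof. exact (@is_series_plus R_AbsRing R_NormedModule f g a b). Qed.

Lemma ser_scal (c : R) (f : nat -> R) (a : R) : ser f a -> ser (fun k => c * f k) (c * a).
Proof. exact (@is_series_scal R_AbsRing R_NormedModule c f a). Qed.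

Lemma ser_ext (f g : nat -> R) (a : R) : (forall k, f k = g k) -> ser f a -> ser g a.
Proof. exact (@is_series_ext R_AbsRing R_NormedModule f g a). Qed.

Lemma ser_unique (f : nat -> R) (a b : R) : ser f a -> ser f b -> a = b.
Proof.
intros ha hb. rewrite <- (is_series_unique _ _ ha). exact (is_series_unique _ _ hb).
Qed.

Lemma ser_eq (f : nat -> R) (a b : R) : ser f a -> a = b -> ser f b.
Proof. intros h <-. exact h. Qed.

Lemma ser_shift (f : nat -> R) (a : R) : ser f a -> ser (fun k => f (S k)) (a - f 0%nat).
Proof.
intros h. apply (@is_series_incr_1 R_AbsRing R_NormedModule).
apply (ser_eq f a _ h). unfold plus; simpl; ring.
Qed.

Lemma ser_unshift (f : nat -> R) (a : R) : ser (fun k => f (S k)) a -> ser f (a + f 0%nat).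
Proof.
intros h. apply (@is_series_decr_1 R_AbsRing R_NormedModule).
apply (ser_eq _ a _ h). unfold plus, opp; simpl; ring.
Qed.

Lemma ser_partial_le (f : nat -> R) (a : R) n : ser f a -> (forall k, 0 <= f k) -> sum_f_R0 f n <= a.
Proof.
intros h hf. apply is_series_Reals in h. apply sum_incr; assumption.
Qed.

Lemma ser_ge0 (f : nat -> R) (a : R) : ser f a -> (forall k, 0 <= f k) -> 0 <= a.
Proof. intros h hf. apply Rle_trans with (2 := ser_partial_le _ _ 0%nat h hf). apply hf. Qed.

Lemma ser_le (f g : nat -> R) (a b : R) : ser f a -> ser g b -> (forall k, f k <= g k) -> a <= b.
Proof.
intros ha hb h.
assert (H : ser (fun k => g k + (-1) * f k) (b + (-1) * a)) by (apply ser_plus; [|apply ser_scal]; assumption).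
apply ser_ge0 in H; [lra|]. intros k; specialize (h k); lra.
Qed.

Lemma ser_dominated (f g : nat -> R) (b : R) : ser g b -> (forall k, 0 <= f k <= g k) -> exists a, ser f a /\ 0 <= a <= b.
Proof.
intros hb h.
assert (H : ex_series f).
{ apply (@ex_series_le R_AbsRing R_CompleteNormedModule f g).
  - intros n. unfold norm; simpl. unfold abs; simpl. rewrite Rabs_pos_eq; apply h.
  - exists b; exact hb. }
exists (Series f). apply Series_correct in H. split; [exact H|]. split.
- apply (ser_ge0 _ _ H). apply h.
- apply (ser_le _ _ _ _ H hb). apply h.
Qed.

Lemma ser_finite (f : nat -> R) n : (forall k, (n < k)%nat -> f k = 0) -> ser f (sum_f_R0 f n).
Proof.
intros h. apply is_series_Reals. intros e he. exists n. intros j hj.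
replace (sum_f_R0 f j) with (sum_f_R0 f n); [unfold Rdist; rewrite Rminus_diag, Rabs_R0; lra|].
induction j as [|j IH].
- replace n with 0%nat by lia. reflexivity.
- destruct (Nat.eq_dec n (S j)) as [->|hne]; [reflexivity|].
  simpl. rewrite <- IH by lia. rewrite h by lia. ring.
Qed.

Lemma ser_zero : ser (fun _ => 0) 0.
Proof. apply (ser_finite (fun _ => 0) 0). reflexivity. Qed.

(** The removed terms become 0 and the index is not shifted, so that a tail can be compared termwise
    with series over the same index. *)
Lemma ser_tail (f : nat -> R) (a : R) n : ser f a -> ser (fun k => if (k <=? n)%nat then 0 else f k) (a - sum_f_R0 f n).
Proof.
intros h.
assert (H : ser (fun k => if (k <=? n)%nat then f k else 0) (sum_f_R0 f n)).
{ replace (sum_f_R0 f n) with (sum_f_R0 (fun k => if (k <=? n)%nat then f k else 0) n).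
  - apply ser_finite. intros k hk. destruct (Nat.leb_spec k n); [lia|reflexivity].
  - apply sum_eq. intros k hk. destruct (Nat.leb_spec k n); [reflexivity|lia]. }
apply ser_eq with (a + (-1) * sum_f_R0 f n); [|ring].
apply ser_ext with (2 := ser_plus _ _ _ _ h (ser_scal (-1) _ _ H)).
intros k. simpl. destruct (Nat.leb_spec k n); ring.
Qed.

(** * Convolution and the stochastic order *)

Definition nonneg (f : nat -> R) := forall k, 0 <= f k.

Lemma sum_nonneg f n : nonneg f -> 0 <= sum_f_R0 f n.
Proof. intros h. apply cond_pos_sum. exact h. Qed.

Lemma sum_mono f n k : nonneg f -> (n <= k)%nat -> sum_f_R0 f n <= sum_f_R0 f k.
Proof.
intros h hk. induction hk as [|k hk IH]; [lra|]. simpl. specialize (h (S k)). lra.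
Qed.

Lemma sum_rev h n : sum_f_R0 h n = sum_f_R0 (fun j => h (n - j)%nat) n.
Proof.
revert h; induction n as [|n IH]; intros h; [reflexivity|].
rewrite (decomp_sum (fun j => h (S n - j)%nat)) by lia. simpl pred.
simpl sum_f_R0 at 1. rewrite IH. rewrite Nat.sub_0_r. rewrite Rplus_comm. f_equal.
Qed.

Lemma conv_comm f g k : conv f g k = conv g f k.
Proof.
unfold conv. rewrite sum_rev. apply sum_eq. intros j hj.
replace (k - (k - j))%nat with j by lia. ring.
Qed.

(** Conditioning on the first summand; in this form the distribution function of a sum is visibly
    monotone in that of the second summand. *)
Lemma sum_conv f g k : sum_f_R0 (conv f g) k = sum_f_R0 (fun j => f j * sum_f_R0 g (k - j)) k.
Proof.
induction k as [|k IH]; [reflexivity|].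
rewrite tech5, IH. unfold conv. rewrite !tech5, Nat.sub_diag, <- Rplus_assoc.
f_equal. rewrite <- plus_sum. apply sum_eq. intros j hj.
replace (S k - j)%nat with (S (k - j)) by lia. rewrite tech5. ring.
Qed.

Lemma conv_nonneg f g : nonneg f -> nonneg g -> nonneg (conv f g).
Proof. intros hf hg k. apply cond_pos_sum. intros j. apply Rmult_le_pos; auto. Qed.

Lemma conv_pow_nonneg f n : nonneg f -> nonneg (conv_pow f n).
Proof.
intros hf. induction n as [|n IH].
- intros k; simpl. destruct (Nat.eqb k 0); lra.
- apply conv_nonneg; assumption.
Qed.

Lemma step_nonneg m f : nonneg f -> nonneg (step m f).
Proof.
intros hf k. assert (h := conv_pow_nonneg f m hf).
destruct k; simpl; [generalize (h 0%nat) (h 1%nat); lra | apply h].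
Qed.

Lemma law_nonneg m f n : nonneg f -> nonneg (law m f n).
Proof. intros hf. induction n; simpl; [|apply step_nonneg]; assumption. Qed.

(** [dom f g]: the law [f] is stochastically larger than [g]. *)
Definition dom (f g : nat -> R) := forall k, sum_f_R0 f k <= sum_f_R0 g k.

(** One argument is replaced at a time, the other one serving as nonnegative weights; commutativity
    brings the first argument into second place. *)
Lemma dom_conv f f' g g' : nonneg f -> nonneg g' -> dom f f' -> dom g g' -> dom (conv f g) (conv f' g').
Proof.
intros hf hg' h1 h2 k. apply Rle_trans with (sum_f_R0 (conv f g') k).
- rewrite !sum_conv. apply sum_Rle. intros j hj. apply Rmult_le_compat_l; [apply hf|apply h2].
- assert (e : forall u, sum_f_R0 (conv u g') k = sum_f_R0 (conv g' u) k)
    by (intros u; apply sum_eq; intros; apply conv_comm).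
  rewrite !e, !sum_conv. apply sum_Rle. intros j hj. apply Rmult_le_compat_l; [apply hg'|apply h1].
Qed.

Lemma dom_conv_pow f g n : nonneg f -> nonneg g -> dom f g -> dom (conv_pow f n) (conv_pow g n).
Proof.
intros hf hg h. induction n as [|n IH]; [intros k; apply Rle_refl|].
apply dom_conv; auto. apply conv_pow_nonneg; assumption.
Qed.

Lemma sum_step m f k : sum_f_R0 (step m f) k = sum_f_R0 (conv_pow f m) (S k).
Proof.
induction k as [|k IH]; [reflexivity|].
rewrite tech5, IH. reflexivity.
Qed.

Lemma dom_step m f g : nonneg f -> nonneg g -> dom f g -> dom (step m f) (step m g).
Proof. intros hf hg h k. rewrite !sum_step. apply dom_conv_pow; assumption. Qed.

Lemma sum_conv_le f g k : nonneg f -> nonneg g ->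
  sum_f_R0 (conv f g) k <= sum_f_R0 f k * sum_f_R0 g k.
Proof.
intros hf hg. rewrite sum_conv, (Rmult_comm (sum_f_R0 f k)), scal_sum. apply sum_Rle. intros j hj.
apply Rmult_le_compat_l; [apply hf|]. apply sum_mono; [assumption|lia].
Qed.

(** * Generating functions and first moments along one step *)

Definition wt (s : R) (f : nat -> R) (k : nat) : R := f k * s ^ k.

Lemma wt_nonneg s f : 0 <= s -> nonneg f -> nonneg (wt s f).
Proof. intros hs hf k. apply Rmult_le_pos; [apply hf|apply pow_le; assumption]. Qed.

Lemma wt_conv s f g k : wt s (conv f g) k = conv (wt s f) (wt s g) k.
Proof.
unfold wt, conv. rewrite Rmult_comm, scal_sum. apply sum_eq. intros j hj.
replace (s ^ k) with (s ^ j * s ^ (k - j)); [ring|].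
rewrite <- pow_add. f_equal. lia.
Qed.

Lemma ser_wt_conv s f g a b : 0 <= s -> nonneg f -> nonneg g ->
  ser (wt s f) a -> ser (wt s g) b -> ser (wt s (conv f g)) (a * b).
Proof.
intros hs hf hg ha hb.
apply ser_ext with (conv (wt s f) (wt s g)).
- intros k. symmetry. apply wt_conv.
- apply is_series_mult_pos; auto; intros k; apply wt_nonneg; auto.
Qed.

Lemma ser_wt_pow s f a n : 0 <= s -> nonneg f -> ser (wt s f) a -> ser (wt s (conv_pow f n)) (a ^ n).
Proof.
intros hs hf ha. induction n as [|n IH].
-
  apply ser_eq with (sum_f_R0 (wt s (conv_pow f 0)) 0).
  + apply ser_finite. intros k hk. unfold wt; simpl. destruct (Nat.eqb_spec k 0); [lia|ring].
  + unfold wt; simpl; ring.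
- simpl. apply ser_wt_conv; auto. apply conv_pow_nonneg; auto.
Qed.

Lemma ser_moment_conv s f g a b a1 b1 : 0 <= s -> nonneg f -> nonneg g ->
  ser (wt s f) a -> ser (wt s g) b ->
  ser (fun k => INR k * wt s f k) a1 -> ser (fun k => INR k * wt s g k) b1 ->
  ser (fun k => INR k * wt s (conv f g) k) (a1 * b + a * b1).
Proof.
intros hs hf hg ha hb ha1 hb1.
assert (wf := wt_nonneg s f hs hf). assert (wg := wt_nonneg s g hs hg).
assert (w1 : forall h, nonneg (wt s h) -> nonneg (fun k => INR k * wt s h k)).
{ intros h hh k. apply Rmult_le_pos; [apply pos_INR|apply hh]. }
apply ser_ext with (fun k => conv (fun k => INR k * wt s f k) (wt s g) k + conv (wt s f) (fun k => INR k * wt s g k) k).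
- intros k. rewrite wt_conv. unfold conv. rewrite <- plus_sum, scal_sum. apply sum_eq.
  intros j hj. rewrite minus_INR by lia. ring.
- apply ser_plus; apply is_series_mult_pos; auto; intros k; try apply wf; try apply wg; apply w1; auto.
Qed.

Lemma ser_moment_pow s f a a1 n : 0 <= s -> nonneg f -> ser (wt s f) a ->
  ser (fun k => INR k * wt s f k) a1 ->
  ser (fun k => INR k * wt s (conv_pow f n) k) (INR n * a ^ (pred n) * a1).
Proof.
intros hs hf ha ha1. induction n as [|n IH].
- apply ser_eq with 0; [|simpl; ring]. apply ser_ext with (fun _ => 0); [|apply ser_zero].
  intros k; unfold wt; simpl. destruct (Nat.eqb_spec k 0) as [->|]; [simpl|]; ring.
- apply ser_eq with (a1 * a ^ n + a * (INR n * a ^ pred n * a1)).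
  + change (conv_pow f (S n)) with (conv f (conv_pow f n)).
    apply ser_moment_conv; auto; [apply conv_pow_nonneg; auto | apply ser_wt_pow; auto].
  + rewrite S_INR. destruct n; simpl; ring.
Qed.

(** Subtracting 1 divides by [s], except that the value 0 of the sum stays at 0. The atom
    [conv_pow f m 0] that corrects for this is never estimated, since it cancels later. *)
Lemma ser_wt_step s m f a : 0 < s -> nonneg f -> ser (wt s f) a ->
  ser (wt s (step m f)) ((a ^ m - conv_pow f m 0%nat) / s + conv_pow f m 0%nat).
Proof.
intros hs hf ha.
assert (h := ser_shift _ _ (ser_wt_pow s f a m (Rlt_le _ _ hs) hf ha)).
apply (ser_scal (/ s)) in h.
assert (h0 : ser (fun k => if Nat.eqb k 0 then conv_pow f m 0%nat else 0) (conv_pow f m 0%nat)).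
{ apply (ser_finite (fun k => if Nat.eqb k 0 then conv_pow f m 0%nat else 0) 0).
  intros k hk. destruct k; [lia|reflexivity]. }

apply ser_eq with (/ s * (a ^ m - wt s (conv_pow f m) 0%nat) + conv_pow f m 0%nat).
- apply ser_ext with (2 := ser_plus _ _ _ _ h h0).
  intros k. unfold wt. destruct k; simpl; field; lra.
- unfold wt; simpl; field; lra.
Qed.

Lemma ser_moment_step s m f a a1 : 0 < s -> nonneg f -> ser (wt s f) a ->
  ser (fun k => INR k * wt s f k) a1 ->
  ser (fun k => INR k * wt s (step m f) k)
    ((INR m * a ^ (pred m) * a1 - a ^ m + conv_pow f m 0%nat) / s).
Proof.
intros hs hf ha ha1. assert (hs' := Rlt_le _ _ hs).
assert (h := ser_shift _ _ (ser_wt_pow s f a m hs' hf ha)).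
assert (h1 := ser_shift _ _ (ser_moment_pow s f a a1 m hs' hf ha ha1)).
apply ser_eq with (/ s * ((INR m * a ^ pred m * a1 - INR 0 * wt s (conv_pow f m) 0) + (-1) * (a ^ m - wt s (conv_pow f m) 0%nat))).
- apply ser_ext with (2 := ser_scal (/ s) _ _ (ser_plus _ _ _ _ h1 (ser_scal (-1) _ _ h))).
  intros k. rewrite S_INR. unfold wt. destruct k; simpl; field; lra.
- unfold wt; simpl; field; lra.
Qed.

(** * Excess over a level, and bounds for the free energy at a finite time *)

Definition excess (c : nat) (f : nat -> R) (k : nat) : R := INR (k - c) * f k.

(** Superadditivity of x |-> (x - c)^+ . *)
Lemma excess_conv c f g a b u v : nonneg f -> nonneg g -> ser f a -> ser g b ->
  ser (excess c f) u -> ser (excess c g) v -> forall w, ser (excess c (conv f g)) w ->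
  u * b + a * v <= w.
Proof.
intros hf hg ha hb hu hv w hw.
assert (e : forall h, nonneg h -> nonneg (excess c h)) by (intros h hh k; apply Rmult_le_pos; [apply pos_INR|apply hh]).
assert (H1 : ser (conv (excess c f) g) (u * b)) by (apply is_series_mult_pos; auto; apply e; auto).
assert (H2 : ser (conv f (excess c g)) (a * v)) by (apply is_series_mult_pos; auto; apply e; auto).
apply (ser_le _ _ _ _ (ser_plus _ _ _ _ H1 H2) hw).
intros k. unfold excess at 3. unfold conv. rewrite <- plus_sum, scal_sum. apply sum_Rle.
intros j hj. unfold excess.
assert (INR (j - c) + INR (k - j - c) <= INR (k - c)).
{ rewrite <- plus_INR. apply le_INR. lia. }
assert (0 <= f j * g (k - j)%nat) by (apply Rmult_le_pos; auto).
nra.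
Qed.

Lemma ser_excess_ex c f a : nonneg f -> ser (fun k => INR k * f k) a ->
  exists u, ser (excess c f) u /\ 0 <= u.
Proof.
intros hf h. destruct (ser_dominated (excess c f) _ _ h) as [u [hu [h0 _]]].
- intros k. unfold excess. split.
  + apply Rmult_le_pos; [apply pos_INR|apply hf].
  + apply Rmult_le_compat_r; [apply hf|]. apply le_INR. lia.
- exists u; split; assumption.
Qed.

Lemma wt1 f k : wt 1 f k = f k.
Proof. unfold wt. rewrite pow1. ring. Qed.

Lemma ser_wt1 f a : ser f a -> ser (wt 1 f) a.
Proof. apply ser_ext. intros k. symmetry. apply wt1. Qed.

Lemma ser_mom1 f a : ser (fun k => INR k * f k) a -> ser (fun k => INR k * wt 1 f k) a.
Proof. apply ser_ext. intros k. rewrite wt1. reflexivity. Qed.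

Lemma ser_of_wt1 f a : ser (wt 1 f) a -> ser f a.
Proof. apply ser_ext. intros k. apply wt1. Qed.

Lemma ser_of_mom1 f a : ser (fun k => INR k * wt 1 f k) a -> ser (fun k => INR k * f k) a.
Proof. apply ser_ext. intros k. rewrite wt1. reflexivity. Qed.

Lemma excess_pow c f n u e w : nonneg f -> ser f 1 -> ser (fun k => INR k * f k) e ->
  ser (excess c f) u -> ser (excess c (conv_pow f n)) w -> INR n * u <= w.
Proof.
intros hf h1 he hu. revert w. induction n as [|n IH]; intros w hw.
- rewrite Rmult_0_l. apply (ser_ge0 _ _ hw). intros k. apply Rmult_le_pos; [apply pos_INR|apply conv_pow_nonneg; auto].
- assert (hp : nonneg (conv_pow f n)) by (apply conv_pow_nonneg; auto).
  assert (hm : ser (fun k => INR k * conv_pow f n k) (INR n * 1 ^ pred n * e)).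
  { apply ser_of_mom1. apply ser_moment_pow; auto; [lra | apply ser_wt1; auto | apply ser_mom1; auto]. }
  assert (h1n : ser (conv_pow f n) 1).
  { apply ser_of_wt1. apply ser_eq with (1 ^ n); [|apply pow1]. apply ser_wt_pow; auto; [lra|apply ser_wt1; auto]. }
  destruct (ser_excess_ex c _ _ hp hm) as [v [hv _]].
  specialize (IH v hv).
  assert (H := excess_conv c f (conv_pow f n) 1 1 u v hf hp h1 h1n hu hv w hw).
  rewrite S_INR. lra.
Qed.

(** The shift by 1 lowers the level from [S c] to [c]; the positive part is harmless because a sum
    equal to 0 has no excess on either side. *)
Lemma excess_step c m f u e w : nonneg f -> ser f 1 -> ser (fun k => INR k * f k) e ->
  ser (excess (S c) f) u -> ser (excess c (step m f)) w -> INR m * u <= w.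
Proof.
intros hf h1 he hu hw. apply (excess_pow (S c) f m u e w hf h1 he hu).
apply ser_eq with (w + excess (S c) (conv_pow f m) 0%nat).
- apply ser_unshift. apply ser_ext with (2 := hw).
  intros k. unfold excess. destruct k; simpl; [rewrite !Rmult_0_l; reflexivity|reflexivity].
- unfold excess. simpl. ring.
Qed.

Section System.
Variables (m : nat) (f0 : nat -> R) (e0 : R).
Hypotheses (hm : (2 <= m)%nat) (hf0 : nonneg f0) (h1 : ser f0 1)
  (he0 : ser (fun k => INR k * f0 k) e0).
Notation X n := (law m f0 n).

Lemma m_ge2 : 2 <= INR m.
Proof. replace 2 with (INR 2) by (simpl; ring). apply le_INR. exact hm. Qed.

Lemma law_mass n : ser (X n) 1.
Proof.
induction n as [|n IH]; [exact h1|]. simpl. apply ser_of_wt1.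
apply ser_eq with ((1 ^ m - conv_pow (X n) m 0%nat) / 1 + conv_pow (X n) m 0%nat).
- apply ser_wt_step; [lra | apply law_nonneg; exact hf0 | apply ser_wt1; exact IH].
- rewrite pow1. field.
Qed.

Lemma mean_step n e : ser (fun k => INR k * X n k) e ->
  ser (fun k => INR k * X (S n) k) (INR m * e - 1 + conv_pow (X n) m 0%nat).
Proof.
intros he. apply ser_of_mom1.
apply ser_eq with ((INR m * 1 ^ pred m * e - 1 ^ m + conv_pow (X n) m 0%nat) / 1).
- apply ser_moment_step; [lra | apply law_nonneg; exact hf0 | apply ser_wt1; apply law_mass | apply ser_mom1; exact he].
- rewrite !pow1. field.
Qed.

Definition mean n := Series (fun k => INR k * X n k).

Lemma mean_ser n : ser (fun k => INR k * X n k) (mean n).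
Proof.
apply Series_correct. induction n as [|n [e IH]]; [exists e0; exact he0|].
exists (INR m * e - 1 + conv_pow (X n) m 0%nat). apply mean_step. exact IH.
Qed.

Lemma mean_ge0 n : 0 <= mean n.
Proof.
apply (ser_ge0 _ _ (mean_ser n)). intros k. apply Rmult_le_pos; [apply pos_INR|apply law_nonneg; exact hf0].
Qed.

Lemma mean_S n : INR m * mean n - 1 <= mean (S n) <= INR m * mean n.
Proof.
assert (e := ser_unique _ _ _ (mean_ser (S n)) (mean_step n _ (mean_ser n))).
assert (hp : nonneg (conv_pow (X n) m)) by (apply conv_pow_nonneg, law_nonneg, hf0).
assert (hs : ser (conv_pow (X n) m) 1).
{ apply ser_of_wt1. apply ser_eq with (1 ^ m); [|apply pow1].
  apply ser_wt_pow; [lra | apply law_nonneg, hf0 | apply ser_wt1, law_mass]. }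
assert (h := ser_partial_le _ _ 0 hs hp). simpl in h. specialize (hp 0%nat). lra.
Qed.

(** Iteration of [excess_step]: each generation uses up one unit of the level and gains a factor
    [m]. *)
Lemma mean_excess n c u : ser (excess c (X n)) u -> INR m ^ c * u <= mean (n + c).
Proof.
revert n u. induction c as [|c IH]; intros n u hu.
- rewrite Nat.add_0_r. simpl. rewrite Rmult_1_l. right. apply (ser_unique _ _ _ hu).
  apply ser_ext with (2 := mean_ser n). intros k. unfold excess. rewrite Nat.sub_0_r. reflexivity.
- destruct (ser_excess_ex c (X (S n)) _ (law_nonneg _ _ _ hf0) (mean_ser (S n))) as [w [hw _]].
  specialize (IH _ _ hw). replace (n + S c)%nat with (S n + c)%nat by lia.
  apply Rle_trans with (2 := IH).
  assert (h := excess_step c m (X n) u (mean n) w (law_nonneg _ _ _ hf0) (law_mass n) (mean_ser n) hu hw).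
  simpl. rewrite (Rmult_comm (INR m)), Rmult_assoc.
  apply Rmult_le_compat_l; [apply pow_le; assert (H := m_ge2); lra | exact h].
Qed.

(** For integers, the indicator of [k > c] is at most (k - c)^+. Read backwards, an excessive tail
    certifies a large mean [c] generations later, which is how the lower bound reaches the free
    energy. *)
Lemma mean_tail n c : INR m ^ c * (1 - sum_f_R0 (X n) c) <= mean (n + c).
Proof.
assert (hn := law_nonneg m f0 n hf0).
destruct (ser_excess_ex c (X n) _ hn (mean_ser n)) as [u [hu _]].
apply Rle_trans with (2 := mean_excess n c u hu).
apply Rmult_le_compat_l; [apply pow_le; assert (H := m_ge2); lra |].
apply (ser_le _ _ _ _ (ser_tail _ _ c (law_mass n)) hu).
intros k. unfold excess. destruct (Nat.leb_spec k c) as [h|h].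
- apply Rmult_le_pos; [apply pos_INR|apply hn].
- rewrite <- (Rmult_1_l (X n k)) at 1. apply Rmult_le_compat_r; [apply hn|].
  replace 1 with (INR 1) by reflexivity. apply le_INR. lia.
Qed.

Lemma free_energy : exists F, is_free_energy m f0 F /\
  forall n, (mean n - 1) / INR m ^ n <= F <= mean n / INR m ^ n.
Proof.
assert (hm2 := m_ge2).
assert (hpow : forall n, 0 < INR m ^ n) by (intros n; apply pow_lt; lra).
assert (hdec : Un_decreasing (fun n => mean n / INR m ^ n)).
{ intros n. destruct (mean_S n) as [_ h]. apply Rmult_le_reg_r with (INR m ^ S n); [apply hpow|].
  unfold Rdiv. rewrite Rmult_assoc, Rinv_l by (apply Rgt_not_eq, hpow).
  replace (mean n * / INR m ^ n * INR m ^ S n) with (INR m * mean n); [lra|].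
  simpl. field. apply Rgt_not_eq, hpow. }
(* This is where [2 <= m] matters: the lower estimate m e - 1 for the next mean, less 1, is at least
   m (e - 1). *)
assert (hinc : Un_growing (fun n => (mean n - 1) / INR m ^ n)).
{ intros n. destruct (mean_S n) as [h _]. apply Rmult_le_reg_r with (INR m ^ S n); [apply hpow|].
  unfold Rdiv. rewrite (Rmult_assoc (mean (S n) - 1)), Rinv_l by (apply Rgt_not_eq, hpow).
  replace ((mean n - 1) * / INR m ^ n * INR m ^ S n) with (INR m * (mean n - 1)); [lra|].
  simpl. field. apply Rgt_not_eq, hpow. }
destruct (decreasing_cv (fun n => mean n / INR m ^ n) hdec) as [F hF].
{ exists 0. intros x [n ->]. unfold opp_seq. 
  assert (0 <= mean n / INR m ^ n) by (apply Rdiv_le_0_compat; [apply mean_ge0|apply hpow]). lra. }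
exists F. split.
- exists mean. split; [|exact hF]. intros n. apply is_series_Reals. apply mean_ser.
- intros n. split.
  + apply Rle_cv_lim with (fun _ => (mean n - 1) / INR m ^ n) (fun k => mean (k + n) / INR m ^ (k + n)).
    * intros k. apply Rle_trans with ((mean (k + n) - 1) / INR m ^ (k + n)).
      -- apply Rge_le, (growing_prop (fun n => (mean n - 1) / INR m ^ n)); [exact hinc|lia].
      -- unfold Rdiv. apply Rmult_le_compat_r; [left; apply Rinv_0_lt_compat, hpow|lra].
    * intros e he. exists 0%nat. intros. unfold Rdist. rewrite Rminus_diag, Rabs_R0. exact he.
    * intros e he. destruct (hF e he) as [N hN]. exists N. intros k hk. apply hN. lia.
  + apply (decreasing_ineq (fun n => mean n / INR m ^ n)); assumption.
Qed.
End System.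

(** * Elementary inequalities for powers *)

Lemma pow_sub_ge (x y : R) n : 0 <= y -> y <= x -> INR (S n) * (x - y) * y ^ n <= x ^ S n - y ^ S n.
Proof.
intros hy hxy. induction n as [|n IH]; [simpl; lra|].
assert (hyn : 0 <= y ^ S n) by (apply pow_le; exact hy).
assert (hp : y ^ S n <= x ^ S n) by (apply pow_incr; lra).
change (x ^ S (S n)) with (x * x ^ S n). change (y ^ S (S n)) with (y * y ^ S n).
rewrite (S_INR (S n)).
replace ((INR (S n) + 1) * (x - y) * y ^ S n) with (y * (INR (S n) * (x - y) * y ^ n) + (x - y) * y ^ S n)
  by (simpl; ring).
apply Rle_trans with (y * (x ^ S n - y ^ S n) + (x - y) * y ^ S n).
- apply Rplus_le_compat_r, Rmult_le_compat_l; assumption.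
- assert (0 <= (x - y) * (x ^ S n - y ^ S n)) by (apply Rmult_le_pos; lra). lra.
Qed.

Lemma bernoulli (x : R) n : 0 <= x <= 1 -> 1 - INR n * x <= (1 - x) ^ n.
Proof.
intros hx. induction n as [|n IH]; [simpl; lra|]. rewrite S_INR. simpl.
assert (0 <= INR n) by apply pos_INR.
assert (0 <= (1 - x) * ((1 - x) ^ n - (1 - INR n * x))) by (apply Rmult_le_pos; lra).
assert (0 <= INR n * (x * x)) by (apply Rmult_le_pos; nra). nra.
Qed.

Lemma sum_conv_pow_le f n k : nonneg f -> sum_f_R0 (conv_pow f n) k <= sum_f_R0 f k ^ n.
Proof.
intros hf. induction n as [|n IH].
- simpl. right. induction k as [|k IHk]; [reflexivity|]. rewrite tech5, IHk. simpl; ring.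
- apply Rle_trans with (sum_f_R0 f k * sum_f_R0 (conv_pow f n) k).
  + apply sum_conv_le; [exact hf|apply conv_pow_nonneg; exact hf].
  + simpl. apply Rmult_le_compat_l; [apply sum_nonneg; exact hf|exact IH].
Qed.

Lemma conv_ext f f' g g' k : (forall j, f j = f' j) -> (forall j, g j = g' j) -> conv f g k = conv f' g' k.
Proof. intros hf hg. apply sum_eq. intros j _. rewrite hf, hg. reflexivity. Qed.

Lemma wt_conv_pow s f n k : wt s (conv_pow f n) k = conv_pow (wt s f) n k.
Proof.
revert k; induction n as [|n IH]; intros k.
- unfold wt; simpl. destruct (Nat.eqb_spec k 0) as [->|]; simpl; ring.
- simpl conv_pow. rewrite wt_conv. apply conv_ext; [reflexivity|exact IH].
Qed.

(** * Weighted moments at [s = m], and the time during which [A] stays below 1 *)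

Section Weighted.
Variables (m : nat) (f0 : nat -> R) (g0 k0 : R).
Hypotheses (hm : (2 <= m)%nat) (hf0 : nonneg f0) (h1 : ser f0 1)
  (hg0 : ser (wt (INR m) f0) g0) (hk0 : ser (fun k => INR k * wt (INR m) f0 k) k0).
Notation M := (INR m).
Notation X n := (law m f0 n).

Lemma wt_moments n : exists g k, ser (wt M (X n)) g /\ ser (fun j => INR j * wt M (X n) j) k.
Proof.
assert (hM := m_ge2 m hm).
induction n as [|n [g [k [hg hk]]]]; [exists g0, k0; auto|].
exists ((g ^ m - conv_pow (X n) m 0%nat) / M + conv_pow (X n) m 0%nat).
exists ((M * g ^ pred m * k - g ^ m + conv_pow (X n) m 0%nat) / M).
split; [apply ser_wt_step | apply (ser_moment_step M m (X n) g k)]; auto; try lra; apply law_nonneg; exact hf0.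
Qed.

Definition Gs n := Series (wt M (X n)).
Definition Ks n := Series (fun j => INR j * wt M (X n) j).
Definition As n := (M - 1) * Ks n - Gs n.

Lemma Gs_ser n : ser (wt M (X n)) (Gs n).
Proof. apply Series_correct. destruct (wt_moments n) as [g [k [hg _]]]. exists g; exact hg. Qed.

Lemma Ks_ser n : ser (fun j => INR j * wt M (X n) j) (Ks n).
Proof. apply Series_correct. destruct (wt_moments n) as [g [k [_ hk]]]. exists k; exact hk. Qed.

(** The atom [c] of the sum at 0 contributes (m-1) c / m both to [(M - 1) * Ks (S n)] and to
    [Gs (S n)], and so drops out of the difference. *)
Lemma As_step n : As (S n) = As n * Gs n ^ pred m.
Proof.
assert (hM := m_ge2 m hm).
assert (hX := law_nonneg m f0 n hf0).
assert (hM0 : 0 < M) by lra.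
assert (e1 := ser_unique _ _ _ (Gs_ser (S n)) (ser_wt_step M m (X n) _ hM0 hX (Gs_ser n))).
assert (e2 := ser_unique _ _ _ (Ks_ser (S n)) (ser_moment_step M m (X n) _ _ hM0 hX (Gs_ser n) (Ks_ser n))).
unfold As. rewrite e1, e2. replace (Gs n ^ m) with (Gs n * Gs n ^ pred m); [field; lra|].
destruct m; [lia|reflexivity].
Qed.

Lemma Mpow_ge1 k : 1 <= M ^ k.
Proof. apply pow_R1_Rle. assert (hM := m_ge2 m hm). lra. Qed.

Lemma Gs_ge1 n : 1 <= Gs n.
Proof.
apply (ser_le _ _ _ _ (law_mass m f0 hf0 h1 n) (Gs_ser n)).
intros k. unfold wt. rewrite <- (Rmult_1_r (X n k)) at 1.
apply Rmult_le_compat_l; [apply law_nonneg; exact hf0|apply Mpow_ge1].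
Qed.

(** Termwise: for k >= 2 the weight (m-1) k - 1 is at least 1, and [M + 2] times the total mass pays
    for the values 0 and 1. *)
Lemma Gs_le n : Gs n <= As n + M + 2.
Proof.
assert (hM := m_ge2 m hm).
assert (H : ser (fun k => (M - 1) * (INR k * wt M (X n) k) + ((-1) * wt M (X n) k + (M + 2) * X n k))
   ((M - 1) * Ks n + ((-1) * Gs n + (M + 2) * 1))).
{ apply ser_plus; [|apply ser_plus]; apply ser_scal; [apply Ks_ser|apply Gs_ser|apply law_mass; assumption]. }
replace (As n + M + 2) with ((M - 1) * Ks n + (-1 * Gs n + (M + 2) * 1)) by (unfold As; ring).
apply (ser_le _ _ _ _ (Gs_ser n) H). intros k. unfold wt.
assert (hx := law_nonneg m f0 n hf0 k).
assert (hp := Mpow_ge1 k).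
destruct k as [|[|k]].
- set (x := X n 0%nat) in *. simpl INR. simpl pow. assert (0 <= M * x) by nra. lra.
- set (x := X n 1%nat) in *. simpl INR. simpl pow.
  assert (0 <= x * (M * (M - 2))) by (repeat apply Rmult_le_pos; lra). lra.
- set (y := M ^ S (S k)) in *. assert (2 <= INR (S (S k))) by (rewrite !S_INR; generalize (pos_INR k); lra).
  set (j := INR (S (S k))) in *.
  assert (0 <= (M - 1) * j - 2) by nra.
  assert (0 <= ((M - 1) * j - 2) * y) by nra.
  assert (0 <= X n (S (S k)) * (((M - 1) * j - 2) * y)) by nra.
  assert (0 <= X n (S (S k)) * (M + 2)) by nra. lra.
Qed.

Lemma Ks_le n : Ks n <= Rabs (As n) + As n + M + 2.
Proof.
assert (hM := m_ge2 m hm).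
assert (h := Gs_le n). assert (h' := Gs_ge1 n). assert (e : (M - 1) * Ks n = As n + Gs n) by (unfold As; ring).
assert (hK : 0 <= Ks n).
{ apply (ser_ge0 _ _ (Ks_ser n)). intros k. apply Rmult_le_pos; [apply pos_INR|apply wt_nonneg; [lra|apply law_nonneg; exact hf0]]. }
generalize (Rle_abs (As n)). nra.
Qed.

Fixpoint Dp n := match n with O => 1 | S n => Dp n * Gs n ^ pred m end.

Lemma As_Dp n : As n = As 0 * Dp n.
Proof. induction n as [|n IH]; [simpl; ring|]. rewrite As_step, IH. simpl. ring. Qed.

Lemma Dp_ge1 n : 1 <= Dp n.
Proof.
induction n as [|n IH]; simpl; [lra|]. assert (1 <= Gs n ^ pred m) by (apply pow_R1_Rle, Gs_ge1). nra.
Qed.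

Definition Pt n k := sum_f_R0 (wt M (X n)) k.
(** E[m^(X_n); X_n > k]. *)
Definition Vt n k := Gs n - Pt n k.

Lemma wtX_nonneg n : nonneg (wt M (X n)).
Proof. assert (hM := m_ge2 m hm). apply wt_nonneg; [lra|apply law_nonneg; exact hf0]. Qed.

Lemma Vt_ge0 n k : 0 <= Vt n k.
Proof. unfold Vt. assert (h := ser_partial_le _ _ k (Gs_ser n) (wtX_nonneg n)). unfold Pt. lra. Qed.

Lemma sum_wt_step n k : M * sum_f_R0 (wt M (X (S n))) k =
  sum_f_R0 (wt M (conv_pow (X n) m)) (S k) + (M - 1) * conv_pow (X n) m 0%nat.
Proof.
induction k as [|k IH].
- unfold wt. simpl. ring.
- rewrite tech5, Rmult_plus_distr_l, IH. rewrite (tech5 (wt M (conv_pow (X n) m)) (S k)).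
  unfold wt at 2 4. simpl law. simpl step. simpl pow. ring.
Qed.

(** One big jump: exactly one of the [m] summands exceeds [k + 1]. *)
Lemma Vt_step n k : Vt n (S k) * Pt n (S k) ^ pred m <= Vt (S n) k.
Proof.
assert (hM := m_ge2 m hm). assert (hX := law_nonneg m f0 n hf0).
assert (hM0 : 0 < M) by lra.
assert (e1 := ser_unique _ _ _ (Gs_ser (S n)) (ser_wt_step M m (X n) _ hM0 hX (Gs_ser n))).
assert (e2 := sum_wt_step n k).
assert (h2 : sum_f_R0 (wt M (conv_pow (X n) m)) (S k) <= Pt n (S k) ^ m).
{ apply Rle_trans with (2 := sum_conv_pow_le (wt M (X n)) m (S k) (wtX_nonneg n)).
  apply Req_le. apply sum_eq. intros i _. apply wt_conv_pow. }
assert (h3 : M * (Vt n (S k) * Pt n (S k) ^ pred m) <= Gs n ^ m - Pt n (S k) ^ m).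
{ assert (hP : 0 <= Pt n (S k)) by (apply sum_nonneg, wtX_nonneg).
  assert (hV := Vt_ge0 n (S k)). unfold Vt in *.
  destruct m as [|m']; [lia|]. simpl pred. rewrite <- Rmult_assoc. apply pow_sub_ge; lra. }
apply Rmult_le_reg_l with M; [lra|]. apply Rle_trans with (1 := h3).
unfold Vt at 1, Pt at 2. rewrite Rmult_minus_distr_l, e2, e1.
apply Rle_trans with (Gs n ^ m - sum_f_R0 (wt M (conv_pow (X n) m)) (S k)); [lra|].
right. field. lra.
Qed.

Lemma Vt_markov n k : INR (S k) * Vt n k <= Ks n.
Proof.
assert (hw := wtX_nonneg n).
apply (ser_le _ _ _ _ (ser_scal (INR (S k)) _ _ (ser_tail _ _ k (Gs_ser n))) (Ks_ser n)).
intros j. destruct (Nat.leb_spec j k) as [h|h].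
- rewrite Rmult_0_r. apply Rmult_le_pos; [apply pos_INR|apply hw].
- apply Rmult_le_compat_r; [apply hw|apply le_INR; lia].
Qed.

(** Iterates the one big jump while the level descends from [k + n] to [k]. All levels used exceed
    [b], so Markov's inequality bounds [Vt] there by C / (b+1); as [Gs] is at least 1, each factor
    [Pt] is at least (1 - C / (b+1)) [Gs], and the product recovers [Dp n] up to a power. *)
Lemma Vt_lower C b n : 0 <= C -> C <= INR (S b) -> (forall i, (i < n)%nat -> Ks i <= C) ->
  forall k, (b <= k)%nat ->
  Vt 0 (k + n) * Dp n * (1 - C / INR (S b)) ^ (pred m * n) <= Vt n k.
Proof.
intros hC hCb. assert (hb : 0 < INR (S b)) by (apply lt_0_INR; lia).
set (x := C / INR (S b)).
assert (hx : 0 <= x <= 1).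
{ unfold x. split; [apply Rdiv_le_0_compat; lra|]. apply Rmult_le_reg_r with (INR (S b)); [lra|].
  unfold Rdiv. rewrite Rmult_assoc, Rinv_l; lra. }
induction n as [|n IH]; intros hK k hk.
- rewrite Nat.add_0_r, Nat.mul_0_r. simpl. lra.
- assert (IHk := IH (fun i hi => hK i (Nat.lt_lt_succ_r _ _ hi)) (S k) (Nat.le_trans _ _ _ hk (Nat.le_succ_diag_r k))).
  apply Rle_trans with (2 := Vt_step n k).
  assert (hG := Gs_ge1 n).
  assert (hP : Gs n * (1 - x) <= Pt n (S k)).
  { assert (h := Vt_markov n (S k)). assert (hKn := hK n (Nat.lt_succ_diag_r n)).
    assert (hV := Vt_ge0 n (S k)).
    assert (hV2 : Vt n (S k) <= x).
    { apply Rmult_le_reg_l with (INR (S b)); [lra|]. unfold x.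
      replace (INR (S b) * (C / INR (S b))) with C by (field; lra).
      apply Rle_trans with (INR (S (S k)) * Vt n (S k)); [|lra].
      apply Rmult_le_compat_r; [exact hV|apply le_INR; lia]. }
    unfold Vt in *. nra. }
  replace (k + S n)%nat with (S k + n)%nat by lia.
  replace (pred m * S n)%nat with (pred m * n + pred m)%nat by lia.
  rewrite pow_add. simpl Dp.
  replace (Vt 0 (S k + n) * (Dp n * Gs n ^ pred m) * ((1 - x) ^ (pred m * n) * (1 - x) ^ pred m))
    with ((Vt 0 (S k + n) * Dp n * (1 - x) ^ (pred m * n)) * (Gs n * (1 - x)) ^ pred m)
    by (rewrite Rpow_mult_distr; ring).
  apply Rmult_le_compat; [| |exact IHk|].
  + assert (h1x : 0 <= (1 - x) ^ (pred m * n)) by (apply pow_le; lra).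
    assert (hD := Dp_ge1 n). assert (hV := Vt_ge0 0 (S k + n)).
    repeat apply Rmult_le_pos; lra.
  + apply pow_le. apply Rmult_le_pos; lra.
  + apply pow_incr. split; [apply Rmult_le_pos; lra|exact hP].
Qed.

(** With [b] this large compared with [n], Bernoulli's inequality keeps the lost power above 1/2,
    and Markov's inequality at time [n] caps what [Vt_lower] bounds from below. *)
Lemma Dp_bound C C2 b n : 0 <= C -> C <= INR (S b) -> 2 * (INR (pred m * n) * C) <= INR (S b) ->
  (forall i, (i < n)%nat -> Ks i <= C) -> Ks n <= C2 ->
  INR (S b) * Vt 0 (b + n) * Dp n <= 2 * C2.
Proof.
intros hC hCb hCn hK hC2. assert (hb : 0 < INR (S b)) by (apply lt_0_INR; lia).
assert (h := Vt_lower C b n hC hCb hK b (Nat.le_refl b)).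
assert (hm' := Vt_markov n b).
assert (hx : 0 <= C / INR (S b) <= 1).
{ split; [apply Rdiv_le_0_compat; lra|]. apply Rmult_le_reg_r with (INR (S b)); [lra|].
  unfold Rdiv. rewrite Rmult_assoc, Rinv_l; lra. }
assert (hB := bernoulli _ (pred m * n) hx).
assert (hx2 : INR (pred m * n) * (C / INR (S b)) <= / 2).
{ apply Rmult_le_reg_r with (INR (S b)); [lra|]. unfold Rdiv.
  rewrite !Rmult_assoc, Rinv_l, Rmult_1_r; lra. }
assert (hV := Vt_ge0 0 (b + n)). assert (hD := Dp_ge1 n).
assert (hVD : 0 <= Vt 0 (b + n) * Dp n) by (apply Rmult_le_pos; lra).
assert (h2 : Vt 0 (b + n) * Dp n * / 2 <= Vt n b).
{ apply Rle_trans with (2 := h). apply Rmult_le_compat_l; [exact hVD|lra]. }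
assert (INR (S b) * (Vt 0 (b + n) * Dp n * / 2) <= C2).
{ apply Rle_trans with (2 := hC2). apply Rle_trans with (2 := hm'). apply Rmult_le_compat_l; lra. }
lra.
Qed.

(** The numerator is twice a bound for [Ks] one step after [A <= 1]. The base 2m(m+4) + 1 is the
    ratio between the level at which the initial tail is used and the time n + 1 + kc. *)
Definition growth_const (c alpha : R) : R :=
  2 * (2 * (M + 3) ^ pred m + M + 2) / (c * Rpower (INR (2 * m * (m + 4) + 1)) (1 - alpha)).

Lemma As_le1 c alpha kc N : 0 < c -> 2 < alpha ->
  (forall k, (kc <= k)%nat -> (1 <= k)%nat -> c * Rpower (INR k) (1 - alpha) <= Vt 0 k) ->
  0 <= As 0 <= 1 ->
  As 0 * (growth_const c alpha * Rpower (INR (N + 1 + kc)) (alpha - 2)) <= 1 ->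
  forall n, (n <= N)%nat -> 0 <= As n <= 1.
Proof.
intros hc halpha hV hA hN. assert (hM := m_ge2 m hm).
induction n as [n IH] using Wf_nat.lt_wf_ind. intros hn.
assert (hA0 : 0 <= As n) by (rewrite As_Dp; apply Rmult_le_pos; [lra|generalize (Dp_ge1 n); lra]).
split; [exact hA0|].
set (C := INR (m + 4)). assert (eC : C = M + 4) by (unfold C; rewrite plus_INR; simpl; ring).
assert (hK : forall i, (i < n)%nat -> Ks i <= C).
{ intros i hi. assert (hAi := IH i hi ltac:(lia)). assert (h := Ks_le i).
  rewrite Rabs_pos_eq in h by lra. lra. }
set (C2 := 2 * (M + 3) ^ pred m + M + 2).
assert (hp : 1 <= (M + 3) ^ pred m) by (apply pow_R1_Rle; lra).
assert (hKn : Ks n <= C2).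
{ assert (h := Ks_le n). rewrite Rabs_pos_eq in h by lra.
  assert (As n <= (M + 3) ^ pred m); [|unfold C2; lra].
  destruct n as [|n]; [lra|]. assert (hAi := IH n ltac:(lia) ltac:(lia)).
  rewrite As_step. assert (hG := Gs_ge1 n). assert (hG' := Gs_le n).
  assert (Gs n ^ pred m <= (M + 3) ^ pred m) by (apply pow_incr; lra).
  assert (0 <= Gs n ^ pred m) by (apply pow_le; lra). nra. }
(* The factor 2m(m+4) gives 2(m-1) n C <= b + 1 with C = m + 4; including [kc] in [t] puts the level
   [b + n] into the range of [hV]. *)
set (t := (n + 1 + kc)%nat). set (b := (2 * m * (m + 4) * t)%nat).
assert (ht : (1 <= t)%nat) by (unfold t; lia).
assert (hbt : (t <= b)%nat) by (unfold b; nia).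
assert (hCb : C <= INR (S b)) by (apply le_INR; unfold b; nia).
assert (hCn : 2 * (INR (pred m * n) * C) <= INR (S b)).
{ unfold C. rewrite <- mult_INR. replace 2 with (INR 2) by (simpl; ring). rewrite <- mult_INR.
  apply le_INR. unfold b.
  assert (pred m * n <= m * t)%nat by (apply Nat.mul_le_mono; unfold t; lia). nia. }
assert (hD := Dp_bound C C2 b n ltac:(apply pos_INR) hCb hCn hK hKn).
assert (hVb := hV (b + n)%nat ltac:(unfold b, t; nia) ltac:(lia)).
set (B := INR (2 * m * (m + 4) + 1)).
assert (ht0 : 0 < INR t) by (apply lt_0_INR; lia).
assert (hB0 : 0 < B) by (apply lt_0_INR; lia).
assert (hbn : INR (b + n) <= B * INR t).
{ unfold B. rewrite <- mult_INR. apply le_INR. unfold b. assert (n <= t)%nat by (unfold t; lia). nia. }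
assert (hbn0 : 0 < INR (b + n)) by (apply lt_0_INR; lia).
assert (hpow : Rpower B (1 - alpha) * Rpower (INR t) (1 - alpha) <= Rpower (INR (b + n)) (1 - alpha)).
{ rewrite Rpower_mult_distr by lra.
  replace (1 - alpha) with (- (alpha - 1)) by ring. rewrite !Rpower_Ropp.
  apply Rinv_le_contravar; [apply exp_pos|]. apply Rle_Rpower_l; lra. }
assert (hDn := Dp_ge1 n).
assert (hRt : Rpower (INR t) (1 - alpha) * INR t = / Rpower (INR t) (alpha - 2)).
{ rewrite <- Rpower_Ropp. rewrite <- (Rpower_1 (INR t)) at 2 by lra. rewrite <- Rpower_plus. f_equal. ring. }
assert (hpB := exp_pos ((1 - alpha) * ln B)). fold (Rpower B (1 - alpha)) in hpB.
assert (hpt := exp_pos ((alpha - 2) * ln (INR t))). fold (Rpower (INR t) (alpha - 2)) in hpt.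
assert (hpt1 := exp_pos ((1 - alpha) * ln (INR t))). fold (Rpower (INR t) (1 - alpha)) in hpt1.
assert (hfin : Dp n <= growth_const c alpha * Rpower (INR t) (alpha - 2)).
{ unfold growth_const. fold B C2. 
  apply Rmult_le_reg_r with (c * Rpower B (1 - alpha) * / Rpower (INR t) (alpha - 2)).
  - repeat apply Rmult_lt_0_compat; try lra. apply Rinv_0_lt_compat; lra.
  - replace (2 * C2 / (c * Rpower B (1 - alpha)) * Rpower (INR t) (alpha - 2) * (c * Rpower B (1 - alpha) * / Rpower (INR t) (alpha - 2)))
      with (2 * C2) by (field; lra).
    apply Rle_trans with (2 := hD). rewrite <- hRt.
    rewrite (Rmult_comm (INR (S b) * Vt 0 (b + n))). apply Rmult_le_compat_l; [lra|].
    replace (c * Rpower B (1 - alpha) * (Rpower (INR t) (1 - alpha) * INR t)) with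
      (INR t * (c * (Rpower B (1 - alpha) * Rpower (INR t) (1 - alpha)))) by ring.
    apply Rmult_le_compat; [lra| |apply le_INR; lia|].
    + repeat apply Rmult_le_pos; lra.
    + apply Rle_trans with (2 := hVb). apply Rmult_le_compat_l; lra. }
rewrite As_Dp. apply Rle_trans with (2 := hN). apply Rmult_le_compat_l; [lra|].
apply Rle_trans with (1 := hfin). apply Rmult_le_compat_l.
- unfold growth_const. fold B C2. apply Rdiv_le_0_compat; [unfold C2; lra|]. apply Rmult_lt_0_compat; lra.
- apply Rle_Rpower_l; [lra|]. split; [lra|]. apply le_INR. unfold t; lia.
Qed.

Lemma mean_le_Ks n : mean m f0 n <= Ks n.
Proof.
assert (hM := m_ge2 m hm).
assert (h : ex_series (fun k => INR k * X n k)).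
{ destruct (ser_dominated (fun k => INR k * X n k) _ _ (Ks_ser n)) as [u [hu _]]; [|exists u; exact hu].
  intros k. assert (hx := law_nonneg m f0 n hf0 k). assert (hp := Mpow_ge1 k). assert (h0 := pos_INR k).
  unfold wt. split; [apply Rmult_le_pos; assumption|].
  apply Rmult_le_compat_l; [exact h0|]. rewrite <- (Rmult_1_r (X n k)) at 1. apply Rmult_le_compat_l; assumption. }
apply (ser_le _ _ _ _ (Series_correct _ h) (Ks_ser n)).
intros k. assert (hx := law_nonneg m f0 n hf0 k). assert (hp := Mpow_ge1 k). 
unfold wt. apply Rmult_le_compat_l; [apply pos_INR|].
rewrite <- (Rmult_1_r (X n k)) at 1. apply Rmult_le_compat_l; assumption.
Qed.
End Weighted.

(** * Finitely supported laws as polynomials *)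

Module Poly.
Import all_boot all_order all_algebra mathcomp.algebra_tactics.ring mathcomp.algebra_tactics.lra Rstruct.
Import Order.TTheory GRing.Theory Num.Theory.
Set Implicit Arguments.
Unset Strict Implicit.
Unset Printing Implicit Defensive.
Local Open Scope ring_scope.

Section Core.
Variable R : realFieldType.
Implicit Types P Q : {poly R}.
(** Writing [m] as [k.+2] builds in [2 <= m] and turns the exponents m - 1 and m - 2 into [k.+1] and
    [k]. *)
Variable k : nat.
Notation m := (k.+2).
Notation mr := (k.+2%:R : R).

Definition nneg P := forall i, 0 <= P`_i.

Definition pstep P := drop_poly 1 (P ^+ m) + ((P ^+ m)`_0)%:P.

Lemma mulX_pstep P : 'X * pstep P = P ^+ m + ((P ^+ m)`_0)%:P * ('X - 1).
Proof.
have := poly_take_drop 1 (P ^+ m).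
have -> : take_poly 1 (P ^+ m) = ((P ^+ m)`_0)%:P.
  apply/polyP => i; rewrite coef_take_poly coefC; by case: i.
rewrite expr1 /pstep.
move: (drop_poly 1 (P ^+ m)) => D; move: ((P ^+ m)`_0) => c.
by move: (P ^+ m) => Q <-; ring.
Qed.

Lemma coef_pstep P i :
  (pstep P)`_i = (P ^+ m)`_i.+1 + (if i == 0%N then (P ^+ m)`_0 else 0).
Proof. by rewrite coefD coef_drop_poly coefC addn1. Qed.

(** A law with finite support is identified with its generating polynomial [P];
    then [(Aop P).[s]] is E[((s-1) X - 1) s^X]. *)
Definition Aop P := 'X * ('X - 1) * P^`() - P.
(** Equal to [Aop P] at the point [m]; below it the difference (m - X)(X - 1) P' is the source of
    the drift. *)
Definition Wop P := mr%:P * ('X - 1) * P^`() - P.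

Lemma deriv_expE P n : (P ^+ n)^`() = n%:R%:P * P^`() * P ^+ n.-1.
Proof. by rewrite deriv_exp -mulr_natl polyC_natr mulrA. Qed.

(** For Q = [pstep P], [Aop Q] equals (X - 1)(X Q)' - X Q, and by [mulX_pstep] the atom [c]
    contributes c (X - 1) to both terms. *)
Lemma Aop_pstep P : Aop (pstep P) = Wop P * P ^+ k.+1.
Proof.
have e := mulX_pstep P; set c := ((P ^+ m)`_0)%:P in e.
have d : pstep P + 'X * (pstep P)^`() = mr%:P * P^`() * P ^+ k.+1 + c.
  have := congr1 (@deriv _) e.
  rewrite derivM derivX mul1r => ->.
  rewrite derivD derivM derivB derivX deriv_exp /= /c derivC (derivC 1).
  by rewrite -mulr_natl polyC_natr; ring.
have -> : Aop (pstep P) = ('X - 1) * (pstep P + 'X * (pstep P)^`()) - 'X * pstep P.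
  by rewrite /Aop; ring.
rewrite d e /Wop !exprS; ring.
Qed.

(** From here on [aV], [BV], [TV] are the quantities A, A', A'' at [m] of the overview. *)
Definition g P := P.[mr].
Definition g1 P := P^`().[mr].
Definition g2 P := P^`()^`().[mr].
Definition g3 P := P^`()^`()^`().[mr].
Definition aV P := (Aop P).[mr].
Definition BV P := (Aop P)^`().[mr].
Definition TV P := (Aop P)^`()^`().[mr].

Lemma aVE P : aV P = mr * (mr - 1) * g1 P - g P.
Proof. by rewrite /aV /Aop !hornerE. Qed.
Lemma BVE P : BV P = (mr - 1) * (2 * g1 P + mr * g2 P).
Proof.
rewrite /BV /Aop /g1 /g2 !derivE.
by rewrite !hornerE /=; ring.
Qed.
Lemma TVE P : TV P = 2 * g1 P + (4 * mr - 3) * g2 P + mr * (mr - 1) * g3 P.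
Proof.
rewrite /TV /Aop /g1 /g2 /g3 !derivE.
by rewrite !hornerE /=; ring.
Qed.

Lemma aV_step P : aV (pstep P) = aV P * g P ^+ k.+1.
Proof. by rewrite (aVE P) /g /g1 /aV Aop_pstep /Wop !hornerE; ring. Qed.

Lemma BV_step P : BV (pstep P) = (BV P - (mr - 1) * g1 P) * g P ^+ k.+1
   + aV P * ((mr - 1) * g1 P * g P ^+ k).
Proof.
have h1 : k.+1%:R = mr - 1 :> R by rewrite -[in RHS]natr1 addrK.
rewrite (BVE P) (aVE P) /BV Aop_pstep /Wop derivM deriv_expE h1 /g /g1 /g2.
move: mr => c; rewrite !derivE !hornerE /= !exprS; ring.
Qed.

Lemma TV_step P : TV (pstep P) = (TV P - 2 * g1 P - (2 * mr - 2) * g2 P) * g P ^+ k.+1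
   + 2 * (BV P - (mr - 1) * g1 P) * ((mr - 1) * g1 P * g P ^+ k)
   + aV P * ((mr - 1) * (g2 P * g P ^+ k + k%:R * g1 P ^+ 2 * g P ^+ k.-1)).
Proof.
have h1 : k.+1%:R = mr - 1 :> R by rewrite -[in RHS]natr1 addrK.
rewrite (TVE P) (BVE P) (aVE P) /TV Aop_pstep /Wop !derivM deriv_expE.
rewrite !derivD !derivM !deriv_expE h1 /g /g1 /g2 /g3.
move: mr (k%:R : R) => c c'; rewrite !derivE !hornerE /= !exprS. ring.
Qed.

Lemma derivXnE n : ('X^n : {poly R})^`() = n%:R *: 'X^(n.-1).
Proof. by rewrite derivXn scaler_nat. Qed.

(** Reduces an inequality that is linear in the law to point masses; the moment comparisons below
    rest on it. *)
Lemma linear_nneg (Phi : {poly R} -> R) :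
  (forall c P Q, Phi (c *: P + Q) = c * Phi P + Phi Q) ->
  (forall i, 0 <= Phi 'X^i) -> forall P, nneg P -> 0 <= Phi P.
Proof.
move=> lin mono P hP.
have Phi0 : Phi 0 = 0.
  by have := lin (-1) 0 0; rewrite scaler0 addr0 mulN1r addNr.
rewrite -[P]coefK poly_def.
elim: (size P) => [|n IH]; first by rewrite big_ord0 Phi0.
rewrite big_ord_recr /= addrC lin addr_ge0 // mulr_ge0 //.
Qed.

Lemma k_ge0 : 0 <= k%:R :> R. Proof. exact: ler0n. Qed.
Lemma mrE : mr = k%:R + 2. Proof. by rewrite -addn2 natrD. Qed.
Lemma mr_ge2 : 2 <= mr. Proof. by rewrite mrE; have := k_ge0; lra. Qed.

Lemma horner_nneg P x : nneg P -> 0 <= x -> 0 <= P.[x].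
Proof.
move=> hP hx; rewrite horner_coef; apply: sumr_ge0 => i _.
by rewrite mulr_ge0 ?exprn_ge0.
Qed.

Lemma deriv_nneg P : nneg P -> nneg P^`().
Proof. by move=> hP i; rewrite coef_deriv mulrn_wge0. Qed.

Lemma mul_nneg P Q : nneg P -> nneg Q -> nneg (P * Q).
Proof. by move=> hP hQ i; rewrite coefM; apply: sumr_ge0 => j _; rewrite mulr_ge0. Qed.

Lemma exp_nneg P n : nneg P -> nneg (P ^+ n).
Proof.
move=> hP; elim: n => [|n IH]; last by rewrite exprS; exact: mul_nneg.
by move=> i; rewrite expr0 coef1 ler0n.
Qed.

Lemma pstep_nneg P : nneg P -> nneg (pstep P).
Proof.
move=> hP i; rewrite coef_pstep; have h := exp_nneg m hP.
by case: ifP => _; rewrite ?addr0 ?addr_ge0.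
Qed.

Lemma pstep_mass P : (pstep P).[1] = P.[1] ^+ m.
Proof.
have := congr1 (fun Q => Q.[1]) (mulX_pstep P).
by rewrite !hornerE /= subrr mulr0 addr0.
Qed.

Lemma g_ge1 P : nneg P -> P.[1] = 1 -> forall x, 1 <= x -> 1 <= P.[x].
Proof.
move=> hP h1 x hx; rewrite -h1 -subr_ge0.
apply: (linear_nneg (Phi := fun P => P.[x] - P.[1])) => // [c Q Q'|i].
  by rewrite !(hornerD, hornerZ); ring.
by rewrite !hornerXn expr1n subr_ge0 exprn_ege1.
Qed.

Lemma g_le P : nneg P -> P.[1] = 1 -> g P <= aV P + mr + 2.
Proof.
move=> hP h1; suff : 0 <= mr * (mr - 1) * P^`().[mr] - P.[mr] + mr * P.[1] + 2 * P.[1] - P.[mr].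
  by rewrite h1 aVE /g /g1; lra.
apply: (linear_nneg (Phi := fun P => mr * (mr - 1) * P^`().[mr] - P.[mr]
   + mr * P.[1] + 2 * P.[1] - P.[mr])) => // [c Q Q'|i].
  by rewrite !(derivD, derivZ, hornerD, hornerZ); ring.
rewrite derivXnE hornerZ !hornerXn expr1n.
move: mr mr_ge2 => c hc.
case: i => [|i] /=; first by rewrite expr0; lra.
case: i => [|i] /=; first by rewrite expr0 expr1; nra.
rewrite -[i.+2]addn2 natrD exprD exprSr.
have := ler0n R i; have : 1 <= c ^+ i by rewrite exprn_ege1 //; lra.
move: (c ^+ i) (i%:R : R) => x y hx hy.
have : 0 <= c * c * x * ((c - 1) * (y + 2) - 2); last by lra.
by rewrite mulr_ge0 ?mulr_ge0 //; nra.
Qed.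

(** Cauchy-Schwarz, proved as positivity of a quadratic form monomial by monomial. *)
Lemma BV_sqr P : nneg P -> BV P ^+ 2 <= 2 * (aV P + g P) * TV P.
Proof.
move=> hP.
have key t : 0 <= 2 * (aV P + g P) * t ^+ 2 - 2 * t * BV P + TV P.
  rewrite aVE BVE TVE /g /g1 /g2 /g3.
  apply: (linear_nneg (Phi := fun P => 2 * (mr * (mr - 1) * P^`().[mr] - P.[mr] + P.[mr]) * t ^+ 2
     - 2 * t * ((mr - 1) * (2 * P^`().[mr] + mr * P^`()^`().[mr]))
     + (2 * P^`().[mr] + (4 * mr - 3) * P^`()^`().[mr] + mr * (mr - 1) * P^`()^`()^`().[mr])))
     => // [c Q Q'|i].
    by rewrite !(derivD, derivZ, hornerD, hornerZ); ring.
  move: mr mr_ge2 => c hc; rewrite derivXnE derivZ derivXnE !derivZ derivXnE !hornerZ !hornerXn.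
  have q (z u v w : R) : 0 < u -> v ^+ 2 <= u * w -> 0 <= u * z ^+ 2 - 2 * z * v + w.
    move=> hu hw; rewrite -(pmulr_rge0 _ hu).
    have -> : u * (u * z ^+ 2 - 2 * z * v + w) = (u * z - v) ^+ 2 + (u * w - v ^+ 2) by ring.
    by rewrite addr_ge0 ?sqr_ge0 // subr_ge0.
  (* For a point mass at y >= 1 the discriminant condition reduces to 0 <= (y-1)(c-1) + 2; the
     factor 2 in the statement makes this true for all c >= 2. *)
  have disc (y : R) : 1 <= y ->
     (y * (y + 1) * (c - 1) * c) ^+ 2 <= (2 * c ^+ 2 * (c - 1) * y) * (y * (y + 1) * (y * (c - 1) + 1)).
    move=> hy; rewrite -subr_ge0.
    have -> : 2 * c ^+ 2 * (c - 1) * y * (y * (y + 1) * (y * (c - 1) + 1)) -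
       (y * (y + 1) * (c - 1) * c) ^+ 2
      = (y * c) ^+ 2 * ((c - 1) * (y + 1)) * ((y - 1) * (c - 1) + 2) by ring.
    by apply: mulr_ge0; [apply: mulr_ge0; [exact: sqr_ge0 | nra] | nra].
  case: i => [|i] /=; first by rewrite expr0 !mul0r; lra.
  case: i => [|i] /=.
    rewrite !mul0r expr0 expr1.
    have h1 : 0 < 2 * (c * (c - 1)) by nra.
    have h2 : (2 * (c - 1)) ^+ 2 <= 2 * (c * (c - 1)) * 2 by nra.
    by have := q t _ _ _ h1 h2; lra.
  have e : c * (i%:R * c ^+ i.-1) = i%:R * c ^+ i.
    by case: i => [|i] /=; [rewrite !mul0r mulr0 | rewrite mulrCA -exprS].
  have hx : 0 < c ^+ i by rewrite exprn_gt0 //; lra.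
  have hi := ler0n R i.
  rewrite -[i.+2]addn2 -[i.+1]addn1 !natrD !exprD expr1.
  move: (c ^+ i) (c ^+ i.-1) (i%:R : R) e hx hi => x x' y e hx hy.
  have -> : 2 * (c * (c - 1) * ((y + 2) * (x * c)) - x * c ^+ 2 + x * c ^+ 2) * t ^+ 2 -
    2 * t * ((c - 1) * (2 * ((y + 2) * (x * c)) + c * ((y + 2) * ((y + 1) * x)))) +
    (2 * ((y + 2) * (x * c)) + (4 * c - 3) * ((y + 2) * ((y + 1) * x)) +
     c * (c - 1) * ((y + 2) * ((y + 1) * (y * x'))))
    = x * ((2 * c ^+ 2 * (c - 1) * (y + 2)) * t ^+ 2
          - 2 * t * ((y + 2) * (y + 2 + 1) * (c - 1) * c)
          + (y + 2) * (y + 2 + 1) * ((y + 2) * (c - 1) + 1)) + (c * (y * x') - y * x) * ((c - 1) * (y + 1) * (y + 2)).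
    ring.
  rewrite e subrr mul0r addr0 mulr_ge0 ?(ltW hx) //.
  apply: q; last by apply: disc => //; lra.
  by rewrite !mulr_gt0 ?exprn_gt0 //; lra.
have ha : 0 <= aV P + g P.
  rewrite aVE subrK mulr_ge0 //; last by apply: horner_nneg; [exact: deriv_nneg | exact: ler0n].
  by have := mr_ge2; nra.
move: (aV P + g P) (BV P) (TV P) key ha => a b c key ha.
have [ha0|ha0] := eqVneq a 0.
  have [->|hb] := eqVneq b 0; first by rewrite ha0 expr0n mulr0 mul0r.
  (* With vanishing leading coefficient and b different from 0, this argument gives the form the
     value -1. *)
  have := key ((c + 1) / (2 * b)); rewrite ha0.
  have -> : 2 * 0 * ((c + 1) / (2 * b)) ^+ 2 - 2 * ((c + 1) / (2 * b)) * b + c = - 1 by field; lra.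
  by rewrite oppr_ge0 ler10.
have {ha0} ha : 0 < a by rewrite lt_def ha0.
have := key (b / (2 * a)).
have -> : 2 * a * (b / (2 * a)) ^+ 2 - 2 * (b / (2 * a)) * b + c = (2 * a * c - b ^+ 2) / (2 * a).
  by field; lra.
by rewrite pmulr_lge0 ?invr_gt0 ?subr_ge0 //; lra.
Qed.

Lemma ler_of_sqr (x y : R) : 0 <= y -> x ^+ 2 <= y ^+ 2 -> x <= y.
Proof. by move=> hy h; case: (leP x y) => // hxy; nra. Qed.

Lemma g1_ge0 P : nneg P -> 0 <= g1 P.
Proof. by move=> hP; apply: horner_nneg; [exact: deriv_nneg | exact: ler0n]. Qed.
Lemma g2_ge0 P : nneg P -> 0 <= g2 P.
Proof. by move=> hP; apply: horner_nneg; [do 2!apply: deriv_nneg | exact: ler0n]. Qed.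

Lemma BV_ge0 P : nneg P -> 0 <= BV P.
Proof.
move=> hP; rewrite BVE; have := mr_ge2; have := g1_ge0 hP; have := g2_ge0 hP.
by move=> h1 h2 h3; apply: mulr_ge0; [lra | apply: addr_ge0; apply: mulr_ge0; lra].
Qed.

Lemma g_mr_ge1 P : nneg P -> P.[1] = 1 -> 1 <= g P.
Proof. by move=> hP h1; apply: g_ge1 => //; have := mr_ge2; lra. Qed.

(** Apart from [TV P], the terms of [TV (pstep P)] without a factor [aV P] sum to
    something nonpositive. *)
Lemma TV_step_le P : nneg P -> P.[1] = 1 -> 0 <= aV P <= 1 ->
  TV (pstep P) <= (TV P + 3 * aV P * BV P) * g P ^+ k.+1.
Proof.
move=> hP h1 /andP[ha0 ha1].
have hg := g_mr_ge1 hP h1.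
(* Removes the truncated predecessor: for k = 0 both sides carry the factor 0. *)
have hk : k%:R * g P ^+ k.-1 * g P = k%:R * g P ^+ k.
  by case: (k) => [|n]; rewrite ?mul0r // -mulrA -exprSr.
have hu : 0 < g P ^+ k by rewrite exprn_gt0 //; lra.
have := g1_ge0 hP; have := g2_ge0 hP; have := BV_ge0 hP.
rewrite TV_step exprS; move: (TV P) => T.
have e : mr * (mr - 1) * g1 P = aV P + g P by rewrite aVE; ring.
move: (BV P) (BVE P) ha0 ha1 e => B -> {B}.
move: (aV P) (g P) (g1 P) (g2 P) (g P ^+ k) (g P ^+ k.-1) hg hk hu.
rewrite (mrE); move: (k%:R : R) (k_ge0) => c hc a y y1 y2 u h hg hk hu ha0 ha1 e hB hy2 hy1.
have e1 : (c + 2 - 1) * y1 <= y.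
  have : (c + 2) * ((c + 2 - 1) * y1) <= (c + 2) * y by rewrite mulrA e; nra.
  by rewrite ler_pM2l //; lra.
set B := (c + 2 - 1) * (2 * y1 + (c + 2) * y2) in hB *.
have hB1 : y1 <= B by rewrite /B; nra.
have hB2 : (c + 1) * (2 * y1 + 2 * y2) <= B by rewrite /B; nra.
have t1 : 2 * (B - (c + 2 - 1) * y1) * ((c + 2 - 1) * y1)
   = 2 * (c + 1) ^+ 2 * (y1 + (c + 2) * y2) * y1 by rewrite /B; ring.
have t2 : (c + 2) * (2 * (c + 1) ^+ 2 * (y1 + (c + 2) * y2) * y1)
   = 2 * (c + 1) * (y1 + (c + 2) * y2) * (a + y) by rewrite -e; ring.
(* By [e], one factor (m-1) [y1] becomes (a + y)/m. Its [y] part is absorbed by the negative terms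
   of [TV_step], its [a] part by a B. With [t4] and [t5] this makes three such terms, hence the
   constant 3. *)
have t3 : 2 * (c + 1) ^+ 2 * (y1 + (c + 2) * y2) * y1 <= y * (2 * y1 + (2 * (c + 2) - 2) * y2) + y * (a * B).
  rewrite -(ler_pM2l (_ : 0 < c + 2)) ?t2; last by lra.
  have : 2 * (c + 1) * (y1 + (c + 2) * y2) * a <= (c + 2) * (y * (a * B)).
    have : 2 * (c + 1) * (y1 + (c + 2) * y2) <= (c + 2) * B.
      have : (c + 1) * (y1 + (c + 2) * y2) <= B.
        by have -> : B = (c + 1) * (2 * y1 + (c + 2) * y2); [rewrite /B; ring | rewrite ler_wpM2l //; lra].
      by nra.
    have : (c + 2) * B * a <= (c + 2) * (y * (a * B)).
      rewrite -mulrA ler_wpM2l //; first by lra.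
      have haB : 0 <= a * B by exact: mulr_ge0.
      by rewrite mulrC ler_peMl.
    by move=> i1 i2; apply: le_trans i1; rewrite ler_wpM2r.
  have : 2 * (c + 1) * (y1 + (c + 2) * y2) * y <= (c + 2) * (y * (2 * y1 + (2 * (c + 2) - 2) * y2)).
    rewrite -subr_ge0.
    have -> : (c + 2) * (y * (2 * y1 + (2 * (c + 2) - 2) * y2)) -
      2 * (c + 1) * (y1 + (c + 2) * y2) * y = 2 * (y * y1) by ring.
    by apply: mulr_ge0 => //; apply: mulr_ge0 => //; lra.
  lra.
have t4 : a * ((c + 2 - 1) * (y2 * u)) <= a * B * (y * u).
  rewrite -(mulrA a B) ler_wpM2l //.
  have : (c + 2 - 1) * y2 * u <= B * u by rewrite ler_wpM2r ?(ltW hu) //; nra.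
  have : B * u <= B * (y * u) by rewrite ler_wpM2l // ler_peMl // ltW.
  lra.
have t5 : a * ((c + 2 - 1) * (c * y1 ^+ 2 * h)) <= a * B * (y * u).
  rewrite -(mulrA a B) ler_wpM2l //.
  rewrite -(ler_pM2r (_ : 0 < y)); last by lra.
  have -> : (c + 2 - 1) * (c * y1 ^+ 2 * h) * y = (c + 2 - 1) * y1 ^+ 2 * (c * h * y) by ring.
  rewrite hk.
  have -> : (c + 2 - 1) * y1 ^+ 2 * (c * u) = ((c + 2 - 1) * y1) * (c * y1) * u by ring.
  have -> : B * (y * u) * y = y * (B * y) * u by ring.
  rewrite ler_wpM2r ?(ltW hu) // ler_pM ?mulr_ge0 //; first by lra.
  apply: (@le_trans _ _ B); first by nra.
  by rewrite ler_peMr.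
have : 2 * (B - (c + 2 - 1) * y1) * ((c + 2 - 1) * y1 * u) <=
   (y * (2 * y1 + (2 * (c + 2) - 2) * y2) + y * (a * B)) * u.
  by rewrite mulrA t1 ler_wpM2r // ltW.
lra.
Qed.

Definition Y P n := iter n pstep P.

Lemma Y_nneg P n : nneg P -> nneg (Y P n).
Proof. by move=> hP; elim: n => //= n; apply: pstep_nneg. Qed.
Lemma Y_mass P n : P.[1] = 1 -> (Y P n).[1] = 1.
Proof. by move=> hP; elim: n => //= n; rewrite pstep_mass => ->; rewrite expr1n. Qed.

(** * The Riccati argument for the ratio [BV / aV] *)

Section Start.
Variables (P : {poly R}) (l : nat).
Hypotheses (hP : nneg P) (h1 : P.[1] = 1) (ha0 : 0 < aV P).
(** Large enough that 18 (m+3) <= kap^2, so that the bound on [BV] returned by [BV_small] is exactly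
    the increment allowed in [TV_bound]. *)
Let kap : R := 6 * (mr + 3).

Lemma gY_ge1 n : 1 <= g (Y P n).
Proof. by apply: g_mr_ge1; [exact: Y_nneg | exact: Y_mass]. Qed.

Lemma aV_gt0 n : 0 < aV (Y P n).
Proof.
elim: n => //= n IH; rewrite aV_step mulr_gt0 // exprn_gt0 //.
by have := gY_ge1 n; lra.
Qed.

Lemma aV_ge n : aV P <= aV (Y P n).
Proof.
elim: n => //= n IH; rewrite aV_step (le_trans IH) // ler_peMr ?exprn_ege1 ?gY_ge1 //.
exact/ltW/aV_gt0.
Qed.

Hypothesis hT : TV P <= aV P * l%:R ^+ 2.

Lemma BV_small n : aV (Y P n) <= 1 / 2 ->
  TV (Y P n) <= 2 * kap ^+ 2 * l%:R ^+ 2 * aV (Y P n) -> 3 * BV (Y P n) <= kap ^+ 2 * l%:R.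
Proof.
move=> ha ht.
have hk : 0 <= kap by rewrite /kap; have := mr_ge2; lra.
have hb := BV_sqr (Y_nneg n hP).
have hg := g_le (Y_nneg n hP) (Y_mass n h1).
have hB := BV_ge0 (Y_nneg n hP).
have ha' := aV_gt0 n.
have hl : 0 <= l%:R :> R by exact: ler0n.
apply: ler_of_sqr; first by rewrite mulr_ge0 ?exprn_ge0.
have hm := mr_ge2.
have hT1 : TV (Y P n) <= kap ^+ 2 * l%:R ^+ 2.
  have : 0 <= kap ^+ 2 * l%:R ^+ 2 by rewrite mulr_ge0 ?exprn_ge0.
  by move=> hx; have := ler_wpM2l hx ha; lra.
have : 2 * (aV (Y P n) + g (Y P n)) * TV (Y P n) <= 2 * (mr + 3) * (kap ^+ 2 * l%:R ^+ 2).
  have hpos : 0 <= kap ^+ 2 * l%:R ^+ 2 by rewrite mulr_ge0 ?exprn_ge0.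
  have i1 : 2 * (aV (Y P n) + g (Y P n)) <= 2 * (mr + 3) by lra.
  have i0 : 0 <= 2 * (aV (Y P n) + g (Y P n)) by have := gY_ge1 n; lra.
  apply: (@le_trans _ _ (2 * (aV (Y P n) + g (Y P n)) * (kap ^+ 2 * l%:R ^+ 2))).
    by rewrite ler_wpM2l.
  by rewrite ler_wpM2r.
have : 9 * (2 * (mr + 3) * (kap ^+ 2 * l%:R ^+ 2)) <= (kap ^+ 2 * l%:R) ^+ 2.
  have -> : (kap ^+ 2 * l%:R) ^+ 2 = kap ^+ 2 * (kap ^+ 2 * l%:R ^+ 2) by ring.
  rewrite !mulrA ler_wpM2r ?exprn_ge0 // ler_wpM2r ?exprn_ge0 // /kap; nra.
by rewrite exprMn; lra.
Qed.

(** [TV] and [aV] pick up the same factor [g ^+ k.+1], so their quotient grows by at most 3 [BV] per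
    step. As long as n <= l it stays below twice kap^2 l^2, which is what [BV_small] needs to bound
    the next increment. *)
Lemma TV_bound n : (n <= l)%N -> (forall j, (j < n)%N -> aV (Y P j) <= 1 / 2) ->
  TV (Y P n) <= kap ^+ 2 * l%:R * (l%:R + n%:R) * aV (Y P n).
Proof.
have hl : 0 <= l%:R :> R by exact: ler0n.
have hk1 : 1 <= kap ^+ 2 by rewrite exprn_ege1 // /kap; have := mr_ge2; lra.
elim: n => [_ _|n IH hn hj] /=.
  apply: (le_trans hT); rewrite addr0 mulrC ler_wpM2r ?(ltW ha0) // -mulrA -expr2.
  by rewrite ler_peMl ?exprn_ge0.
have {}IH := IH (ltnW hn) (fun j hjn => hj j (ltnW hjn)).
have ha := hj n (ltnSn n); have ha' := aV_gt0 n.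
have hB : 3 * BV (Y P n) <= kap ^+ 2 * l%:R.
  apply: BV_small => //; apply: (le_trans IH); rewrite ler_wpM2r ?(ltW ha') //.
  have : n%:R <= l%:R :> R by rewrite ler_nat ltnW.
  have : 0 <= kap ^+ 2 * l%:R by rewrite mulr_ge0 // sqr_ge0.
  by rewrite expr2; move: (kap ^+ 2) => x; nra.
apply: (le_trans (TV_step_le (Y_nneg n hP) (Y_mass n h1) _)); first by apply/andP; lra.
rewrite aV_step mulrA ler_wpM2r ?exprn_ge0 //; first by have := gY_ge1 n; lra.
rewrite -natr1; have : 3 * aV (Y P n) * BV (Y P n) <= kap ^+ 2 * l%:R * aV (Y P n).
  by have := ler_wpM2r (ltW ha') hB; lra.
lra.
Qed.

(** Discrete form of x' = -x^2/K, whose positive solutions stay below K/n. *)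
Lemma riccati (x : nat -> R) (K : R) N : 0 < K -> (forall n, 0 <= x n) ->
  (forall n, (n < N)%N -> x n.+1 <= x n - x n ^+ 2 / K) ->
  forall n, (n <= N)%N -> n%:R * x n <= K.
Proof.
move=> hK hx hr; elim=> [|n IH] hn; first by rewrite mul0r ltW.
have {}IH := IH (ltnW hn); have := hr n hn; have hxn := hx n.
move=> h.
have hs : n.+1%:R * x n.+1 <= n.+1%:R * (x n - x n ^+ 2 / K) by rewrite ler_wpM2l ?ler0n.
apply: (le_trans hs); rewrite -(ler_pM2r hK).
have -> : n.+1%:R * (x n - x n ^+ 2 / K) * K = n.+1%:R * (x n * K - x n ^+ 2) by field; lra.
rewrite -natr1; move: (x n) IH hxn => y IH hy; have := ler0n R n; move: (n%:R : R) IH => c IH hc.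
(* For y > K the right side of the recursion is already negative. Otherwise the claim is the
   nonnegativity of (K - c y)(K - y) + y^2. *)
rewrite -subr_ge0; case: (ltP K y) => h'.
  have : 0 <= (c + 1) * (y * (y - K)) by do 2?[apply: mulr_ge0]; lra.
  by have := sqr_ge0 K; lra.
have : 0 <= (K - c * y) * (K - y) by apply: mulr_ge0; lra.
by have := sqr_ge0 y; lra.
Qed.

(** With a = [aV] and G = [g], the exact decrease is (G^2 - a^2)/(m a G); G >= 1 and a <= 1/2 make
    it at least 1/(2 m a). *)
Lemma ratio_step n : aV (Y P n) <= 1 / 2 ->
  BV (Y P n.+1) / aV (Y P n.+1) <= BV (Y P n) / aV (Y P n) - (2 * mr * aV (Y P n))^-1.
Proof.
move=> ha; have ha' := aV_gt0 n; have hg := gY_ge1 n; have hm := mr_ge2.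
have hu : 0 < g (Y P n) ^+ k by rewrite exprn_gt0 //; lra.
rewrite /= BV_step aV_step exprS.
have e : (mr - 1) * g1 (Y P n) = (aV (Y P n) + g (Y P n)) / mr.
  by rewrite aVE; field; lra.
rewrite e; move: (aV _) (g _) (BV _) (_ ^+ k) mr ha ha' hg hm hu => a G B u c ha ha' hg hm hu.
rewrite -subr_ge0.
have -> : B / a - (2 * c * a)^-1 - ((B - (a + G) / c) * (G * u) + a * ((a + G) / c * u)) / (a * (G * u))
  = (G ^+ 2 - a ^+ 2 - G / 2) / (c * a * G).
  by field; rewrite ?gt_eqF //; lra.
apply: divr_ge0; first by nra.
by rewrite !mulr_ge0 //; lra.
Qed.

(** The Riccati constant [K] below divided by l^2, that is 4m * 2(m+3) * kap^2. *)
Definition Cst : R := 288 * mr * (mr + 3) ^+ 3.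

Lemma BV_le_aV_reached : aV P <= 1 / 2 -> (0 < l)%N ->
  exists2 n, (n <= l)%N & BV (Y P n) <= Cst * l%:R * aV (Y P n).
Proof.
move=> hah hl; have hm := mr_ge2.
have hl1 : 1 <= l%:R :> R by rewrite ler1n.
have [|hno] := boolP [exists n : 'I_l.+1, 1 / 2 < aV (Y P n)].
  move=> /existsP ex.
  have ex' : exists n, (n <= l)%N && (1 / 2 < aV (Y P n)).
    by case: ex => n hn; exists n; rewrite -ltnS ltn_ord.
  (* At the first such time [TV_bound] still applies, as it asks only about earlier times, and a_n >
     1/2 turns the Cauchy-Schwarz bound into a multiple of (l a_n)^2. *)
  case: (ex_minnP ex') => n /andP[hnl hn] hmin; exists n => //.
  have ht := TV_bound hnl _.
  have {}ht : TV (Y P n) <= kap ^+ 2 * l%:R * (l%:R + n%:R) * aV (Y P n).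
    apply: ht => j hj; rewrite leNgt; apply/negP => h.
    by have := hmin j; rewrite (leq_trans (ltnW hj) hnl) h leqNgt hj => /(_ isT).
  have hb := BV_sqr (Y_nneg n hP).
  have hg := g_le (Y_nneg n hP) (Y_mass n h1); have hg1 := gY_ge1 n.
  have hnl' : n%:R <= l%:R :> R by rewrite ler_nat.
  have hC : 1 <= Cst.
    rewrite /Cst; have : 1 <= (mr + 3) ^+ 3 by rewrite exprn_ege1 //; lra.
    by nra.
  apply: ler_of_sqr; first by rewrite !mulr_ge0 //; lra.
  apply: (le_trans hb).
  have hk2 : kap ^+ 2 = 36 * (mr + 3) ^+ 2 by rewrite /kap; ring.
  have i1 : 2 * (aV (Y P n) + g (Y P n)) <= 4 * (mr + 3) * aV (Y P n) by nra.
  have i2 : TV (Y P n) <= 72 * (mr + 3) ^+ 2 * l%:R ^+ 2 * aV (Y P n).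
    apply: (le_trans ht); rewrite ler_wpM2r //; first by lra.
    rewrite hk2; have h0 : 0 <= 36 * (mr + 3) ^+ 2 * l%:R by rewrite !mulr_ge0 ?exprn_ge0 //; lra.
    by have := ler_wpM2l h0 (_ : l%:R + n%:R <= 2 * l%:R); rewrite expr2; lra.
  apply: (@le_trans _ _ (4 * (mr + 3) * aV (Y P n) * (72 * (mr + 3) ^+ 2 * l%:R ^+ 2 * aV (Y P n)))).
    apply: (@le_trans _ _ (2 * (aV (Y P n) + g (Y P n)) * (72 * (mr + 3) ^+ 2 * l%:R ^+ 2 * aV (Y P n)))).
      by rewrite ler_wpM2l //; lra.
    by rewrite ler_wpM2r // !mulr_ge0 ?exprn_ge0 //; lra.
  have -> : 4 * (mr + 3) * aV (Y P n) * (72 * (mr + 3) ^+ 2 * l%:R ^+ 2 * aV (Y P n))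
     = (288 * (mr + 3) ^+ 3) * (l%:R * aV (Y P n)) ^+ 2 by ring.
  rewrite -(mulrA Cst) [X in _ <= X]exprMn ler_wpM2r ?sqr_ge0 //.
  apply: (@le_trans _ _ Cst); last by rewrite expr2 ler_peMl //; lra.
  by rewrite /Cst; have : 0 <= (mr + 3) ^+ 3 by [rewrite exprn_ge0 //; lra]; nra.
have {hno}hall n : (n <= l)%N -> aV (Y P n) <= 1 / 2.
  move=> hn; rewrite leNgt; apply/negP => h; case/negP: hno.
  by apply/existsP; exists (Ordinal (hn : (n < l.+1)%N)).
exists l => //.
(* With a + g <= m + 3 and T <= 2 kap^2 l^2 a, Cauchy-Schwarz bounds (B/a)^2 by a multiple of 1/a.
   This [K] makes the decrement 1/(2 m a) at least (B/a)^2 / K. *)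
pose K := 4 * mr * (2 * (mr + 3)) * kap ^+ 2 * l%:R ^+ 2.
have hkap : 0 < kap by rewrite /kap; lra.
have hK : 0 < K by rewrite /K !mulr_gt0 ?exprn_gt0 //; lra.
have hx n : 0 <= BV (Y P n) / aV (Y P n).
  by rewrite divr_ge0 ?(ltW (aV_gt0 n)) // BV_ge0 //; exact: Y_nneg.
have := @riccati (fun n => BV (Y P n) / aV (Y P n)) K l hK hx _ l (leqnn l).
rewrite mulrA ler_pdivrMr ?aV_gt0 // => h.
have {}h : l%:R * BV (Y P l) <= K * aV (Y P l).
  apply: h => n hn; apply: (le_trans (ratio_step (hall n (ltnW hn)))).
  rewrite lerD2l lerN2 ler_pdivrMr //.
  have ht := TV_bound (ltnW hn) (fun j hj => hall j (ltnW (ltn_trans hj hn))).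
  have hb := BV_sqr (Y_nneg n hP); have hg := g_le (Y_nneg n hP) (Y_mass n h1).
  have ha := aV_gt0 n; have ha2 := hall n (ltnW hn).
  rewrite expr_div_n ler_pdivrMr ?exprn_gt0 //.
  have -> : (2 * mr * aV (Y P n))^-1 * K * aV (Y P n) ^+ 2
    = (2 * (mr + 3)) * (2 * (kap ^+ 2 * l%:R ^+ 2) * aV (Y P n)).
    by rewrite /K; field; lra.
  apply: (le_trans hb).
  have hkl : 0 <= kap ^+ 2 * l%:R by rewrite mulr_ge0 ?exprn_ge0 //; lra.
  have hnl' : n%:R <= l%:R :> R by rewrite ler_nat ltnW.
  have hT' : TV (Y P n) <= 2 * (kap ^+ 2 * l%:R ^+ 2) * aV (Y P n).
    apply: (le_trans ht); rewrite ler_wpM2r ?(ltW ha) //.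
    by have := ler_wpM2l hkl (_ : l%:R + n%:R <= 2 * l%:R); rewrite expr2; lra.
  have := gY_ge1 n => hg1.
  apply: (@le_trans _ _ (2 * (aV (Y P n) + g (Y P n)) * (2 * (kap ^+ 2 * l%:R ^+ 2) * aV (Y P n)))).
    by rewrite ler_wpM2l //; lra.
  rewrite ler_wpM2r //; last by lra.
  by rewrite !mulr_ge0 ?exprn_ge0 //; lra.
rewrite -(ler_pM2l (_ : 0 < l%:R)); last by lra.
apply: (le_trans h); rewrite le_eqVlt; apply/orP; left; apply/eqP.
by rewrite /K /Cst /kap; ring.
Qed.
End Start.

(** * Evaluation at [s] below [m], and removal of large values *)

Lemma Aop_linear (c : R) P Q : Aop (c *: P + Q) = c *: Aop P + Aop Q.
Proof. by rewrite /Aop derivD derivZ mulrDr -scalerAr opprD addrACA scalerBr. Qed.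

Lemma expr_sub_le (x y : R) n : 0 <= y -> y <= x ->
  x ^+ n.+1 - y ^+ n.+1 <= (x - y) * n.+1%:R * x ^+ n.
Proof.
move=> hy hxy; elim: n => [|n IH]; first by rewrite !expr1 expr0 !mulr1.
have hx : 0 <= x by lra.
have hp : y ^+ n.+1 <= x ^+ n.+1 by apply: lerXn2r; rewrite ?nnegrE.
have := ler_wpM2l hx IH.
have : 0 <= (x - y) * (x ^+ n.+1 - y ^+ n.+1) by rewrite mulr_ge0 ?subr_ge0.
rewrite -[in X in _ -> _ -> X]natr1 [x ^+ n.+2]exprS [y ^+ n.+2]exprS.
have -> : (x - y) * (n.+1%:R + 1) * x ^+ n.+1 = x * ((x - y) * n.+1%:R * x ^+ n) + (x - y) * x ^+ n.+1.
  by rewrite exprS; ring.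
lra.
Qed.

Lemma Aop_lower P s : nneg P -> 1 <= s -> s <= mr ->
  aV P - 2 * (mr - s) * BV P <= (Aop P).[s].
Proof.
move=> hP hs1 hsm; rewrite -subr_ge0.
apply: (linear_nneg (Phi := fun P => (Aop P).[s] - (aV P - 2 * (mr - s) * BV P))) => // [c Q Q'|i].
  by rewrite /aV /BV !Aop_linear !(derivD, derivZ, hornerD, hornerZ); ring.
rewrite aVE BVE /g /g1 /g2 /Aop; move: mr (mr_ge2) hsm => c hc hsm.
rewrite derivXnE derivZ derivXnE !(hornerE, hornerXn).
case: i => [|[|i]] /=.
- by rewrite !expr0; lra.
- by rewrite !expr0 !expr1; nra.
have h1 := @expr_sub_le c s i.+1 (le_trans ler01 hs1) hsm.
have hx : 0 < c ^+ i by rewrite exprn_gt0 //; lra.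
have hy : 0 <= s ^+ i by rewrite exprn_ge0 //; lra.
have hxy : s ^+ i.+2 <= c ^+ i.+2 by apply: lerXn2r; rewrite ?nnegrE //; lra.
move: h1 hxy; rewrite -[i.+2]addn2 -[i.+1]addn1 !natrD !exprD !expr1.
have := ler0n R i; move: (i%:R : R) (c ^+ i) (s ^+ i) hx hy => n x y hx hy hn h1 hxy.
have h2 : (x * c ^+ 2 - y * s ^+ 2) * ((s - 1) * (n + 2) - 1) <= (x * c ^+ 2 - y * s ^+ 2) * ((c - 1) * (n + 2)).
  rewrite ler_wpM2l ?subr_ge0 //.
  by have : (s - 1) * (n + 2) <= (c - 1) * (n + 2) by [rewrite ler_wpM2r //; lra]; lra.
have h3 : (x * c ^+ 2 - y * s ^+ 2) * ((c - 1) * (n + 2)) <= (c - s) * (n + 2) * (x * c) * ((c - 1) * (n + 2)).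
  by rewrite ler_wpM2r // mulr_ge0; lra.
have h4 : 0 <= (c - s) * (x * c) * (n + 2) * ((c - 1) * (n + 2 + 2) - c).
  by rewrite !mulr_ge0 //; nra.
lra.
Qed.

(** The law with all values larger than [M] replaced by 0. *)
Definition kill M P := take_poly M.+1 P + (1 - (take_poly M.+1 P).[1])%:P.

Lemma coef_kill M P i : (kill M P)`_i =
  (if (i < M.+1)%N then P`_i else 0) + (if i == 0%N then 1 - (take_poly M.+1 P).[1] else 0).
Proof. by rewrite coefD coef_take_poly coefC. Qed.

Definition over M P := drop_poly M.+1 P * 'X^(M.+1).

Lemma coef_over M P i : (over M P)`_i = if (i < M.+1)%N then 0 else P`_i.
Proof. by rewrite coefMXn coef_drop_poly; case: ltnP => // h; rewrite subnK. Qed.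

Lemma take_over M P : take_poly M.+1 P = P - over M P.
Proof. by rewrite -[in X in X - _](poly_take_drop M.+1 P) addrK. Qed.

Lemma over_nneg M P : nneg P -> nneg (over M P).
Proof. by move=> hP i; rewrite coef_over; case: ifP. Qed.

Lemma kill_nneg M P : nneg P -> P.[1] = 1 -> nneg (kill M P).
Proof.
move=> hP h1 i; rewrite coef_kill take_over hornerD hornerN h1 opprB addrCA subrr addr0.
have := horner_nneg (over_nneg M hP) ler01.
by case: ifP; case: ifP => *; rewrite ?addr_ge0.
Qed.

Lemma kill_mass M P : (kill M P).[1] = 1.
Proof. by rewrite hornerD hornerC addrCA subrr addr0. Qed.

Lemma size_kill M P : (size (kill M P) <= M.+1)%N.
Proof.
apply: leq_trans (size_polyD _ _) _; rewrite geq_max size_take_poly.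
by apply: leq_trans (size_polyC_leq1 _) _.
Qed.

(** Moving the part O above [M] to 0 changes A(s) by -s(s-1) O'(s) + O(s) - O(1), and O(s) >=
    O(1). *)
Lemma Aop_kill M P s : nneg P -> P.[1] = 1 -> 1 <= s ->
  (Aop P).[s] - (s - 1) * (s * (over M P)^`().[s]) <= (Aop (kill M P)).[s].
Proof.
move=> hP h1 hs.
have ho : (over M P).[1] <= (over M P).[s].
  rewrite -subr_ge0.
  apply: (linear_nneg (Phi := fun P => P.[s] - P.[1])); last exact: over_nneg.
    by move=> c Q Q'; rewrite !(hornerD, hornerZ); ring.
  by move=> i; rewrite !hornerXn expr1n subr_ge0 exprn_ege1.
rewrite /kill take_over; move: (over M P) ho => O ho.
by rewrite /Aop !derivE !(hornerD, hornerN, hornerM, hornerC, hornerX) h1; lra.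
Qed.

Lemma eulerE P N x : (size P <= N)%N ->
  x * P^`().[x] = \sum_(i < N) P`_i * (i%:R * x ^+ i).
Proof.
move=> hN; have -> : x * P^`().[x] = ('X * P^`()).[x] by rewrite !hornerE.
rewrite (@horner_coef_wide _ N); last first.
  apply/leq_sizeP => j hj; rewrite coefXM; case: j hj => //= j hj.
  by rewrite coef_deriv nth_default ?mul0rn // (leq_trans hN).
apply: eq_bigr => i _; rewrite coefXM; case: (nat_of_ord i) => [|j] /=; first by rewrite !mul0r mulr0.
by rewrite coef_deriv mulrA mulr_natr.
Qed.

(** Serves for the first removal, when the moment at x = m is still under control; afterwards
    [over_bounded] replaces it, with a bound on the single coefficients as its only input. *)
Lemma over_decay M P s x : nneg P -> 0 <= s -> s <= x -> 0 < x ->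
  s * (over M P)^`().[s] <= (s / x) ^+ M * (x * P^`().[x]).
Proof.
move=> hP hs hsx hx.
have hso : (size (over M P) <= size P)%N.
  by apply/leq_sizeP => j hj; rewrite coef_over; case: ifP => // _; rewrite nth_default.
rewrite (eulerE s hso) (eulerE x (leqnn (size P))) mulr_sumr; apply: ler_sum => i _.
have hr : 0 <= s / x by rewrite divr_ge0 // ltW.
have hr1 : s / x <= 1 by rewrite ler_pdivrMr // mul1r.
rewrite coef_over; case: ltnP => hi.
  by rewrite mul0r !mulr_ge0 ?exprn_ge0 // ltW.
rewrite [leRHS]mulrCA ler_wpM2l // [leRHS]mulrCA ler_wpM2l //.
have -> : s ^+ i = (s / x) ^+ i * x ^+ i by rewrite -exprMn divfK // gt_eqF.
by rewrite ler_wpM2r ?exprn_ge0 ?(ltW hx) // ler_wiXn2l // ltnW.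
Qed.

Lemma over_bounded M N P s x H : nneg P -> 0 <= s -> s <= x -> 0 < x -> 0 <= H ->
  (size P <= N.+1)%N -> (forall i, (0 < i)%N -> P`_i * x ^+ i <= H) ->
  s * (over M P)^`().[s] <= N.+1%:R ^+ 2 * H * (s / x) ^+ M.
Proof.
move=> hP hs hsx hx hH hN hb.
have hr : 0 <= s / x by rewrite divr_ge0 // ltW.
have hr1 : s / x <= 1 by rewrite ler_pdivrMr // mul1r.
have hso : (size (over M P) <= N.+1)%N.
  by apply/leq_sizeP => j hj; rewrite coef_over; case: ifP => // _; rewrite nth_default // (leq_trans hN).
rewrite (eulerE s hso).
have -> : N.+1%:R ^+ 2 * H * (s / x) ^+ M = \sum_(i < N.+1) N.+1%:R * H * (s / x) ^+ M.
  by rewrite sumr_const card_ord -mulr_natr; ring.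
apply: ler_sum => i _; rewrite coef_over; case: ltnP => hi.
  by rewrite mul0r !mulr_ge0 ?exprn_ge0.
have hi0 : (0 < i)%N by rewrite (leq_trans _ hi).
have -> : s ^+ i = (s / x) ^+ i * x ^+ i by rewrite -exprMn divfK // gt_eqF.
have -> : P`_i * (i%:R * ((s / x) ^+ i * x ^+ i)) = i%:R * (P`_i * x ^+ i) * (s / x) ^+ i by ring.
have hp : 0 <= P`_i * x ^+ i by rewrite mulr_ge0 ?exprn_ge0 // ltW.
apply: ler_pM; rewrite ?exprn_ge0 //; first by rewrite mulr_ge0.
  by apply: ler_pM; rewrite ?hb // ler_nat ltnW.
by rewrite ler_wiXn2l // ltnW.
Qed.

Lemma size_pstep P M : (size P <= M.+1)%N -> (size (pstep P) <= (m * M).+1)%N.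
Proof.
move=> hP; apply/leq_sizeP => j hj; rewrite coef_pstep.
have hs : (size (P ^+ m) <= (m * M).+1)%N.
  apply: leq_trans (size_poly_exp_leq _ _) _; rewrite ltnS mulnC leq_mul2l /=.
  by case: (size P) hP.
have hj0 : (0 < j)%N by rewrite (leq_trans _ hj).
by rewrite nth_default ?(leq_trans hs (leqW hj)) // eqn0Ngt hj0 addr0.
Qed.

Lemma Aop_horner P x : (Aop P).[x] = x * (x - 1) * P^`().[x] - P.[x].
Proof. by rewrite /Aop !hornerE. Qed.

(** Since A(s) >= 0, s P'(s) is at least 1/m, and the support bound converts this into P(s) - 1 >=
    1/(3 m M), a growth factor. The additive term is the drift (m-s)/s * (A(s) + P(s)) with P(s) >=
    1. *)
Lemma Aop_grow P s M : nneg P -> P.[1] = 1 -> (size P <= M.+1)%N -> (0 < M)%N ->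
  3 / 2 <= s -> s <= mr -> 0 <= (Aop P).[s] ->
  (1 + (3 * mr * M%:R)^-1) * (Aop P).[s] + (mr - s) / mr <= (Aop (pstep P)).[s].
Proof.
move=> hP h1 hN hM hs hsm hA; have hm := mr_ge2.
have hM0 : 0 < M%:R :> R by rewrite ltr0n.
have hG1 : 1 <= P.[s] by apply: g_ge1 => //; lra.
have hE : (s - 1) * (s * P^`().[s]) = (Aop P).[s] + P.[s].
  by rewrite Aop_horner; ring.
have hG : 1 + (3 * mr * M%:R)^-1 <= P.[s].
  have : s * P^`().[s] <= 3 * M%:R * (P.[s] - 1).
    have -> : P.[s] - 1 = \sum_(i < M.+1) P`_i * (s ^+ i - 1).
      have -> : P.[s] - 1 = P.[s] - P.[1] by rewrite h1.
      rewrite !(@horner_coef_wide _ M.+1 P) // -sumrB; apply: eq_bigr => i _.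
      by rewrite expr1n mulrBr.
    rewrite (eulerE s hN) mulr_sumr; apply: ler_sum => i _.
    rewrite [leRHS]mulrCA ler_wpM2l //; case: i => [[|i] hi] /=.
      by rewrite mul0r expr0 subrr mulr0.
    have hsi : s <= s ^+ i.+1 by rewrite exprS ler_peMr ?exprn_ege1 //; lra.
    have hiM : i.+1%:R <= M%:R :> R by rewrite ler_nat.
    (* This uses s >= 3/2 and is the origin of the 3 in the growth rate. *)
    have h3 : s ^+ i.+1 <= 3 * (s ^+ i.+1 - 1) by lra.
    rewrite -(mulrA 3) mulrCA ler_pM //; first by rewrite exprn_ge0 //; lra.
  have hp : 1 <= mr * (s * P^`().[s]).
    have hd : 0 <= s * P^`().[s].
      by rewrite mulr_ge0 ?horner_nneg //; [lra | exact: deriv_nneg | lra].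
    have : (s - 1) * (s * P^`().[s]) <= mr * (s * P^`().[s]) by rewrite ler_wpM2r //; lra.
    lra.
  move=> h; have hpos : 0 < 3 * mr * M%:R by rewrite !mulr_gt0 //; lra.
  rewrite addrC -lerBrDr -div1r ler_pdivrMr //.
  have hmr0 : 0 <= mr by lra.
  by have := ler_wpM2l hmr0 h; lra.
rewrite Aop_pstep /Wop.
have -> : ((mr%:P * ('X - 1) * P^`() - P) * P ^+ k.+1).[s] =
  ((Aop P).[s] + (mr - s) / s * ((s - 1) * (s * P^`().[s]))) * P.[s] ^+ k.+1.
  have -> : ((mr%:P * ('X - 1) * P^`() - P) * P ^+ k.+1).[s] = (mr * (s - 1) * P^`().[s] - P.[s]) * P.[s] ^+ k.+1.
    by rewrite !hornerE.
  by rewrite Aop_horner; field; lra.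
rewrite hE.
have h2 : (mr - s) / mr <= (mr - s) / s * ((Aop P).[s] + P.[s]).
  rewrite -mulrA ler_wpM2l ?subr_ge0 //.
  have : mr^-1 <= s^-1 by rewrite lef_pV2 // posrE; lra.
  have : 0 <= s^-1 by rewrite invr_ge0; lra.
  move: (s^-1) (mr^-1) => x y hx hy; apply: (le_trans hy).
  by rewrite ler_peMr //; lra.
have h3 : 1 + (3 * mr * M%:R)^-1 <= P.[s] ^+ k.+1.
  by rewrite exprS (le_trans hG) // ler_peMr ?exprn_ege1 //; lra.
have h4 : 0 <= (mr - s) / mr by rewrite divr_ge0; lra.
have h5 : 1 <= P.[s] ^+ k.+1 by rewrite exprn_ege1.
have := ler_wpM2l hA h3; have := ler_wpM2l h4 h5.
have := ler_wpM2r (le_trans ler01 h5) h2.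
move: ((mr - s) / s * ((Aop P).[s] + P.[s])) ((mr - s) / mr) (1 + (3 * mr * M%:R)^-1) => y x z.
move: (P.[s] ^+ k.+1) (Aop P).[s] => u v.
by rewrite mulrDl (mulrC v z); lra.
Qed.

(** * Forcing a large coefficient in the truncated system *)

Section Overflow.
Variables (P : {poly R}) (l M J : nat) (H : R).
Hypotheses (hP : nneg P) (h1 : P.[1] = 1) (ha0 : 0 < aV P) (ha1 : aV P <= 1 / 2).
Hypotheses (hT : TV P <= aV P * l%:R ^+ 2) (hl : (0 < l)%N) (hM : (0 < M)%N) (hH : 0 <= H).
(** Makes 2 [eta] [BV] at most [aV] / 2 at the time supplied by [BV_le_aV_reached], so that at least
    half of [aV] survives the move from [m] to [s]. *)
Let eta : R := (4 * Cst * l%:R)^-1.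
Let s : R := mr - eta.
Let r : R := s / mr.
(** The first removal costs at most half of [aV]; each later one at most half of the drift eta/m;
    after [J] further steps the growth exceeds every value of A(s) compatible with coefficients at
    most H m^(-i). *)
Hypothesis h_start : r ^+ M * (4 + 2 * (mr + 2) / aV P) <= 1.
Hypothesis h_loss : mr * ((m * M).+1%:R ^+ 2 * H * r ^+ M) <= eta / (2 * mr).
Hypothesis h_grow : mr * (M.+1%:R ^+ 2 * H) < (1 + (3 * mr * M%:R)^-1) ^+ J * (eta / (2 * mr)).

Definition Z n j := iter j (fun Q => kill M (pstep Q)) (kill M (Y P n)).

Lemma Cst_ge1 : 1 <= Cst.
Proof.
have hm := mr_ge2; rewrite /Cst.
have : 1 <= (mr + 3) ^+ 3 by rewrite exprn_ege1 //; lra.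
by nra.
Qed.

Lemma Z_nneg_mass n j : nneg (Z n j) /\ (Z n j).[1] = 1.
Proof.
case: j => [|j]; first by split; [apply: kill_nneg; [exact: Y_nneg | exact: Y_mass] | exact: kill_mass].
split; last exact: kill_mass.
elim: j => [|j IH] /=.
  apply: kill_nneg; first by apply/pstep_nneg/kill_nneg; [exact: Y_nneg | exact: Y_mass].
  by rewrite pstep_mass kill_mass expr1n.
apply: kill_nneg; first by apply/pstep_nneg/IH.
by rewrite pstep_mass kill_mass expr1n.
Qed.

Lemma Z_size n j : (size (Z n j) <= M.+1)%N.
Proof. by case: j => [|j]; exact: size_kill. Qed.

(** If all coefficients were at most H m^(-i), each removal would be affordable, so A(s) would gain
    a factor 1 + 1/(3 m M) per step; but the same bound caps A(s) by m (M+1)^2 H. *)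
Theorem coef_overflow : exists2 n, (n <= l)%N &
  exists j i, [/\ (j <= J)%N, (0 < i <= m * M)%N & H < (pstep (Z n j))`_i * mr ^+ i].
Proof.
have hm := mr_ge2; have hC := Cst_ge1.
have hl1 : 1 <= l%:R :> R by rewrite ler1n.
have hpos : 0 < 4 * Cst * l%:R by rewrite !mulr_gt0 //; lra.
have heta : 0 < eta by rewrite invr_gt0.
have heta1 : eta <= 1 / 4.
  by rewrite /eta -div1r ler_pdivrMr //; nra.
have hs : 3 / 2 <= s by rewrite /s; lra.
have hsm : s <= mr by rewrite /s; lra.
have hr0 : 0 <= r by rewrite divr_ge0; lra.
have [n hnl hB] := BV_le_aV_reached hP h1 ha0 hT ha1 hl; exists n => //.
have hYn := Y_nneg n hP; have hY1 := Y_mass n h1.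
have ha := aV_gt0 hP h1 ha0 n; have haa := aV_ge hP h1 ha0 n.
have hA0 : 0 <= (Aop (Z n 0)).[s].
  apply: (le_trans _ (Aop_kill M hYn hY1 (_ : 1 <= s))); last by lra.
  rewrite subr_ge0; apply: (@le_trans _ _ (aV (Y P n) / 2)).
    have hd := over_decay M hYn (_ : 0 <= s) hsm (_ : 0 < mr).
    have {}hd : s * (over M (Y P n))^`().[s] <= r ^+ M * (mr * g1 (Y P n)) by apply: hd; lra.
    have hrM : 0 <= r ^+ M by exact: exprn_ge0.
    have hg1 := g1_ge0 hYn.
    have e1 : mr * (mr - 1) * g1 (Y P n) = aV (Y P n) + g (Y P n) by rewrite aVE; ring.
    have hg := g_le hYn hY1.
    have hh : 0 <= r ^+ M * (mr * g1 (Y P n)) by rewrite mulr_ge0 // mulr_ge0 //; lra.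
    apply: (@le_trans _ _ ((mr - 1) * (r ^+ M * (mr * g1 (Y P n))))).
      apply: (@le_trans _ _ ((s - 1) * (r ^+ M * (mr * g1 (Y P n))))).
        by rewrite ler_wpM2l //; lra.
      by rewrite ler_wpM2r //; lra.
    have -> : (mr - 1) * (r ^+ M * (mr * g1 (Y P n))) = r ^+ M * (aV (Y P n) + g (Y P n)).
      by rewrite -e1; ring.
    (* The additive m + 2 from [g_le] is charged to [aV (Y P n)], which is at least [aV P]. *)
    apply: (@le_trans _ _ (r ^+ M * (2 * aV (Y P n) + (mr + 2) * (aV (Y P n) / aV P)))).
      rewrite ler_wpM2l //.
      have : 1 <= aV (Y P n) / aV P by rewrite ler_pdivlMr // mul1r.
      by nra.
    have := ler_wpM2r (ltW ha) h_start.
    have -> : r ^+ M * (4 + 2 * (mr + 2) / aV P) * aV (Y P n) =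
      2 * (r ^+ M * (2 * aV (Y P n) + (mr + 2) * (aV (Y P n) / aV P))) by field; rewrite gt_eqF.
    lra.
  have hs1 : 1 <= s by lra.
  apply: (le_trans _ (Aop_lower hYn hs1 hsm)).
  have -> : mr - s = eta by rewrite /s; ring.
  have h2e : 0 <= 2 * eta by lra.
  have := ler_wpM2l h2e hB.
  have -> : 2 * eta * (Cst * l%:R * aV (Y P n)) = aV (Y P n) / 2.
    by rewrite /eta; field; lra.
  lra.
have [/existsP|hno] := boolP [exists j : 'I_J.+1, [exists i : 'I_(m * M).+1,
   (0 < i)%N && (H < (pstep (Z n j))`_i * mr ^+ i)]].
  case=> j /existsP[i /andP[hi hh]]; exists j, i; split => //.
    by rewrite -ltnS ltn_ord.
  by rewrite hi -ltnS ltn_ord.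
have {hno}hb j i : (j <= J)%N -> (0 < i)%N -> (pstep (Z n j))`_i * mr ^+ i <= H.
  move=> hj hi; have [hiM|hiM] := ltnP i (m * M).+1; last first.
    by rewrite nth_default ?mul0r // (leq_trans (size_pstep (Z_size n j))).
  rewrite leNgt; apply/negP => hc; case/negP: hno.
  apply/existsP; exists (Ordinal (hj : (j < J.+1)%N)); apply/existsP; exists (Ordinal hiM).
  by rewrite /= hi.
pose gam := 1 + (3 * mr * M%:R)^-1.
have hM0 : 0 < M%:R :> R by rewrite ltr0n.
have hgam : 1 <= gam by rewrite lerDl invr_ge0 !mulr_ge0 //; lra.
have hgam0 : 0 <= gam := le_trans ler01 hgam.
have he2 : 0 < eta / (2 * mr) by rewrite divr_gt0 //; lra.
(* The drift eta/m is split in two equal halves: one pays for the removal, the other starts and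
   feeds the growth. *)
have stepA j : (j <= J)%N -> 0 <= (Aop (Z n j)).[s] ->
    gam * (Aop (Z n j)).[s] + eta / (2 * mr) <= (Aop (Z n j.+1)).[s].
  move=> hj hA; have [hZ hZ1] := Z_nneg_mass n j.
  have hg := Aop_grow hZ hZ1 (Z_size n j) hM hs hsm hA.
  have hp1 : (pstep (Z n j)).[1] = 1 by rewrite pstep_mass hZ1 expr1n.
  have hs1 : 1 <= s by lra.
  have hk := Aop_kill M (pstep_nneg hZ) hp1 hs1.
  have ho := @over_bounded M (m * M) (pstep (Z n j)) s mr H (pstep_nneg hZ) _ hsm _ hH
     (size_pstep (Z_size n j)) (fun i hi => hb j i hj hi).
  have {}ho : s * (over M (pstep (Z n j)))^`().[s] <= (m * M).+1%:R ^+ 2 * H * r ^+ M by apply: ho; lra.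
  have hq : 0 <= (m * M).+1%:R ^+ 2 * H * r ^+ M by rewrite !mulr_ge0 ?exprn_ge0.
  have hl2 : (s - 1) * (s * (over M (pstep (Z n j)))^`().[s]) <= eta / (2 * mr).
    apply: le_trans h_loss.
    apply: (@le_trans _ _ ((s - 1) * ((m * M).+1%:R ^+ 2 * H * r ^+ M))).
      by rewrite ler_wpM2l //; lra.
    by rewrite ler_wpM2r //; lra.
  apply: (le_trans _ hk).
  have e : (mr - s) / mr = eta / (2 * mr) + eta / (2 * mr) by rewrite /s; field; lra.
  have aux (x y z w : R) : x + (w + w) <= y -> z <= w -> x + w <= y - z by lra.
  by apply: aux hl2; rewrite -e.
have hpow j : (j <= J)%N -> 0 <= (Aop (Z n j)).[s] /\ gam ^+ j * (eta / (2 * mr)) <= (Aop (Z n j.+1)).[s].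
  elim: j => [|j IH] hj.
    split=> //; rewrite expr0 mul1r; apply: le_trans (stepA 0%N hj hA0).
    by rewrite lerDr mulr_ge0.
  have [_ h] := IH (ltnW hj).
  have hg0 : 0 <= gam ^+ j * (eta / (2 * mr)) by rewrite mulr_ge0 ?exprn_ge0 // ltW.
  have hA : 0 <= (Aop (Z n j.+1)).[s] by exact: le_trans h.
  split=> //; apply: le_trans (stepA j.+1 hj hA).
  rewrite exprS -mulrA (le_trans (ler_wpM2l hgam0 h)) // lerDl; exact: ltW.
have [_ hlow] := hpow J (leqnn J).
have := lt_le_trans h_grow hlow; rewrite ltNge => /negP; case.
have [hZ hZ1] := Z_nneg_mass n J.+1.
have hZ' : nneg (Z n J.+1)^`() := deriv_nneg hZ.
rewrite Aop_horner.
have hZs : 0 <= (Z n J.+1).[s] by apply: horner_nneg => //; lra.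
have hds : 0 <= s * (Z n J.+1)^`().[s] by rewrite mulr_ge0 ?horner_nneg //; lra.
apply: (@le_trans _ _ ((s - 1) * (s * (Z n J.+1)^`().[s]))).
  by rewrite [s * (s - 1)]mulrC -mulrA gerBl.
apply: (@le_trans _ _ (mr * (s * (Z n J.+1)^`().[s]))).
  by rewrite ler_wpM2r //; lra.
rewrite ler_wpM2l //.
rewrite (eulerE s (Z_size n J.+1)).
have -> : M.+1%:R ^+ 2 * H = \sum_(i < M.+1) M.+1%:R * H.
  by rewrite sumr_const card_ord -mulr_natr; ring.
apply: ler_sum => i _; have [hi|hi] := posnP (nat_of_ord i).
  by rewrite hi mul0r mulr0 mulr_ge0.
rewrite mulrCA ler_pM //; first by rewrite mulr_ge0 ?exprn_ge0 //; lra.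
  by rewrite ler_nat ltnW.
rewrite [Z n J.+1]iterS -/(Z n J) coef_kill ltn_ord eqn0Ngt hi addr0.
apply: (le_trans _ (hb J i (leqnn J) hi)); rewrite ler_wpM2l ?pstep_nneg //.
  by case: (Z_nneg_mass n J).
by apply: lerXn2r; rewrite ?nnegrE //; lra.
Qed.
End Overflow.

Lemma linear_coef (Phi : {poly R} -> R) P N : (size P <= N)%N ->
  (forall c P Q, Phi (c *: P + Q) = c * Phi P + Phi Q) ->
  Phi P = \sum_(i < N) P`_i * Phi 'X^i.
Proof.
move=> hN lin.
have Phi0 : Phi 0 = 0.
  by have := lin (-1) 0 0; rewrite scaler0 addr0 mulN1r addNr.
have {1}-> : P = \sum_(i < N) P`_i *: 'X^i.
  rewrite -poly_def; apply/polyP => i; rewrite coef_poly; case: ltnP => // hi.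
  by rewrite nth_default // (leq_trans hN).
elim: N {hN} => [|N IH]; first by rewrite !big_ord0.
by rewrite !big_ord_recr /= addrC lin IH addrC.
Qed.

Lemma aV_coef P N : (size P <= N)%N ->
  aV P = \sum_(i < N) P`_i * (((mr - 1) * i%:R - 1) * mr ^+ i).
Proof.
move=> hN; rewrite (linear_coef (Phi := aV) hN); last first.
  by move=> c Q Q'; rewrite /aV Aop_linear hornerD hornerZ.
apply: eq_bigr => i _; congr (_ * _); rewrite aVE /g1 /g derivXnE hornerZ !hornerXn.
case: (nat_of_ord i) => [|j]; first by rewrite expr0; ring.
by rewrite exprS /=; ring.
Qed.

Lemma TV_coef_le P N : nneg P -> (size P <= N)%N ->
  TV P <= \sum_(i < N) P`_i * (2 * i%:R ^+ 3 * mr ^+ i).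
Proof.
move=> hP hN; rewrite (linear_coef (Phi := TV) hN); last first.
  by move=> c Q Q'; rewrite /TV Aop_linear !(derivD, derivZ, hornerD, hornerZ).
apply: ler_sum => i _; rewrite ler_wpM2l //.
rewrite TVE /g1 /g2 /g3 derivXnE derivZ derivXnE !derivZ derivXnE !hornerZ !hornerXn.
move: mr (mr_ge2) => c hc; case: (nat_of_ord i) => [|[|j]] /=.
- by rewrite !exprS !mul0r; lra.
- by rewrite !mul0r expr0 expr1 expr1n; lra.
have e : c * (j%:R * c ^+ j.-1) = j%:R * c ^+ j.
  by case: j => [|j] /=; [rewrite !mul0r mulr0 | rewrite mulrCA -exprS].
have hx : 0 < c ^+ j by rewrite exprn_gt0 //; lra.
have hj := ler0n R j.
rewrite -[j.+2]addn2 -[j.+1]addn1 !natrD !exprD expr1.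
move: (c ^+ j) (c ^+ j.-1) (j%:R : R) e hx hj => x x' y e hx hy.
have -> : 2 * ((y + 2) * (x * c)) + (4 * c - 3) * ((y + 2) * ((y + 1) * x)) +
     c * (c - 1) * ((y + 2) * ((y + 1) * (y * x')))
    = x * ((y + 2) * ((y + 3) * ((y + 2) * (c - 1) + 1)))
      + (c * (y * x') - y * x) * ((c - 1) * (y + 1) * (y + 2)) by ring.
rewrite e subrr mul0r addr0.
rewrite [leRHS](_ : _ = x * ((y + 2) * ((2 * (y + 2)) * ((y + 2) * c ^+ 2)))); last by ring.
rewrite ler_wpM2l ?(ltW hx) // ler_wpM2l //; first by lra.
apply: ler_pM; [lra | nra | lra | ].
have : (y + 2) * c <= (y + 2) * c ^+ 2 by rewrite ler_wpM2l //; [lra | nra].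
nra.
Qed.
End Core.

(** * Transfer from polynomials to laws *)

Section Bridge.
Notation RR := Rdefinitions.R.
Variable k : nat.
Notation m := (k.+2).
Implicit Types P Q : {poly RR}.
Notation cf P := (fun i => P`_i).

Lemma sum_ord (f : nat -> RR) n : sum_f_R0 f n = \sum_(i < n.+1) f i.
Proof. by elim: n => [|n IH]; rewrite big_ord_recr /= ?big_ord0 ?add0r // IH. Qed.

Lemma conv_poly P Q i : conv (cf P) (cf Q) i = (P * Q)`_i.
Proof. by rewrite /conv sum_ord coefM. Qed.

Lemma conv_pow_poly P n i : conv_pow (cf P) n i = (P ^+ n)`_i.
Proof.
elim: n i => [|n IH] i; first by rewrite expr0 coef1 /=; case: i.
rewrite exprS -conv_poly /=; exact: conv_ext.
Qed.

Lemma step_poly P i : step m (cf P) i = (pstep k P)`_i.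
Proof.
rewrite coef_pstep; case: i => [|i]; rewrite /step !conv_pow_poly; first by rewrite addrC.
by rewrite addr0.
Qed.

Lemma nneg_fun P : nneg P -> nonneg (cf P).
Proof. by move=> hP i; apply/RleP; exact: hP. Qed.

Lemma cdf_le1 P n : nneg P -> P.[1] = 1 -> \sum_(i < n.+1) P`_i <= 1.
Proof.
move=> hP h1; rewrite -[leRHS]h1 -[P in P.[_]](poly_take_drop n.+1) hornerD.
rewrite (_ : \sum_(i < n.+1) P`_i = (take_poly n.+1 P).[1]).
  by rewrite lerDl -/(over n P) horner_nneg ?ler01 //; exact: over_nneg.
rewrite (@horner_coef_wide _ n.+1) ?size_take_poly //.
by apply: eq_bigr => i _; rewrite coef_take_poly ltn_ord expr1n mulr1.
Qed.

(** Up to [M] the distribution function only gains the atom at 0; beyond [M] it equals 1, hence the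
    assumption that the partial sums of [f] are at most 1. *)
Lemma dom_kill M P f : nneg P -> P.[1] = 1 -> dom f (cf P) -> nonneg f ->
  (forall n, Rle (sum_f_R0 f n) 1) -> dom f (cf (kill M P)).
Proof.
move=> hP h1 hd hf hf1 n.
have hkn := kill_nneg M hP h1.
have [hn|hn] := leqP n M.
  apply: (Rle_trans _ _ _ (hd n)); apply/RleP; rewrite !sum_ord; apply: ler_sum => i _.
  rewrite coef_kill (leq_trans (ltn_ord i)) // lerDl; case: ifP => // _.
  rewrite subr_ge0 -[leRHS]h1 take_over hornerD hornerN gerBl.
  by rewrite horner_nneg ?ler01 //; exact: over_nneg.
apply: (Rle_trans _ _ _ (hf1 n)); apply/RleP; rewrite sum_ord R1E -{1}(kill_mass M P).
rewrite (@horner_coef_wide _ n.+1); last by rewrite (leq_trans (size_kill M P)) // ltnS ltnW.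
by apply: ler_sum => i _; rewrite expr1n mulr1.
Qed.

Lemma dom_ext (f g g' : nat -> RR) : (forall i, g i = g' i) -> dom f g -> dom f g'.
Proof.
move=> e h i; rewrite (_ : sum_f_R0 g' i = sum_f_R0 g i); first exact: h.
by apply: PartSum.sum_eq => j _.
Qed.

Lemma dom_Y P x n : nneg P -> nonneg x -> dom x (cf P) -> dom (law m x n) (cf (Y k P n)).
Proof.
move=> hP hx hd; elim: n => [|n IH] //=.
have hs := dom_step m _ _ (law_nonneg m x n hx) (nneg_fun (Y_nneg k n hP)) IH.
by apply: dom_ext hs; exact: step_poly.
Qed.

Lemma dom_Z P x M n j : nneg P -> P.[1] = 1 -> nonneg x -> dom x (cf P) ->
  (forall n i, Rle (sum_f_R0 (law m x n) i) 1) ->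
  dom (law m x (j + n)) (cf (Z k P M n j)).
Proof.
move=> hP h1 hx hd hx1; elim: j => [|j IH].
  apply: dom_kill; [exact: Y_nneg | exact: Y_mass | exact: dom_Y | exact: law_nonneg | exact: hx1].
have [hZ hZ1] := Z_nneg_mass k M hP h1 n j.
apply: dom_kill; [exact: pstep_nneg | by rewrite pstep_mass hZ1 expr1n | | exact: law_nonneg | exact: hx1].
have hs := dom_step m _ _ (law_nonneg m x (j + n) hx) (nneg_fun hZ) IH.
by apply: dom_ext hs; exact: step_poly.
Qed.

Local Notation Mr := (INR m).

Lemma overflow_real (f x : nat -> RR) (L l M J : nat) (H : RR) :
  nonneg f -> (forall i, (L < i)%coq_nat -> f i = IZR 0) -> sum_f_R0 f L = IZR 1 ->
  let A := sum_f_R0 (fun i => Rmult (f i) (Rmult (Rminus (Rmult (Rminus Mr 1) (INR i)) 1) (pow Mr i))) L in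
  Rlt 0 A -> Rle A (Rdiv 1 2) ->
  Rle (sum_f_R0 (fun i => Rmult (f i) (Rmult (Rmult 2 (pow (INR i) 3)) (pow Mr i))) L) (Rmult A (pow (INR l) 2)) ->
  (0 < l)%coq_nat -> (0 < M)%coq_nat -> Rle 0 H ->
  let eta := Rinv (Rmult (Rmult 4 (Rmult (Rmult 288 Mr) (pow (Rplus Mr 3) 3))) (INR l)) in
  let r := Rdiv (Rminus Mr eta) Mr in
  Rle (Rmult (pow r M) (Rplus 4 (Rdiv (Rmult 2 (Rplus Mr 2)) A))) 1 ->
  Rle (Rmult Mr (Rmult (Rmult (pow (INR (m * M).+1) 2) H) (pow r M))) (Rdiv eta (Rmult 2 Mr)) ->
  Rlt (Rmult Mr (Rmult (pow (INR M.+1) 2) H))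
    (Rmult (pow (Rplus 1 (Rinv (Rmult (Rmult 3 Mr) (INR M)))) J) (Rdiv eta (Rmult 2 Mr))) ->
  nonneg x -> (forall n i, Rle (sum_f_R0 (law m x n) i) 1) -> dom x f ->
  exists n i, [/\ (n <= l + J + 1)%coq_nat, (i < m * M)%coq_nat &
    Rlt H (Rmult (Rminus 1 (sum_f_R0 (law m x n) i)) (pow Mr i.+1))].
Proof.
move=> hf hL h1 A /RltP hA0 /RleP hA1 /RleP hT /ssrnat.ltP hl /ssrnat.ltP hM /RleP hH eta r /RleP hs /RleP hlo /RltP hg hx hx1 hd.
pose P : {poly RR} := \poly_(i < L.+1) f i.
have cP i : P`_i = f i by rewrite coef_poly; case: ltnP => // hi; rewrite hL //; exact/ssrnat.ltP.
have hP : nneg P by move=> i; rewrite cP; apply/RleP; exact: hf.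
have hsz : (size P <= L.+1)%N by exact: size_poly.
have hP1 : P.[1] = 1.
  rewrite (horner_coef_wide _ hsz) -R1E -[RHS]h1 sum_ord; apply: eq_bigr => i _.
  by rewrite expr1n mulr1 cP.
have eA : A = aV k P.
  rewrite /A sum_ord (aV_coef k hsz); apply: eq_bigr => i _.
  by rewrite !RealsE cP.
have hd' : dom x (fun i => P`_i) by apply: dom_ext hd => i; rewrite cP.
have hT' : TV k P <= aV k P * l%:R ^+ 2.
  apply: (le_trans (TV_coef_le k hP hsz)); rewrite -eA.
  move: hT; rewrite sum_ord !RealsE => /(le_trans _); apply.
  by apply: ler_sum => i _; rewrite !RealsE cP.
have := @coef_overflow _ k P l M J H hP hP1 _ _ hT' hl hM _.
rewrite -eA /Cst; move: hA0 hA1 hH hs hlo hg; rewrite /r /eta !RealsE /=.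
move=> hA0 hA1 hH hs hlo hg.
move=> /(_ hA0 hA1 hH hs hlo hg) [n hn [j [i [hj /andP[hi hiM] hlt]]]].
have [hZ hZ1] := Z_nneg_mass k M hP hP1 n j.
(* One step more than [Z], since the large coefficient belongs to [pstep (Z k P M n j)]; and [i.-1],
   since P(X > i - 1) is at least the mass at i. *)
exists (j + n).+1, i.-1; split.
- by apply/ssrnat.leP; rewrite addn1 ltnS addnC leq_add.
- by apply/ssrnat.ltP; rewrite prednK.
apply/RltP; rewrite !RealsE -exprS prednK //; apply: (lt_le_trans hlt).
rewrite ler_wpM2r ?exprn_ge0 // lerBrDr.
have hdom := dom_step m _ _ (law_nonneg m x (j + n) hx) (nneg_fun hZ) (dom_Z M n j hP hP1 hx hd' hx1).
have hpn := pstep_nneg k hZ.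
have hp1 : (pstep k (Z k P M n j)).[1] = 1 by rewrite pstep_mass hZ1 expr1n.
apply: le_trans (cdf_le1 i hpn hp1).
rewrite big_ord_recr /= [leRHS]addrC lerD2l.
have /RleP := hdom i.-1; rewrite sum_f_R0E sum_ord prednK // => h; apply: (le_trans h).
by apply: ler_sum => a _; rewrite step_poly.
Qed.
End Bridge.
End Poly.

Lemma tail_overflow (m : nat) (f x : nat -> R) (L l M J : nat) (H : R) :
  (2 <= m)%nat -> nonneg f -> (forall i, (L < i)%nat -> f i = 0) -> sum_f_R0 f L = 1 ->
  let A := sum_f_R0 (fun i => f i * (((INR m - 1) * INR i - 1) * INR m ^ i)) L in
  0 < A -> A <= 1 / 2 ->
  sum_f_R0 (fun i => f i * (2 * INR i ^ 3 * INR m ^ i)) L <= A * INR l ^ 2 ->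
  (0 < l)%nat -> (0 < M)%nat -> 0 <= H ->
  let eta := / (4 * (288 * INR m * (INR m + 3) ^ 3) * INR l) in
  let r := (INR m - eta) / INR m in
  r ^ M * (4 + 2 * (INR m + 2) / A) <= 1 ->
  INR m * (INR (S (m * M)) ^ 2 * H * r ^ M) <= eta / (2 * INR m) ->
  INR m * (INR (S M) ^ 2 * H) < (1 + / (3 * INR m * INR M)) ^ J * (eta / (2 * INR m)) ->
  nonneg x -> (forall n i, sum_f_R0 (law m x n) i <= 1) -> dom x f ->
  exists n i, (n <= l + J + 1)%nat /\ (i < m * M)%nat /\
    H < (1 - sum_f_R0 (law m x n) i) * INR m ^ S i.
Proof.
intros hm. destruct m as [|[|k]]; [lia|lia|]. intros.
destruct (@Poly.overflow_real k f x L l M J H) as [n [i [h1 h2 h3]]]; try assumption.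
exists n, i; repeat split; assumption.
Qed.

(** * Eventual inequalities, in the variable x = 1/(p - p_c) *)

Definition for_large (P : R -> Prop) := exists X, forall x, X < x -> P x.

Lemma for_large_and P Q : for_large P -> for_large Q -> for_large (fun x => P x /\ Q x).
Proof.
intros [X hX] [Y hY]. exists (Rmax X Y). intros x hx.
assert (h1 := Rmax_l X Y). assert (h2 := Rmax_r X Y). split; [apply hX|apply hY]; lra.
Qed.

Lemma for_large_imp (P Q : R -> Prop) : (forall x, P x -> Q x) -> for_large P -> for_large Q.
Proof. intros h [X hX]. exists X. intros x hx. apply h, hX, hx. Qed.

Lemma for_large_gt X : for_large (fun x => X < x).
Proof. exists X. auto. Qed.

Lemma Rpower_pos x y : 0 < Rpower x y.
Proof. apply exp_pos. Qed.

Lemma for_large_pow a b C : a < b -> for_large (fun x => C * Rpower x a <= Rpower x b).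
Proof.
intros hab. exists (Rpower (Rabs C + 1) (/ (b - a))). intros x hx.
assert (hC := Rabs_pos C). assert (hC' := Rle_abs C).
assert (hp := Rpower_pos (Rabs C + 1) (/ (b - a))).
assert (h : Rabs C + 1 <= Rpower x (b - a)).
{ replace (Rabs C + 1) with (Rpower (Rpower (Rabs C + 1) (/ (b - a))) (b - a)).
  - apply Rle_Rpower_l; lra.
  - rewrite Rpower_mult, Rinv_l, Rpower_1; lra. }
replace b with (a + (b - a)) at 1 by ring. rewrite Rpower_plus, Rmult_comm.
apply Rmult_le_compat_l; [left; apply Rpower_pos|lra].
Qed.

Lemma ln_le_self y : 0 < y -> ln y <= y.
Proof.
intros hy. assert (h := exp_ineq1_le (ln y)). rewrite exp_ln in h by exact hy. lra.
Qed.

(** As ln x <= (2/b) x^(b/2), each of ln C and a ln x is eventually at most half of c x^b. *)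
Lemma for_large_exp a b c C : 0 < b -> 0 < c -> 0 < C ->
  for_large (fun x => C * Rpower x a * exp (- (c * Rpower x b)) <= 1).
Proof.
intros hb hc hC.
assert (h1 := for_large_pow 0 b (2 * Rabs (ln C) / c) hb).
assert (h2 := for_large_pow (b / 2) b (4 * Rabs a / (b * c)) ltac:(lra)).
apply for_large_imp with (2 := for_large_and _ _ (for_large_gt 1) (for_large_and _ _ h1 h2)).
intros x [hx [e1 e2]]. rewrite Rpower_O in e1 by lra.
assert (hl : ln x <= 2 / b * Rpower x (b / 2)).
{ assert (h := ln_le_self (Rpower x (b / 2)) (Rpower_pos _ _)). unfold Rpower at 1 in h. rewrite ln_exp in h.
  apply Rmult_le_reg_l with (b / 2); [lra|]. field_simplify; field_simplify in h; lra. }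
assert (hl0 : 0 < ln x) by (rewrite <- ln_1; apply ln_increasing; lra).
assert (ha : a * ln x <= c / 2 * Rpower x b).
{ apply Rle_trans with (Rabs a * ln x); [apply Rmult_le_compat_r; [lra|apply Rle_abs]|].
  apply Rle_trans with (Rabs a * (2 / b * Rpower x (b / 2))); [apply Rmult_le_compat_l; [apply Rabs_pos|exact hl]|].
  apply Rmult_le_compat_l with (r := c / 2) in e2; [|lra].
  apply Rle_trans with (2 := e2). right. field. lra. }
assert (hC' : ln C <= c / 2 * Rpower x b).
{ apply Rle_trans with (1 := Rle_abs _). apply Rmult_le_compat_l with (r := c / 2) in e1; [|lra].
  apply Rle_trans with (2 := e1). right. field. lra. }
rewrite <- (exp_ln C) by exact hC. unfold Rpower at 1. rewrite <- !exp_plus, <- exp_0.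
destruct (Rle_lt_or_eq_dec (ln C + a * ln x + - (c * Rpower x b)) 0) as [h|h]; [lra| |].
- left. apply exp_increasing. exact h.
- rewrite h. lra.
Qed.

(** Telescoping: b (k+1)^(-1-b) <= k^(-b) - (k+1)^(-b), which follows from ln((k+1)/k) >=
    1/(k+1). *)
Lemma power_tail_sum b l n : 0 < b -> (1 <= l)%nat ->
  sum_f_R0 (fun k => if (k <=? l)%nat then 0 else Rpower (INR k) (- 1 - b)) n <= Rpower (INR l) (- b) / b.
Proof.
intros hb hl.
assert (key : forall n, (l <= n)%nat ->
  sum_f_R0 (fun k => if (k <=? l)%nat then 0 else Rpower (INR k) (- 1 - b)) n
   <= (Rpower (INR l) (- b) - Rpower (INR n) (- b)) / b).
{ intros k hk. induction hk as [|k hk IH].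
  - right. replace (Rpower (INR l) (- b) - Rpower (INR l) (- b)) with 0 by ring.
    unfold Rdiv; rewrite Rmult_0_l.
    rewrite <- (sum_eq (fun _ => 0)); [apply sum_eq_R0; reflexivity|].
    intros i hi. destruct (Nat.leb_spec i l); [reflexivity|lia].
  - rewrite tech5. destruct (Nat.leb_spec (S k) l) as [h|_]; [lia|].
    assert (hk0 : 0 < INR k) by (apply lt_0_INR; lia).
    assert (hk1 : 0 < INR (S k)) by (apply lt_0_INR; lia).
    assert (h : b * Rpower (INR (S k)) (- 1 - b) <= Rpower (INR k) (- b) - Rpower (INR (S k)) (- b)).
    { replace (- 1 - b) with (- b + - 1) by ring.
      rewrite Rpower_plus, Rpower_Ropp with (y := 1), Rpower_1 by exact hk1.
      assert (hr : Rpower (INR k) (- b) = Rpower (INR (S k)) (- b) * exp (b * (ln (INR (S k)) - ln (INR k)))).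
      { unfold Rpower. rewrite <- exp_plus. f_equal. ring. }
      rewrite hr. assert (hexp := exp_ineq1_le (b * (ln (INR (S k)) - ln (INR k)))).
      assert (hln : / INR (S k) <= ln (INR (S k)) - ln (INR k)).
      { assert (h := exp_ineq1_le (ln (INR k / INR (S k)))).
        rewrite exp_ln in h by (apply Rdiv_lt_0_compat; assumption).
        rewrite ln_div in h by assumption.
        replace (INR k / INR (S k)) with (1 - / INR (S k)) in h by (rewrite S_INR in *; field; lra). lra. }
      assert (hp := Rpower_pos (INR (S k)) (- b)).
      apply Rle_trans with (Rpower (INR (S k)) (- b) * (b * / INR (S k))); [right; ring|].
      apply Rle_trans with (Rpower (INR (S k)) (- b) * (exp (b * (ln (INR (S k)) - ln (INR k))) - 1)); [|right; ring].
      apply Rmult_le_compat_l; [lra|].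
      apply Rmult_le_compat_l with (r := b) in hln; lra. }
    apply Rmult_le_reg_r with b; [lra|]. rewrite Rmult_plus_distr_r.
    apply Rmult_le_compat_r with (r := b) in IH; [|lra].
    unfold Rdiv in *. rewrite Rmult_assoc, Rinv_l in IH by lra. rewrite Rmult_assoc, Rinv_l by lra. lra. }
assert (hp : forall k, 0 <= (if (k <=? l)%nat then 0 else Rpower (INR k) (- 1 - b))).
{ intros k. destruct (k <=? l)%nat; [lra|left; apply Rpower_pos]. }
apply Rle_trans with (1 := sum_mono _ n (n + l) hp ltac:(lia)).
apply Rle_trans with (1 := key (n + l)%nat ltac:(lia)).
apply Rmult_le_compat_r; [left; apply Rinv_0_lt_compat; lra|].
assert (h := Rpower_pos (INR (n + l)) (- b)). lra.
Qed.

Lemma ser_le_bound f a B : ser f a -> (forall n, sum_f_R0 f n <= B) -> a <= B.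
Proof.
intros h hB. apply is_series_Reals in h.
apply Rle_cv_lim with (fun n => sum_f_R0 f n) (fun _ => B).
- exact hB.
- exact h.
- intros e he. exists 0%nat. intros. unfold Rdist. rewrite Rminus_diag, Rabs_R0. exact he.
Qed.

Lemma nat_ceil y : 1 <= y -> exists n : nat, (1 <= n)%nat /\ y <= INR n <= 2 * y.
Proof.
intros hy. destruct (nfloor_ex y ltac:(lra)) as [n [h1 h2]].
exists (S n). rewrite S_INR. split; [lia|lra].
Qed.

Lemma Rpower_inv x y : 0 < x -> Rpower (/ x) (- y) = Rpower x y.
Proof. intros hx. unfold Rpower. rewrite ln_Rinv by exact hx. f_equal. ring. Qed.

Lemma pow_sub_exp y n : 0 <= y <= 1 -> (1 - y) ^ n <= exp (- (INR n * y)).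
Proof.
intros hy. induction n as [|n IH].
- simpl. rewrite Rmult_0_l, Ropp_0, exp_0. lra.
- rewrite S_INR. replace (- ((INR n + 1) * y)) with (- y + - (INR n * y)) by ring.
  rewrite exp_plus. simpl. apply Rmult_le_compat; [lra|apply pow_le; lra| |exact IH].
  assert (h := exp_ineq1_le (- y)). lra.
Qed.

Lemma pow_add_exp y n : 0 <= y <= 1 -> exp (INR n * (y / 2)) <= (1 + y) ^ n.
Proof.
intros hy. induction n as [|n IH].
- simpl. rewrite Rmult_0_l, exp_0. lra.
- rewrite S_INR. replace ((INR n + 1) * (y / 2)) with (y / 2 + INR n * (y / 2)) by ring.
  rewrite exp_plus. simpl. apply Rmult_le_compat; try (left; apply exp_pos); [|exact IH].
  assert (h := exp_ineq1_le (- (y / 2))). rewrite exp_Ropp in h. assert (hp := exp_pos (y / 2)).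
  apply Rmult_le_compat_r with (r := exp (y / 2)) in h; [|lra]. rewrite Rinv_l in h by lra.
  nra.
Qed.

(** * The initial law: bounds, moments and the value of A_0 *)

Section Initial.
Variables (m : nat) (q : nat -> R) (c0 alpha S : R).
Hypotheses (hm : (2 <= m)%nat) (hq : nonneg q) (hq0 : q 0%nat = 0) (hq1 : ser q 1)
  (hc0 : 0 < c0) (halpha : 2 < alpha)
  (hasympt : Un_cv (fun k => q k / (c0 * / INR m ^ k * Rpower (INR k) (- alpha))) 1)
  (hS : ser (fun k => q k * ((INR m - 1) * INR k - 1) * INR m ^ k) S).
Notation M := (INR m).

(** The upper bound has to hold from k = 1 on, as it is summed over all k; the finitely many ratios
    before [kc] are added to the constant. *)
Lemma q_bounds : exists kc C, 0 < C /\
  (forall k, (1 <= k)%nat -> q k * M ^ k <= C * Rpower (INR k) (- alpha)) /\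
  (forall k, (kc <= k)%nat -> c0 / 2 * Rpower (INR k) (- alpha) <= q k * M ^ k).
Proof.
assert (hM := m_ge2 m hm).
destruct (hasympt (1 / 2) ltac:(lra)) as [kc hk].
assert (hpow : forall k, 0 < M ^ k) by (intros; apply pow_lt; lra).
assert (hr : forall k, (kc <= k)%nat -> c0 / 2 * Rpower (INR k) (- alpha) <= q k * M ^ k <= 2 * c0 * Rpower (INR k) (- alpha)).
{ intros k h. specialize (hk k h). unfold Rdist in hk. apply Rabs_def2 in hk.
  assert (hp := Rpower_pos (INR k) (- alpha)).
  set (w := c0 * / M ^ k * Rpower (INR k) (- alpha)) in *.
  assert (hw : 0 < w) by (repeat apply Rmult_lt_0_compat; auto; apply Rinv_0_lt_compat; auto).
  assert (e : q k = (q k / w) * w) by (field; lra).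
  assert (ew : w * M ^ k = c0 * Rpower (INR k) (- alpha)) by (unfold w; field; apply Rgt_not_eq, hpow).
  assert (ew2 : q k * M ^ k = (q k / w) * (c0 * Rpower (INR k) (- alpha))) by (rewrite <- ew, <- Rmult_assoc, <- e; reflexivity).
  rewrite ew2. assert (0 < c0 * Rpower (INR k) (- alpha)) by (apply Rmult_lt_0_compat; lra).
  split; nra. }
set (g := fun k => q k * M ^ k / Rpower (INR k) (- alpha)).
assert (hg : forall k, 0 <= g k).
{ intros k. apply Rdiv_le_0_compat; [apply Rmult_le_pos; [apply hq|left; apply hpow]|apply Rpower_pos]. }
exists kc, (2 * c0 + sum_f_R0 g kc). assert (hs := cond_pos_sum g kc hg).
split; [lra|]. split; [|intros k h; apply hr; exact h].
intros k h1. assert (hp := Rpower_pos (INR k) (- alpha)).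
destruct (Nat.le_gt_cases kc k) as [h|h].
- apply Rle_trans with (1 := proj2 (hr k h)). apply Rmult_le_compat_r; lra.
- apply Rle_trans with (g k * Rpower (INR k) (- alpha)); [right; unfold g; field; lra|].
  apply Rmult_le_compat_r; [lra|].
  assert (h2 := sum_mono g k kc hg ltac:(lia)).
  assert (g k <= sum_f_R0 g k); [|lra].
  destruct k as [|k]; [simpl; lra|]. rewrite tech5. assert (h3 := cond_pos_sum g k hg). lra.
Qed.

Lemma q_series : exists G K, ser (wt M q) G /\ ser (fun k => INR k * wt M q k) K.
Proof.
assert (hM := m_ge2 m hm).
(* Twice the weight (m-1) k - 1 dominates k only from k = 2 on; for m = 2 it vanishes at k = 1, so
   that term is added by hand. *)
set (b := fun k => 2 * (q k * ((M - 1) * INR k - 1) * M ^ k) + (if Nat.eqb k 1 then q 1%nat * M else 0)).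
assert (hb : ser b (2 * S + q 1%nat * M)).
{ apply ser_plus; [apply ser_scal; exact hS|].
  assert (h := ser_finite (fun k => if Nat.eqb k 1 then q 1%nat * M else 0) 1).
  simpl in h. apply ser_eq with (2 := Rplus_0_l _). apply h.
  intros k hk. destruct k as [|[|k]]; [lia|lia|reflexivity]. }
assert (hle : forall k, 0 <= INR k * wt M q k <= b k).
{ intros k. assert (hqk := hq k). assert (hp := Mpow_ge1 m hm k). unfold wt, b.
  split; [repeat apply Rmult_le_pos; try lra; apply pos_INR|].
  destruct k as [|[|k]].
  - rewrite hq0. simpl. lra.
  - simpl. assert (0 <= q 1%nat * M * (M - 2)) by (repeat apply Rmult_le_pos; lra). lra.
  - simpl Nat.eqb. set (j := INR (Datatypes.S (Datatypes.S k))).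
    assert (hj : 2 <= j) by (unfold j; rewrite !S_INR; generalize (pos_INR k); lra).
    set (y := q (Datatypes.S (Datatypes.S k)) * M ^ Datatypes.S (Datatypes.S k)).
    assert (hy : 0 <= y) by (apply Rmult_le_pos; lra).
    assert (0 <= y * (2 * ((M - 1) * j - 1) - j)) by (apply Rmult_le_pos; [exact hy|nra]).
    unfold y in *. lra. }
destruct (ser_dominated _ b _ hb hle) as [K [hK _]].
destruct (ser_dominated (wt M q) _ _ hK) as [G [hG _]]; [|exists G, K; auto].
intros k. assert (hw := wt_nonneg M q ltac:(lra) hq k). split; [exact hw|].
destruct k as [|k]; [unfold wt; rewrite hq0; lra|].
rewrite <- (Rmult_1_l (wt M q (Datatypes.S k))) at 1. apply Rmult_le_compat_r; [exact hw|].
rewrite S_INR. generalize (pos_INR k). lra.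
Qed.

Lemma S_ge0 : 0 <= S.
Proof.
assert (hM := m_ge2 m hm). apply (ser_ge0 _ _ hS). intros k.
destruct k as [|k]; [rewrite hq0; lra|].
apply Rmult_le_pos; [apply Rmult_le_pos; [apply hq|]|generalize (Mpow_ge1 m hm (Datatypes.S k)); lra].
rewrite S_INR. generalize (pos_INR k). nra.
Qed.

Section Mix.
Variable p : R.
Hypothesis hp : 0 <= p <= 1.

Lemma ser_mix (w : nat -> R) (a : R) : ser (fun k => w k * q k) a -> ser (fun k => w k * mix p q k) (w 0%nat * (1 - p) + p * a).
Proof.
intros h.
assert (h0 : ser (fun k => if Nat.eqb k 0 then w 0%nat * (1 - p) else 0) (w 0%nat * (1 - p))).
{ apply (ser_finite (fun k => if Nat.eqb k 0 then w 0%nat * (1 - p) else 0) 0).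
  intros k hk. destruct k; [destruct (Nat.lt_irrefl _ hk)|reflexivity]. }
apply ser_ext with (2 := ser_plus _ _ _ _ h0 (ser_scal p _ _ h)).
intros k. unfold mix. destruct k; simpl; ring.
Qed.

Lemma mix_nonneg : nonneg (mix p q).
Proof. intros k. unfold mix. assert (h := hq k). destruct (Nat.eqb k 0); nra. Qed.

Lemma mix_ser : ser (mix p q) 1.
Proof.
assert (h := ser_mix (fun _ => 1) 1 (ser_ext _ _ _ (fun k => eq_sym (Rmult_1_l (q k))) hq1)).
apply ser_eq with (1 * (1 - p) + p * 1); [|ring].
apply ser_ext with (2 := h). intros k; apply Rmult_1_l.
Qed.

Lemma mix_moments : exists G K, ser (wt M (mix p q)) G /\ ser (fun k => INR k * wt M (mix p q) k) K.
Proof.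
destruct q_series as [G [K [hG hK]]].
exists (1 * (1 - p) + p * G), (0 * (1 - p) + p * K). split.
- assert (h := ser_mix (fun k => M ^ k) G (ser_ext _ _ _ (fun k => Rmult_comm _ _) hG)).
  apply ser_ext with (2 := h). intros k; unfold wt; ring.
- assert (h := ser_mix (fun k => INR k * M ^ k) K). simpl in h. rewrite Rmult_1_r in h.
  assert (h' : ser (fun k => INR k * M ^ k * q k) K) by (apply ser_ext with (2 := hK); intros k; unfold wt; ring).
  apply ser_ext with (2 := h h'). intros k; unfold wt; ring.
Qed.

Lemma mix_mean : exists e, ser (fun k => INR k * mix p q k) e.
Proof.
destruct mix_moments as [G [K [_ hK]]].
destruct (ser_dominated (fun k => INR k * mix p q k) _ _ hK) as [e [he _]]; [|exists e; exact he].
intros k. assert (h := mix_nonneg k). assert (h1 := Mpow_ge1 m hm k). assert (h2 := pos_INR k). unfold wt.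
split; [apply Rmult_le_pos; assumption|]. apply Rmult_le_compat_l; [exact h2|].
rewrite <- (Rmult_1_r (mix p q k)) at 1. apply Rmult_le_compat_l; assumption.
Qed.

Lemma mix_As (G K : R) : ser (wt M (mix p q)) G -> ser (fun k => INR k * wt M (mix p q) k) K ->
  (M - 1) * K - G = p * (1 + S) - 1.
Proof.
intros hG hK.
assert (h := ser_mix (fun k => ((M - 1) * INR k - 1) * M ^ k) S).
simpl in h.
assert (h' : ser (fun k => ((M - 1) * INR k - 1) * M ^ k * q k) S) by (apply ser_ext with (2 := hS); intros k; ring).
specialize (h h').
assert (h2 := ser_plus _ _ _ _ (ser_scal (M - 1) _ _ hK) (ser_scal (-1) _ _ hG)).
replace ((M - 1) * K - G) with ((M - 1) * K + -1 * G) by ring.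
assert (h3 : ser (fun k => ((M - 1) * INR k - 1) * M ^ k * mix p q k) ((M - 1) * K + -1 * G)).
{ apply ser_ext with (2 := h2). intros k; unfold wt; ring. }
rewrite (ser_unique _ _ _ h3 h). ring.
Qed.

(** The [k] values in (k, 2k] each contribute at least p (c0/2) (2k)^(-alpha). Replacing [p] by [pc]
    makes the constant uniform as p tends to p_c. *)
Lemma Vt_mix_lower pc kc : 0 <= pc -> pc <= p ->
  (forall k, (kc <= k)%nat -> c0 / 2 * Rpower (INR k) (- alpha) <= q k * M ^ k) ->
  forall k, (kc <= k)%nat -> (1 <= k)%nat ->
  pc * (c0 / 2 * Rpower 2 (- alpha)) * Rpower (INR k) (1 - alpha) <= Vt m (mix p q) 0 k.
Proof.
intros hpc hpcp hk k h1 h2. destruct mix_moments as [G [K [hG hK]]].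
assert (hser := Gs_ser m (mix p q) G K hm mix_nonneg hG hK 0).
assert (hw := wtX_nonneg m (mix p q) hm mix_nonneg 0).
assert (hk0 : 0 < INR k) by (apply lt_0_INR; lia).
set (t := c0 / 2 * Rpower (INR (2 * k)) (- alpha)).
assert (ht : 0 < t) by (apply Rmult_lt_0_compat; [lra|apply Rpower_pos]).
assert (hstep : forall j, (j <= k)%nat -> pc * (INR j * t) <= Pt m (mix p q) 0 (k + j) - Pt m (mix p q) 0 k).
{ induction j as [|j IH]; intros hj.
  - rewrite Nat.add_0_r. simpl. lra.
  - specialize (IH ltac:(lia)). rewrite Nat.add_succ_r. unfold Pt in *. rewrite tech5.
    assert (e : t <= q (Datatypes.S (k + j)) * M ^ (Datatypes.S (k + j))).
    { apply Rle_trans with (2 := hk (Datatypes.S (k + j)) ltac:(lia)). apply Rmult_le_compat_l; [lra|].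
      rewrite !Rpower_Ropp. apply Rinv_le_contravar; [apply Rpower_pos|].
      apply Rle_Rpower_l; [lra|]. split; [apply lt_0_INR; lia|apply le_INR; lia]. }
    assert (e2 : pc * t <= wt M (law m (mix p q) 0) (Datatypes.S (k + j))).
    { unfold wt, mix. simpl law. simpl Nat.eqb. cbv iota.
      apply Rle_trans with (p * (q (Datatypes.S (k + j)) * M ^ Datatypes.S (k + j))); [|unfold mix; simpl Nat.eqb; cbv iota; right; ring].
      apply Rmult_le_compat; lra. }
    rewrite S_INR. lra. }
specialize (hstep k (Nat.le_refl k)).
assert (hle := ser_partial_le _ _ (k + k) hser hw). unfold Vt. unfold Pt in *.
apply Rle_trans with (pc * (INR k * t)); [|lra].
right. unfold t. rewrite mult_INR. simpl (INR 2). rewrite <- Rpower_mult_distr by lra.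
replace (1 - alpha) with (1 + - alpha) by ring. rewrite (Rpower_plus 1 (- alpha)), Rpower_1 by exact hk0. 
replace (1 + 1) with 2 by ring. ring.
Qed.
End Mix.
End Initial.

Lemma Rpower_ge1 x b : 1 <= x -> 0 <= b -> 1 <= Rpower x b.
Proof.
intros hx hb. rewrite <- (Rpower_O x) by lra. apply Rle_Rpower; lra.
Qed.

(** * Upper bound for the free energy *)

Section Upper.
Variables (m : nat) (q : nat -> R) (c0 alpha S : R).
Hypotheses (hm : (2 <= m)%nat) (hq : nonneg q) (hq0 : q 0%nat = 0) (hq1 : ser q 1)
  (hc0 : 0 < c0) (halpha : 2 < alpha)
  (hasympt : Un_cv (fun k => q k / (c0 * / INR m ^ k * Rpower (INR k) (- alpha))) 1)
  (hS : ser (fun k => q k * ((INR m - 1) * INR k - 1) * INR m ^ k) S).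
Notation M := (INR m).
Notation pc := (1 / (1 + S)).
Notation nu := (1 / (alpha - 2)).

Lemma free_energy_upper e : 0 < e < nu -> for_large (fun x => forall p F, p = pc + / x -> p <= 1 ->
  (forall n, F <= mean m (mix p q) n / M ^ n) -> F <= exp (- Rpower x (nu - e))).
Proof.
intros he. assert (hM := m_ge2 m hm). assert (hS0 := S_ge0 m q S hm hq hq0 hS).
destruct (q_bounds m q c0 alpha hm hq hc0 hasympt) as [kc [C [hC [_ hlow]]]].
assert (hpc : 0 < pc) by (apply Rdiv_lt_0_compat; lra).
set (c := pc * (c0 / 2 * Rpower 2 (- alpha))).
assert (hc : 0 < c).
{ apply Rmult_lt_0_compat; [exact hpc|]. apply Rmult_lt_0_compat; [lra|apply Rpower_pos]. }
set (GC := growth_const m c alpha).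
set (C1 := (1 + S) * GC * Rpower (2 + INR kc) (alpha - 2)).
assert (hlM : 0 < ln M) by (rewrite <- ln_1; apply ln_increasing; lra).
assert (hne : 0 < nu - e / 2) by lra.
assert (a2 : 0 < alpha - 2) by lra.
assert (E1 := for_large_pow (1 - e / 2 * (alpha - 2)) 1 C1 ltac:(nra)).
assert (E2 := for_large_pow (nu - e) (nu - e / 2) (2 / ln M) ltac:(lra)).
assert (E3 := for_large_pow 0 (nu - e / 2) (2 * (ln (M + 4) + ln M) / ln M) ltac:(lra)).
apply for_large_imp with (2 := for_large_and _ _ (for_large_gt (1 + S)) (for_large_and _ _ E1 (for_large_and _ _ E2 E3))).
intros x [hx [e1 [e2 e3]]] p F hp hp1 hF.
assert (hx0 : 0 < / x) by (apply Rinv_0_lt_compat; lra).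
assert (hp0 : 0 <= p <= 1) by lra.
rewrite Rpower_O in e3 by lra. rewrite Rpower_1 in e1 by lra.
(* Half of [e] makes y^(alpha-2) of smaller order than x, so that A_0 D_N <= 1; the other half makes
   y ln m exceed x^(nu-e) together with the constants. *)
set (y := Rpower x (nu - e / 2)) in *.
assert (hy : 1 <= y) by (apply Rpower_ge1; lra).
destruct (nfloor_ex y ltac:(lra)) as [N [hN1 hN2]].
assert (hf := mix_nonneg q hq p hp0).
assert (h1 := mix_ser q hq1 p).
destruct (mix_moments m q S hm hq hq0 hS p) as [G [K [hG hK]]].
assert (hA0 : As m (mix p q) 0 = (1 + S) / x).
{ unfold As. rewrite (mix_As m q S hS p (Gs m (mix p q) 0) (Ks m (mix p q) 0)).
  - rewrite hp. field. lra.
  - apply (Gs_ser m (mix p q) G K hm hf hG hK 0).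
  - apply (Ks_ser m (mix p q) G K hm hf hG hK 0). }
assert (hA01 : 0 <= As m (mix p q) 0 <= 1).
{ rewrite hA0. split; [apply Rdiv_le_0_compat; lra|]. apply Rmult_le_reg_r with x; [lra|].
  unfold Rdiv. rewrite Rmult_assoc, Rinv_l by lra. lra. }
assert (hV := Vt_mix_lower m q c0 alpha S hm hq hq0 hc0 halpha hS p hp0 pc kc ltac:(lra) ltac:(lra) hlow).
fold c in hV.
assert (hcond : As m (mix p q) 0 * (GC * Rpower (INR (N + 1 + kc)) (alpha - 2)) <= 1).
{ rewrite hA0.
  assert (hkc := pos_INR kc).
  assert (hN0 : 0 < INR (N + 1 + kc)) by (apply lt_0_INR; lia).
  assert (hle : Rpower (INR (N + 1 + kc)) (alpha - 2) <= Rpower (2 + INR kc) (alpha - 2) * Rpower x (1 - e / 2 * (alpha - 2))).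
  { replace (Rpower x (1 - e / 2 * (alpha - 2))) with (Rpower y (alpha - 2)).
    - rewrite Rpower_mult_distr by lra. apply Rle_Rpower_l; [lra|]. split; [exact hN0|].
      rewrite !plus_INR. simpl (INR 1). nra.
    - unfold y. rewrite Rpower_mult. f_equal. field. lra. }
  assert (hGC : 0 < GC).
  { unfold GC, growth_const. apply Rdiv_lt_0_compat.
    - assert (0 < (M + 3) ^ pred m) by (apply pow_lt; lra). lra.
    - apply Rmult_lt_0_compat; [exact hc|apply Rpower_pos]. }
  apply Rmult_le_reg_r with x; [lra|].
  replace ((1 + S) / x * (GC * Rpower (INR (N + 1 + kc)) (alpha - 2)) * x)
    with ((1 + S) * GC * Rpower (INR (N + 1 + kc)) (alpha - 2)) by (field; lra).
  rewrite Rmult_1_l. apply Rle_trans with (2 := e1). unfold C1. rewrite (Rmult_assoc ((1 + S) * GC)).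
  apply Rmult_le_compat_l; [apply Rmult_le_pos; lra|exact hle]. }
assert (hAN := As_le1 m (mix p q) G K hm hf h1 hG hK c alpha kc N hc halpha hV hA01 hcond N (Nat.le_refl N)).
assert (hKN := Ks_le m (mix p q) G K hm hf h1 hG hK N). rewrite Rabs_pos_eq in hKN by lra.
assert (hmean := mean_le_Ks m (mix p q) G K hm hf hG hK N).
assert (hpowN : 0 < M ^ N) by (apply pow_lt; lra).
apply Rle_trans with (1 := hF N). apply Rle_trans with ((M + 4) / M ^ N).
{ apply Rmult_le_compat_r; [left; apply Rinv_0_lt_compat; exact hpowN|lra]. }
replace ((M + 4) / M ^ N) with (exp (ln (M + 4) - INR N * ln M)).
- assert (hfin : Rpower x (nu - e) <= INR N * ln M - ln (M + 4)).
  { apply Rmult_le_compat_l with (r := ln M / 2) in e2; [|lra].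
    apply Rmult_le_compat_l with (r := ln M / 2) in e3; [|lra].
    replace (ln M / 2 * (2 / ln M * Rpower x (nu - e))) with (Rpower x (nu - e)) in e2 by (field; lra).
    replace (ln M / 2 * (2 * (ln (M + 4) + ln M) / ln M * 1)) with (ln (M + 4) + ln M) in e3 by (field; lra).
    assert ((y - 1) * ln M <= INR N * ln M) by (apply Rmult_le_compat_r; lra). lra. }
  destruct (Rle_lt_or_eq_dec (ln (M + 4) - INR N * ln M) (- Rpower x (nu - e))) as [h|h]; [lra| |].
  + left. apply exp_increasing. exact h.
  + rewrite h. lra.
- unfold Rminus. rewrite exp_plus, exp_Ropp, exp_ln by lra.
  replace (exp (INR N * ln M)) with (M ^ N); [reflexivity|].
  rewrite <- Rpower_pow by lra. reflexivity.
Qed.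
End Upper.

Lemma exp_mono a b : a <= b -> exp a <= exp b.
Proof.
intros h. destruct (Rle_lt_or_eq_dec a b h) as [h'|h']; [left; apply exp_increasing; exact h'|rewrite h'; lra].
Qed.

(** * Truncation of the initial law at level [l] *)

Definition trunc (l : nat) (p : R) (q : nat -> R) (k : nat) : R :=
  if Nat.eqb k 0 then 1 - p * sum_f_R0 q l else if (k <=? l)%nat then p * q k else 0.

Section Truncation.
Variables (m : nat) (q : nat -> R) (alpha S C p : R) (l : nat).
Hypotheses (hm : (2 <= m)%nat) (hq : nonneg q) (hq0 : q 0%nat = 0) (hq1 : ser q 1)
  (halpha : 2 < alpha <= 4)
  (hS : ser (fun k => q k * ((INR m - 1) * INR k - 1) * INR m ^ k) S)
  (hC : 0 < C) (hup : forall k, (1 <= k)%nat -> q k * INR m ^ k <= C * Rpower (INR k) (- alpha))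
  (hp : 0 <= p <= 1) (hl : (1 <= l)%nat).
Notation M := (INR m).

Lemma trunc_sum w k : (k <= l)%nat -> sum_f_R0 (fun i => trunc l p q i * w i) k =
  p * sum_f_R0 (fun i => q i * w i) k + (1 - p * sum_f_R0 q l) * w 0%nat.
Proof.
induction k as [|k IH]; intros hk.
- simpl. unfold trunc. simpl. rewrite hq0. ring.
- rewrite !tech5, IH by lia. unfold trunc. simpl Nat.eqb. cbv iota.
  destruct (Nat.leb_spec (Datatypes.S k) l) as [h|h]; [ring|lia].
Qed.

Lemma trunc_cdf k : (k <= l)%nat -> sum_f_R0 (trunc l p q) k = p * sum_f_R0 q k + (1 - p * sum_f_R0 q l).
Proof.
intros hk. rewrite (sum_eq _ (fun i => trunc l p q i * 1)) by (intros; ring).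
rewrite trunc_sum by exact hk. rewrite Rmult_1_r. f_equal. f_equal. apply sum_eq. intros; ring.
Qed.

Lemma trunc_supp i : (l < i)%nat -> trunc l p q i = 0.
Proof.
intros hi. unfold trunc. destruct i as [|i]; [lia|]. simpl Nat.eqb. cbv iota.
destruct (Nat.leb_spec (Datatypes.S i) l); [lia|reflexivity].
Qed.

Lemma trunc_total : sum_f_R0 (trunc l p q) l = 1.
Proof. rewrite trunc_cdf by lia. ring. Qed.

Lemma trunc_nonneg : nonneg (trunc l p q).
Proof.
intros k. unfold trunc. assert (h := ser_partial_le _ _ l hq1 hq). assert (h' := hq k).
assert (h0 := cond_pos_sum q l hq).
destruct (Nat.eqb k 0); [nra|]. destruct (k <=? l)%nat; nra.
Qed.

Lemma mix_cdf k : sum_f_R0 (mix p q) k = 1 - p + p * sum_f_R0 q k.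
Proof.
induction k as [|k IH]; [unfold mix; simpl; ring|]. rewrite !tech5, IH. unfold mix. simpl Nat.eqb. cbv iota. ring.
Qed.

Lemma dom_trunc : dom (mix p q) (trunc l p q).
Proof.
intros k. rewrite mix_cdf.
assert (h := ser_partial_le _ _ l hq1 hq). assert (h' := ser_partial_le _ _ k hq1 hq).
destruct (Nat.le_gt_cases k l) as [hk|hk].
- rewrite trunc_cdf by exact hk. nra.
- assert (h2 := sum_mono _ l k trunc_nonneg ltac:(lia)). rewrite trunc_total in h2. nra.
Qed.

Let A := sum_f_R0 (fun i => trunc l p q i * (((M - 1) * INR i - 1) * M ^ i)) l.

Lemma trunc_A : A = p * sum_f_R0 (fun k => q k * ((M - 1) * INR k - 1) * M ^ k) l - (1 - p * sum_f_R0 q l).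
Proof.
unfold A. rewrite trunc_sum by lia. simpl (INR 0). simpl (M ^ 0).
rewrite (sum_eq (fun i => q i * (((M - 1) * INR i - 1) * M ^ i)) (fun k => q k * ((M - 1) * INR k - 1) * M ^ k)) by (intros; ring).
ring.
Qed.

Lemma term_nonneg k : 0 <= q k * ((M - 1) * INR k - 1) * M ^ k.
Proof.
assert (hM := m_ge2 m hm).
destruct k as [|k]; [rewrite hq0; lra|].
apply Rmult_le_pos; [apply Rmult_le_pos; [apply hq|]|generalize (Mpow_ge1 m hm (Datatypes.S k)); lra].
rewrite S_INR. generalize (pos_INR k). nra.
Qed.

Lemma trunc_A_le : A <= p * (1 + S) - 1.
Proof.
rewrite trunc_A. assert (h := ser_partial_le _ _ l hq1 hq).
assert (h' := ser_partial_le _ _ l hS term_nonneg). nra.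
Qed.

(** Moving a value k to 0 costs p q(k) (((m-1) k - 1) m^k + 1), which is at most m C k^(1-alpha);
    the sum over k > l is of order l^(2-alpha). *)
Lemma trunc_A_ge : p * (1 + S) - 1 - M * C / (alpha - 2) * Rpower (INR l) (2 - alpha) <= A.
Proof.
assert (hM := m_ge2 m hm).
rewrite trunc_A.
set (s1 := sum_f_R0 (fun k => q k * ((M - 1) * INR k - 1) * M ^ k) l). set (s2 := sum_f_R0 q l).
assert (h1 := ser_partial_le _ _ l hS term_nonneg). assert (h2 := ser_partial_le _ _ l hq1 hq).
fold s1 in h1. fold s2 in h2.
assert (ht := ser_plus _ _ _ _ (ser_tail _ _ l hS) (ser_tail _ _ l hq1)). fold s1 s2 in ht.
assert (hb : S - s1 + (1 - s2) <= M * C / (alpha - 2) * Rpower (INR l) (2 - alpha)).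
{ apply (ser_le_bound _ _ _ ht). intros n.
  assert (hpt := power_tail_sum (alpha - 2) l n ltac:(lra) hl).
  apply Rle_trans with (M * C * (Rpower (INR l) (- (alpha - 2)) / (alpha - 2))).
  2:{ right. replace (- (alpha - 2)) with (2 - alpha) by ring. field. lra. }
  assert (hMC : 0 <= M * C) by (apply Rmult_le_pos; lra).
  apply Rle_trans with (2 := Rmult_le_compat_l _ _ _ hMC hpt).
  rewrite scal_sum. apply sum_Rle. intros k _.
  destruct (Nat.leb_spec k l) as [h|h]; [lra|].
  assert (hk : 0 < INR k) by (apply lt_0_INR; lia).
  assert (hu := hup k ltac:(lia)).
  assert (hMk := Mpow_ge1 m hm k). assert (hqk := hq k).
  replace (Rpower (INR k) (-1 - (alpha - 2))) with (INR k * Rpower (INR k) (- alpha)).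
  2:{ rewrite <- (Rpower_1 (INR k)) at 1 by exact hk. rewrite <- Rpower_plus. f_equal. ring. }
  assert (hx : 0 <= q k * M ^ k) by (apply Rmult_le_pos; lra).
  assert (q k <= q k * M ^ k) by nra.
  assert (h3 : (M - 1) * INR k * (q k * M ^ k) <= M * INR k * (C * Rpower (INR k) (- alpha))).
  { apply Rmult_le_compat; try assumption; nra. }
  lra. }
nra.
Qed.

(** k^(3-alpha) is split into k^(4-alpha+h) and k^(-1-h); the slack [h] keeps the remaining sum
    bounded in [l] even at alpha = 4, where the sum without it would be logarithmic. *)
Lemma trunc_T h : 0 < h -> sum_f_R0 (fun i => trunc l p q i * (2 * INR i ^ 3 * M ^ i)) l <=
  2 * C * (1 + 1 / h) * Rpower (INR l) (4 - alpha + h).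
Proof.
intros hh. rewrite trunc_sum by lia. simpl (INR 0). simpl (0 ^ 3).
replace ((1 - p * sum_f_R0 q l) * (2 * (0 * (0 * (0 * 1))) * M ^ 0)) with 0 by ring.
set (B := 2 * C * Rpower (INR l) (4 - alpha + h)).
assert (hB : 0 <= B).
{ unfold B. assert (hr := Rpower_pos (INR l) (4 - alpha + h)). repeat apply Rmult_le_pos; lra. }
assert (hsum : sum_f_R0 (fun i => q i * (2 * INR i ^ 3 * M ^ i)) l <= B * (1 + 1 / h)).
{ apply Rle_trans with (sum_f_R0 (fun i => ((if Nat.eqb i 1 then 1 else 0) + (if (i <=? 1)%nat then 0 else Rpower (INR i) (- 1 - h))) * B) l).
  - apply sum_Rle. intros i hi.
    destruct i as [|i]; [rewrite hq0; simpl; lra|].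
    set (k := Datatypes.S i) in *.
    assert (hk : 0 < INR k) by (apply lt_0_INR; lia).
    assert (hu := hup k ltac:(lia)).
    assert (e3 : INR k ^ 3 * Rpower (INR k) (- alpha) = Rpower (INR k) (4 - alpha + h) * Rpower (INR k) (- 1 - h)).
    { rewrite <- (Rpower_pow 3) by exact hk. rewrite <- !Rpower_plus. f_equal. simpl. ring. }
    (* Here alpha <= 4 enters: the exponent is nonnegative, so the power is largest at [l]. *)
    assert (hle : Rpower (INR k) (4 - alpha + h) <= Rpower (INR l) (4 - alpha + h)).
    { apply Rle_Rpower_l; [lra|]. split; [exact hk|apply le_INR; exact hi]. }
    assert (hp1 := Rpower_pos (INR k) (- 1 - h)).
    assert (hk3 : 0 <= INR k ^ 3) by (apply pow_le; lra).
    assert (h1 : q k * (2 * INR k ^ 3 * M ^ k) <= B * Rpower (INR k) (- 1 - h)).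
    { apply Rle_trans with (2 * INR k ^ 3 * (C * Rpower (INR k) (- alpha))).
      - replace (q k * (2 * INR k ^ 3 * M ^ k)) with (2 * INR k ^ 3 * (q k * M ^ k)) by ring.
        apply Rmult_le_compat_l; [lra|exact hu].
      - replace (2 * INR k ^ 3 * (C * Rpower (INR k) (- alpha))) with (2 * C * (INR k ^ 3 * Rpower (INR k) (- alpha))) by ring.
        rewrite e3. unfold B. rewrite (Rmult_assoc (2 * C)). apply Rmult_le_compat_l; [lra|].
        apply Rmult_le_compat_r; lra. }
    apply Rle_trans with (1 := h1). rewrite Rmult_comm. apply Rmult_le_compat_r; [exact hB|].
    destruct i as [|i]; subst k.
    + simpl. right. unfold Rpower. rewrite ln_1, Rmult_0_r, exp_0. ring.
    + simpl Nat.eqb. simpl Nat.leb. cbv iota. lra.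
  - rewrite <- scal_sum. apply Rmult_le_compat_l; [exact hB|]. rewrite plus_sum.
    apply Rplus_le_compat.
    + apply Rle_trans with (sum_f_R0 (fun i => if Nat.eqb i 1 then 1 else 0) (Nat.max 1 l)).
      * apply sum_mono; [intros i; destruct (Nat.eqb i 1); lra|lia].
      * right. assert (hc : forall n, sum_f_R0 (fun i => if Nat.eqb i 1 then 1 else 0) (Datatypes.S n) = 1).
        { induction n as [|n IHn]; [simpl; ring|]. rewrite tech5, IHn. simpl. ring. }
        replace (Nat.max 1 l) with (Datatypes.S (pred l)) by lia. apply hc.
    + apply Rle_trans with (1 := power_tail_sum h 1 l hh ltac:(lia)).
      right. simpl (INR 1). f_equal. unfold Rpower. rewrite ln_1, Rmult_0_r, exp_0. reflexivity. }
assert (hs0 : 0 <= sum_f_R0 (fun i => q i * (2 * INR i ^ 3 * M ^ i)) l).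
{ apply cond_pos_sum. intros k. assert (hqk := hq k). assert (hMk := Mpow_ge1 m hm k).
  assert (0 <= INR k ^ 3) by (apply pow_le, pos_INR). apply Rmult_le_pos; [exact hqk|]. apply Rmult_le_pos; lra. }
unfold B in hsum. nra.
Qed.
End Truncation.

(** * Lower bound for the free energy *)

Section Lower.
Variables (m : nat) (q : nat -> R) (c0 alpha S : R).
Hypotheses (hm : (2 <= m)%nat) (hq : nonneg q) (hq0 : q 0%nat = 0) (hq1 : ser q 1)
  (hc0 : 0 < c0) (halpha : 2 < alpha <= 4)
  (hasympt : Un_cv (fun k => q k / (c0 * / INR m ^ k * Rpower (INR k) (- alpha))) 1)
  (hS : ser (fun k => q k * ((INR m - 1) * INR k - 1) * INR m ^ k) S).
Notation M := (INR m).
Notation pc := (1 / (1 + S)).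
Notation nu := (1 / (alpha - 2)).

Lemma free_energy_lower d : 0 < d -> for_large (fun x => forall p F, p = pc + / x -> p <= 1 ->
  (forall n, (mean m (mix p q) n - 1) / M ^ n <= F) -> exp (- Rpower x (nu + 4 * d)) <= F).
Proof.
intros hd. assert (hM := m_ge2 m hm). assert (hS0 := S_ge0 m q S hm hq hq0 hS).
destruct (q_bounds m q c0 alpha hm hq hc0 hasympt) as [kc [C [hC [hup _]]]].
assert (hpc : 0 < pc) by (apply Rdiv_lt_0_compat; lra).
assert (ha : 0 < alpha - 2) by lra.
assert (hnu : 0 < nu) by (apply Rdiv_lt_0_compat; lra).
assert (hda : 0 < d * (alpha - 2)) by (apply Rmult_lt_0_compat; lra).
assert (enu : (nu + d) * (alpha - 2) = 1 + d * (alpha - 2)) by (field; lra).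
(* Gives (nu+d)(alpha-2-h) = 1 + d(alpha-2)/2: half of the margin won by truncating above x^nu pays
   for the slack [h], the other half beats constants. *)
set (h := d * (alpha - 2) / (2 * (nu + d))).
assert (hh : 0 < h) by (apply Rdiv_lt_0_compat; lra).
assert (eh : (nu + d) * h = d * (alpha - 2) / 2) by (unfold h; field; lra).
set (K := 288 * M * (M + 3) ^ 3).
assert (hK : 0 < K) by (apply Rmult_lt_0_compat; [lra|apply pow_lt; lra]).
(* Rates in z = x^d: the rounding l <= 2 y1 yields B eta / M >= c1 z, and B <= 2 y2 yields J / (6 M
   B) >= c2 z. *)
set (c1 := / (8 * K * M)). set (c2 := / (12 * M)).
assert (hKM : 0 < 8 * K * M) by (repeat apply Rmult_lt_0_compat; lra).
assert (hc1 : 0 < c1) by (apply Rinv_0_lt_compat; exact hKM).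
assert (hc2 : 0 < c2) by (apply Rinv_0_lt_compat; lra).
(* Collects the factors of M (4 y2)^2 (4M) (2M)(8 K y1), which is W y2^2 y1; in the loss condition 4
   M y2 replaces 4 y2, hence the additional M * M. *)
set (W := M * (16 * (4 * M)) * (2 * M) * (8 * K)).
assert (hW : 0 < W) by (unfold W; repeat apply Rmult_lt_0_compat; lra).
assert (hlM : 0 < ln M) by (rewrite <- ln_1; apply ln_increasing; lra).
assert (E1 := for_large_pow 1 (1 + d * (alpha - 2)) (2 * (M * C / (alpha - 2))) ltac:(lra)).
assert (E2 := for_large_pow 1 (1 + d * (alpha - 2) / 2) (4 * C * (1 + 1 / h)) ltac:(lra)).
assert (E3 := for_large_exp 1 d c1 (4 + 4 * (M + 2)) hd hc1 ltac:(lra)).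
assert (hMW : 0 < M * M * W) by (repeat apply Rmult_lt_0_compat; lra).
assert (E4 := for_large_exp (3 * nu + 5 * d) d c1 (M * M * W) hd hc1 hMW).
assert (E5 := for_large_exp (3 * nu + 5 * d) d c2 (2 * W) hd hc2 ltac:(lra)).
assert (E6 := for_large_pow (nu + 3 * d) (nu + 4 * d) (ln M * (5 + 2 * M)) ltac:(lra)).
apply for_large_imp with (2 := for_large_and _ _ (for_large_gt (2 * (1 + S))) (for_large_and _ _ E1 (for_large_and _ _ E2 (for_large_and _ _ E3 (for_large_and _ _ E4 (for_large_and _ _ E5 E6)))))).
intros x [hx [e1 [e2 [e3 [e4 [e5 e6]]]]]] p F hp hp1 hF.
assert (hx0 : 0 < / x) by (apply Rinv_0_lt_compat; lra).
assert (hp0 : 0 <= p <= 1) by lra.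
rewrite !Rpower_1 in * by lra.
(* Scales of the truncation level [l], the support bound [B] and the number of steps [J];
   consecutive ones differ by the factor [z]. *)
set (y1 := Rpower x (nu + d)). set (y2 := Rpower x (nu + 2 * d)). set (y3 := Rpower x (nu + 3 * d)).
set (z := Rpower x d). fold z in e3, e4, e5.
assert (hy1 : 1 <= y1) by (apply Rpower_ge1; lra).
assert (hy2 : 1 <= y2) by (apply Rpower_ge1; lra).
assert (hy3 : 1 <= y3) by (apply Rpower_ge1; lra).
assert (hz : 1 <= z) by (apply Rpower_ge1; lra).
assert (ey2 : y2 = y1 * z) by (unfold y1, y2, z; rewrite <- Rpower_plus; f_equal; ring).
assert (ey3 : y3 = y2 * z) by (unfold y3, y2, z; rewrite <- Rpower_plus; f_equal; ring).
assert (ey : Rpower x (3 * nu + 5 * d) = y2 ^ 2 * y1).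
{ unfold y1, y2. simpl. rewrite Rmult_1_r, <- !Rpower_plus. f_equal. ring. }
rewrite ey in e4, e5. clear ey.
destruct (nat_ceil y1 hy1) as [l [hl1 hl]].
destruct (nat_ceil y2 hy2) as [B [hB1 hB]].
destruct (nat_ceil y3 hy3) as [J [hJ1 hJ]].
assert (hf := mix_nonneg q hq p hp0). assert (h1 := mix_ser q hq1 p).
destruct (mix_mean m q S hm hq hq0 hS p hp0) as [e he].
set (A := sum_f_R0 (fun i => trunc l p q i * (((M - 1) * INR i - 1) * M ^ i)) l).
assert (hAle : A <= p * (1 + S) - 1) by (eapply trunc_A_le; eassumption).
assert (hAge : p * (1 + S) - 1 - M * C / (alpha - 2) * Rpower (INR l) (2 - alpha) <= A)
  by (eapply trunc_A_ge; eassumption).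
assert (hT : sum_f_R0 (fun i => trunc l p q i * (2 * INR i ^ 3 * M ^ i)) l <=
  2 * C * (1 + 1 / h) * Rpower (INR l) (4 - alpha + h)) by (eapply trunc_T; eassumption).
assert (ht0 : nonneg (trunc l p q)) by (eapply trunc_nonneg; eassumption).
assert (ht1 : forall i, (l < i)%nat -> trunc l p q i = 0) by (intros; eapply trunc_supp; eassumption).
assert (ht2 : sum_f_R0 (trunc l p q) l = 1) by (eapply trunc_total; eassumption).
assert (ht3 : dom (mix p q) (trunc l p q)) by (eapply dom_trunc; eassumption).
assert (ep : p * (1 + S) - 1 = (1 + S) / x) by (rewrite hp; field; lra).
rewrite ep in *.
assert (hlp : 0 < INR l) by lra.
assert (hloss : M * C / (alpha - 2) * Rpower (INR l) (2 - alpha) <= / (2 * x)).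
{ assert (i1 : Rpower (INR l) (2 - alpha) <= / Rpower x (1 + d * (alpha - 2))).
  { replace (2 - alpha) with (- (alpha - 2)) by ring. rewrite Rpower_Ropp.
    apply Rinv_le_contravar; [apply Rpower_pos|]. rewrite <- enu, <- Rpower_mult. fold y1.
    apply Rle_Rpower_l; lra. }
  assert (hMC : 0 < M * C / (alpha - 2)) by (apply Rdiv_lt_0_compat; [apply Rmult_lt_0_compat; lra|lra]).
  set (D := M * C / (alpha - 2)) in *. set (P := Rpower x (1 + d * (alpha - 2))) in *.
  assert (hP : 0 < P) by apply Rpower_pos.
  apply Rle_trans with (D * / P); [apply Rmult_le_compat_l; lra|].
  apply Rmult_le_reg_r with (2 * x * P); [apply Rmult_lt_0_compat; lra|].
  replace (D * / P * (2 * x * P)) with (2 * D * x) by (field; lra).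
  replace (/ (2 * x) * (2 * x * P)) with P by (field; lra). exact e1. }
assert (i2x : / (2 * x) = / x / 2) by (field; lra).
assert (hSx : / x <= (1 + S) / x) by (unfold Rdiv; nra).
assert (hA0 : / (2 * x) <= A) by lra.
assert (h2x : 0 < / (2 * x)) by (apply Rinv_0_lt_compat; lra).
assert (hA1 : A <= 1 / 2).
{ apply Rle_trans with (1 := hAle). apply Rmult_le_reg_r with x; [lra|].
  unfold Rdiv at 1. rewrite Rmult_assoc, Rinv_l; lra. }
assert (hT' : sum_f_R0 (fun i => trunc l p q i * (2 * INR i ^ 3 * M ^ i)) l <= A * INR l ^ 2).
{ apply Rle_trans with (1 := hT). apply Rle_trans with (/ (2 * x) * INR l ^ 2).
  2:{ apply Rmult_le_compat_r; [apply pow_le; lra|exact hA0]. }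
  replace (INR l ^ 2) with (Rpower (INR l) (alpha - 2 - h) * Rpower (INR l) (4 - alpha + h)).
  2:{ rewrite <- Rpower_plus, <- (Rpower_pow 2) by exact hlp. f_equal. simpl. ring. }
  rewrite <- Rmult_assoc. apply Rmult_le_compat_r; [left; apply Rpower_pos|].
  assert (i1 : Rpower x (1 + d * (alpha - 2) / 2) <= Rpower (INR l) (alpha - 2 - h)).
  { replace (1 + d * (alpha - 2) / 2) with ((nu + d) * (alpha - 2 - h)) by (rewrite Rmult_minus_distr_l, enu, eh; lra).
    rewrite <- Rpower_mult. fold y1. apply Rle_Rpower_l; [|lra].
    apply Rmult_le_reg_l with (nu + d); [lra|]. rewrite Rmult_minus_distr_l, enu, eh; lra. }
  apply Rmult_le_reg_l with (2 * x); [lra|].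
  replace (2 * x * (/ (2 * x) * Rpower (INR l) (alpha - 2 - h))) with (Rpower (INR l) (alpha - 2 - h)) by (field; lra).
  lra. }
set (eta := / (4 * K * INR l)). set (r := (M - eta) / M).
assert (heta : / (8 * K * y1) <= eta).
{ apply Rinv_le_contravar; [repeat apply Rmult_lt_0_compat; lra|].
  replace (8 * K * y1) with (4 * K * (2 * y1)) by ring. apply Rmult_le_compat_l; lra. }
assert (hKl : 1 <= 4 * K * INR l).
{ assert (1 <= K). { unfold K. assert (1 <= (M + 3) ^ 3) by (apply pow_R1_Rle; lra). nra. } nra. }
assert (heta0 : 0 < eta) by (apply Rinv_0_lt_compat; lra).
assert (heta1 : eta <= 1) by (unfold eta; rewrite <- Rinv_1; apply Rinv_le_contravar; lra).
assert (hetaM : 0 <= eta / M <= 1).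
{ split; [apply Rdiv_le_0_compat; lra|]. apply Rmult_le_reg_r with M; [lra|]. unfold Rdiv. rewrite Rmult_assoc, Rinv_l; lra. }
assert (hr : r ^ B <= exp (- (c1 * z))).
{ replace r with (1 - eta / M) by (unfold r; field; lra).
  apply Rle_trans with (1 := pow_sub_exp _ B hetaM). apply exp_mono. apply Ropp_le_contravar.
  apply Rle_trans with (y2 * (/ (8 * K * y1) / M)).
  - right. rewrite ey2. unfold c1. field. lra.
  - apply Rmult_le_compat; [lra| |lra|].
    + apply Rdiv_le_0_compat; [left; apply Rinv_0_lt_compat; repeat apply Rmult_lt_0_compat; lra|lra].
    + apply Rmult_le_compat_r; [left; apply Rinv_0_lt_compat; lra|exact heta]. }
assert (hr0 : 0 <= r ^ B).
{ apply pow_le. unfold r. apply Rdiv_le_0_compat; lra. }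
assert (hexp1 := exp_pos (- (c1 * z))).
assert (hstart : r ^ B * (4 + 2 * (M + 2) / A) <= 1).
{ apply Rle_trans with (2 := e3). rewrite Rmult_comm. apply Rmult_le_compat; [|exact hr0| |exact hr].
  - assert (0 <= 2 * (M + 2) / A) by (apply Rdiv_le_0_compat; lra). lra.
  - assert (/ A <= 2 * x).
    { rewrite <- (Rinv_inv (2 * x)). apply Rinv_le_contravar; lra. }
    unfold Rdiv. nra. }
assert (hmB : INR (Datatypes.S (m * B)) <= 4 * M * y2).
{ rewrite S_INR, mult_INR. nra. }
assert (hBS : INR (Datatypes.S B) <= 4 * y2) by (rewrite S_INR; lra).
assert (hlossB : M * (INR (Datatypes.S (m * B)) ^ 2 * (4 * M) * r ^ B) <= eta / (2 * M)).
{ apply Rle_trans with (/ (8 * K * y1) / (2 * M)).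
  2:{ apply Rmult_le_compat_r; [left; apply Rinv_0_lt_compat; lra|exact heta]. }
  apply Rle_trans with (M * ((4 * M * y2) ^ 2 * (4 * M) * exp (- (c1 * z)))).
  - apply Rmult_le_compat_l; [lra|]. apply Rmult_le_compat; [|exact hr0| |exact hr].
    + apply Rmult_le_pos; [apply pow_le, pos_INR|lra].
    + apply Rmult_le_compat_r; [lra|]. apply pow_incr. split; [apply pos_INR|exact hmB].
  - apply Rmult_le_reg_r with (2 * M * (8 * K * y1)); [repeat apply Rmult_lt_0_compat; lra|].
    replace (/ (8 * K * y1) / (2 * M) * (2 * M * (8 * K * y1))) with 1 by (field; lra).
    apply Rle_trans with (2 := e4). right. unfold W. ring. }
assert (hgrow : M * (INR (Datatypes.S B) ^ 2 * (4 * M)) < (1 + / (3 * M * INR B)) ^ J * (eta / (2 * M))).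
{ assert (h3 : 1 <= 3 * M * INR B) by nra.
  assert (h3' : 0 <= / (3 * M * INR B) <= 1).
  { split; [left; apply Rinv_0_lt_compat; lra|]. rewrite <- Rinv_1. apply Rinv_le_contravar; lra. }
  assert (hex : exp (c2 * z) <= (1 + / (3 * M * INR B)) ^ J).
  { apply Rle_trans with (2 := pow_add_exp _ J h3'). apply exp_mono.
    apply Rle_trans with (y3 * (/ (3 * M * (2 * y2)) / 2)).
    - right. rewrite ey3. unfold c2. field. lra.
    - apply Rmult_le_compat; [lra| |lra|].
      + apply Rdiv_le_0_compat; [left; apply Rinv_0_lt_compat; repeat apply Rmult_lt_0_compat; lra|lra].
      + apply Rmult_le_compat_r; [lra|]. apply Rinv_le_contravar; [lra|]. apply Rmult_le_compat_l; lra. }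
  assert (hexp2 := exp_pos (c2 * z)).
  rewrite exp_Ropp in e5.
  apply Rlt_le_trans with (exp (c2 * z) * (/ (8 * K * y1) / (2 * M))).
  2:{ assert (0 < / (8 * K * y1)) by (apply Rinv_0_lt_compat; repeat apply Rmult_lt_0_compat; lra).
      assert (0 < / (2 * M)) by (apply Rinv_0_lt_compat; lra).
      apply Rmult_le_compat; [lra|apply Rdiv_le_0_compat; lra|exact hex|].
      apply Rmult_le_compat_r; lra. }
  assert (hWy : 2 * (W * (y2 ^ 2 * y1)) <= exp (c2 * z)).
  { apply Rmult_le_compat_r with (r := exp (c2 * z)) in e5; [|lra].
    rewrite Rmult_assoc, Rinv_l in e5 by lra. lra. }
  assert (hWp : 0 < W * (y2 ^ 2 * y1)).
  { apply Rmult_lt_0_compat; [exact hW|]. apply Rmult_lt_0_compat; [apply pow_lt; lra|lra]. }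
  apply Rmult_lt_reg_r with (2 * M * (8 * K * y1)); [repeat apply Rmult_lt_0_compat; lra|].
  replace (exp (c2 * z) * (/ (8 * K * y1) / (2 * M)) * (2 * M * (8 * K * y1))) with (exp (c2 * z)) by (field; lra).
  apply Rle_lt_trans with (W * (y2 ^ 2 * y1)); [|lra].
  apply Rle_trans with (M * ((4 * y2) ^ 2 * (4 * M)) * (2 * M * (8 * K * y1))).
  - apply Rmult_le_compat_r; [left; repeat apply Rmult_lt_0_compat; lra|].
    apply Rmult_le_compat_l; [lra|]. apply Rmult_le_compat_r; [lra|].
    apply pow_incr. split; [apply pos_INR|exact hBS].
  - right. unfold W. ring. }
assert (hx1 : forall n i, sum_f_R0 (law m (mix p q) n) i <= 1).
{ intros n i. apply (ser_partial_le _ _ i (law_mass m (mix p q) hf h1 n)). apply law_nonneg; exact hf. }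
destruct (tail_overflow m (trunc l p q) (mix p q) l l B J (4 * M) hm
  ht0 ht1 ht2
  (Rlt_le_trans _ _ _ h2x hA0) hA1 hT' ltac:(lia) ltac:(lia) ltac:(lra) hstart hlossB hgrow
  hf hx1 ht3) as [n [i [hn [hi hlt]]]].
assert (hmean := mean_tail m (mix p q) e hm hf h1 he n i).
(* The threshold H = 4 m leaves a mean above 4 at time n + i, so that the mean minus 1 is at least
   1. *)
assert (hgt : 4 < M ^ i * (1 - sum_f_R0 (law m (mix p q) n) i)).
{ apply Rmult_lt_reg_r with M; [lra|]. simpl pow in hlt. lra. }
assert (hpn : 0 < M ^ (n + i)) by (apply pow_lt; lra).
apply Rle_trans with (2 := hF (n + i)%nat).
apply Rle_trans with (1 / M ^ (n + i)).
2:{ apply Rmult_le_compat_r; [left; apply Rinv_0_lt_compat; exact hpn|lra]. }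
replace (1 / M ^ (n + i)) with (exp (- INR (n + i) * ln M)).
2:{ unfold Rdiv. rewrite Rmult_1_l, <- Rpower_pow by lra. rewrite <- Rpower_Ropp. reflexivity. }
apply exp_mono.
assert (hni : INR (n + i) <= (5 + 2 * M) * y3).
{ apply Rle_trans with (INR (l + J + 1 + m * B)); [apply le_INR; lia|].
  rewrite !plus_INR, mult_INR. simpl (INR 1).
  assert (y1 <= y2) by nra. assert (y2 <= y3) by nra. nra. }
apply Rmult_le_compat_l with (r := ln M) in hni; [|lra]. fold y3 in e6. lra.
Qed.
End Lower.

Theorem theorem1p2 (m : nat) (q : nat -> R) (c0 alpha : R)
  (hm : (2 <= m)%nat)
  (hq_nonneg : forall k, 0 <= q k)
  (hq0 : q 0%nat = 0)
  (hq_sum : infinite_sum q 1)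
  (hc0 : 0 < c0)
  (halpha : 2 < alpha <= 4)
  (hasympt : Un_cv (fun k => q k / (c0 * / INR m ^ k * Rpower (INR k) (- alpha))) 1)
  (S : R)
  (hS : infinite_sum (fun k => q k * ((INR m - 1) * INR k - 1) * INR m ^ k) S) :
  let pc := 1 / (1 + S) in
  let nu := 1 / (alpha - 2) in
  forall eps : R, 0 < eps ->
  exists delta : R, 0 < delta /\
    forall p : R, pc < p -> p < pc + delta -> p <= 1 ->
      exists F : R, is_free_energy m (mix p q) F /\
        exp (- Rpower (p - pc) (- (nu + eps))) <= F /\
        F <= exp (- Rpower (p - pc) (- (nu - eps))).
Proof.
intros pc nu eps heps.
apply is_series_Reals in hq_sum. apply is_series_Reals in hS.
assert (hS0 := S_ge0 m q S hm hq_nonneg hq0 hS).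
assert (hnu : 0 < nu) by (apply Rdiv_lt_0_compat; lra).
assert (hpc : 0 < pc) by (apply Rdiv_lt_0_compat; lra).
(* The upper bound asks for a loss below [nu]; capping it at nu/2 only strengthens the resulting
   estimate. *)
assert (he' : 0 < Rmin eps (nu / 2)) by (apply Rmin_glb_lt; lra).
assert (he2 : 0 < Rmin eps (nu / 2) < nu) by (generalize (Rmin_r eps (nu / 2)); lra).
assert (U := free_energy_upper m q c0 alpha S hm hq_nonneg hq0 hq_sum hc0 (proj1 halpha) hasympt hS
  (Rmin eps (nu / 2)) he2).
assert (L := free_energy_lower m q c0 alpha S hm hq_nonneg hq0 hq_sum hc0 halpha hasympt hS (eps / 4) ltac:(lra)).
destruct (for_large_and _ _ U L) as [X hX].
set (X1 := Rmax X 1). assert (hX1 := Rmax_l X 1). assert (hX2 := Rmax_r X 1). fold X1 in hX1, hX2.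
exists (/ X1). split; [apply Rinv_0_lt_compat; lra|].
intros p hp1 hp2 hp3.
set (x := / (p - pc)).
assert (hx : X1 < x).
{ unfold x. rewrite <- (Rinv_inv X1). apply Rinv_lt_contravar; [|lra].
  apply Rmult_lt_0_compat; [lra|apply Rinv_0_lt_compat; lra]. }
assert (ex : p - pc = / x) by (unfold x; rewrite Rinv_inv; reflexivity).
destruct (hX x ltac:(lra)) as [hU hL].
assert (hp0 : 0 <= p <= 1) by lra.
destruct (mix_mean m q S hm hq_nonneg hq0 hS p hp0) as [e he].
destruct (free_energy m (mix p q) e hm (mix_nonneg q hq_nonneg p hp0) (mix_ser q hq_sum p) he) as [F [hF hFn]].
exists F. split; [exact hF|].
assert (ep : p = pc + / x) by lra.
rewrite ex, !Rpower_inv by lra. split.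
- replace eps with (4 * (eps / 4)) by field. apply (hL p F ep hp3). apply hFn.
- apply Rle_trans with (1 := hU p F ep hp3 (fun n => proj2 (hFn n))).
  apply exp_mono, Ropp_le_contravar, Rle_Rpower; [lra|].
  assert (h := Rmin_l eps (nu / 2)). fold nu. lra.
Qed.
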